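(* Consider max-min fair allocation with $k$ persons and $m$ goods, where person $i$ has a non-negative integer valuation $u_{i,j}$ for good $j$, and $u_{i,S}=\sum_{j\in S}u_{i,j}$. Let $T>0$ and $\lambda = 2\sqrt{k}\sqrt{\log k/\log\log k}$. Call good $j$ small for person $i$ if $u_{i,j}<T/\lambda$ and big otherwise. A configuration (set of goods) $S$ is valid for person $i$ if either all goods in $S$ are small for $i$ and $u_{i,S}\ge T$, or $S=\{j\}$ for a single good $j$ that is big for $i$; let $C(i,T)$ be the set of valid configurations for $i$. The configuration LP has variables $x_{i,S}\ge 0$ for persons $i$ and $S\in C(i,T)$, with constraints $\sum_i\sum_{S\ni j}x_{i,S}\le 1$ for every good $j$ and $\sum_{S\in C(i,T)}x_{i,S}=1$ for every person $i$. Then any feasible solution of this configuration LP can be rounded in polynomial time (by a randomized algorithm) to an integral allocation, in which each good is given to at most one person, such that with high probability every person $i$ receives utility at least $T\big/\Theta\!\left(\sqrt{k\log k/\log\log k}\right)$.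
   Context: $T$ plays the role of the (guessed) optimum max-min value, i.e. the largest value such that some allocation gives every person utility at least $T$. *)

(* Defs.v *)
From HB Require Import structures.
From mathcomp Require Import all_boot all_order all_algebra.
From mathcomp Require Import reals exp.

Set Implicit Arguments.
Unset Strict Implicit.
Unset Printing Implicit Defensive.

Import Order.TTheory GRing.Theory Num.Theory.

(** * Randomized algorithms and their running time

    Algorithms are WHILE programs over S-expressions with natural-number
    atoms, extended with a fair coin flip.  The cost is logarithmic: numbers
    count with their binary length and every subexpression is charged the full
    size of its value, so that, up to a polynomial, the cost is the running
    time of a probabilistic Turing machine. *)

Inductive sexp := Nat of nat | Pair of sexp & sexp.

Fixpoint vsize (v : sexp) : nat :=
  match v with
  | Nat n => (trunc_log 2 n).+1
  | Pair v1 v2 => (vsize v1 + vsize v2).+1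
  end.

Definition vnat (v : sexp) : nat := if v is Nat n then n else 0.
Definition vhd (v : sexp) : sexp := if v is Pair v1 _ then v1 else Nat 0.
Definition vtl (v : sexp) : sexp := if v is Pair _ v2 then v2 else Nat 0.
Definition visnat (v : sexp) : bool := if v is Nat _ then true else false.

(* [Nat 0] is both "false" and the empty list. *)
Definition vtrue (v : sexp) : bool := if v is Nat 0 then false else true.

Inductive op1 := OHd | OTl | OIsNat.
Inductive op2 := OCons | OAdd | OSub | OMul | ODiv | OLeq.

Inductive expr :=
  | Var of nat
  | Const of nat
  | Un of op1 & expr
  | Bin of op2 & expr & expr.

Inductive cmd :=
  | Skip
  | Assign of nat & expr
  | Flip of nat
  | Seq of cmd & cmd
  | If of expr & cmd & cmd
  | While of expr & cmd.

Definition store := nat -> sexp.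

Definition upd (s : store) (x : nat) (v : sexp) : store :=
  fun y => if y == x then v else s y.

Definition eval1 (o : op1) (v : sexp) : sexp :=
  match o with
  | OHd => vhd v
  | OTl => vtl v
  | OIsNat => Nat (visnat v)
  end.

Definition eval2 (o : op2) (v1 v2 : sexp) : sexp :=
  match o with
  | OCons => Pair v1 v2
  | OAdd => Nat (vnat v1 + vnat v2)
  | OSub => Nat (vnat v1 - vnat v2)
  | OMul => Nat (vnat v1 * vnat v2)
  | ODiv => Nat (vnat v1 %/ vnat v2)
  | OLeq => Nat (vnat v1 <= vnat v2)
  end.

Fixpoint eval (s : store) (e : expr) : sexp :=
  match e with
  | Var x => s x
  | Const n => Nat n
  | Un o e1 => eval1 o (eval s e1)
  | Bin o e1 e2 => eval2 o (eval s e1) (eval s e2)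
  end.

Fixpoint ecost (s : store) (e : expr) : nat :=
  vsize (eval s e) +
  match e with
  | Var _ | Const _ => 0
  | Un _ e1 => ecost s e1
  | Bin _ e1 e2 => ecost s e1 + ecost s e2
  end.

(* [exec c s w s' w' t]: from the store [s] and the tape [w] of unread random
   bits, [c] terminates in [s'] at cost [t], leaving the bits [w'].  A flip on
   an empty tape is stuck. *)
Inductive exec :
  cmd -> store -> seq bool -> store -> seq bool -> nat -> Prop :=
  | ExSkip s w : exec Skip s w s w 1
  | ExAssign x e s w :
      exec (Assign x e) s w (upd s x (eval s e)) w (ecost s e).+1
  | ExFlip x s b w : exec (Flip x) s (b :: w) (upd s x (Nat b)) w 1
  | ExSeq c1 c2 s w s1 w1 t1 s2 w2 t2 :
      exec c1 s w s1 w1 t1 -> exec c2 s1 w1 s2 w2 t2 ->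
      exec (Seq c1 c2) s w s2 w2 (t1 + t2)
  | ExIf e c1 c2 s w s1 w1 t :
      exec (if vtrue (eval s e) then c1 else c2) s w s1 w1 t ->
      exec (If e c1 c2) s w s1 w1 (ecost s e + t)
  | ExWhileF e c s w :
      ~~ vtrue (eval s e) -> exec (While e c) s w s w (ecost s e)
  | ExWhileT e c s w s1 w1 t1 s2 w2 t2 :
      vtrue (eval s e) -> exec c s w s1 w1 t1 ->
      exec (While e c) s1 w1 s2 w2 t2 ->
      exec (While e c) s w s2 w2 (ecost s e + t1 + t2).

(* Input and output are held in variable 0; all other variables start at 0. *)
Definition runs (c : cmd) (input : sexp) (w : seq bool) (output : sexp)
    (t : nat) : Prop :=
  exists s' w', exec c (upd (fun=> Nat 0) 0 input) w s' w' t /\ s' 0 = output.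

Definition vlist (l : seq sexp) : sexp := foldr Pair (Nat 0) l.

(* Only used for nonnegative rationals, hence no sign. *)
Definition vrat (q : rat) : sexp := Pair (Nat `|numq q|) (Nat `|denq q|).

Local Open Scope ring_scope.

(* The probability of [E] for [N] independent fair bits. *)
Definition Pr (R : realType) (N : nat) (E : N.-tuple bool -> bool) : R :=
  #|[set w | E w]|%:R / 2 ^+ N.

(** * Max-min fair allocation and the configuration LP *)

Definition lambda (R : realType) (k : nat) : R :=
  2 * Num.sqrt k%:R * Num.sqrt (ln k%:R / ln (ln k%:R)).

Section MaxMin.
Variables (R : realType) (k m : nat) (u : 'I_k -> 'I_m -> nat) (T : rat).

Definition util (i : 'I_k) (S : {set 'I_m}) : nat := (\sum_(j in S) u i j)%N.

Definition small (i : 'I_k) (j : 'I_m) : bool :=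
  (u i j)%:R < ratr T / lambda R k.

Definition big (i : 'I_k) (j : 'I_m) : bool := ~~ small i j.

Definition valid (i : 'I_k) (S : {set 'I_m}) : bool :=
  [forall j in S, small i j] && (T <= (util i S)%:R)
  || [exists j, (S == [set j]) && big i j].

(* The LP only has variables for valid configurations; a solution is extended
   by 0 to all pairs (person, set of goods). *)
Definition feasible (x : 'I_k -> {set 'I_m} -> rat) : Prop :=
  [/\ forall i S, 0 <= x i S,
      forall i S, ~~ valid i S -> x i S = 0,
      forall j, \sum_i \sum_(S : {set 'I_m} | valid i S && (j \in S)) x i S <= 1
    & forall i, \sum_(S : {set 'I_m} | valid i S) x i S = 1].

Definition allocation (A : 'I_k -> {set 'I_m}) : Prop :=
  forall i i', i != i' -> [disjoint A i & A i'].

(* [l] lists the nonzero entries of [x], each one once, in any order. *)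
Definition lists_support (x : 'I_k -> {set 'I_m} -> rat)
    (l : seq ('I_k * {set 'I_m})) : Prop :=
  uniq l /\ forall i S, ((i, S) \in l) = (x i S != 0).

Definition enc_entry (x : 'I_k -> {set 'I_m} -> rat)
    (p : 'I_k * {set 'I_m}) : sexp :=
  vlist [:: Nat p.1; vlist [seq Nat (j : 'I_m) | j <- enum p.2]; vrat (x p.1 p.2)].

Definition enc_input (x : 'I_k -> {set 'I_m} -> rat)
    (l : seq ('I_k * {set 'I_m})) : sexp :=
  vlist [:: Nat k; Nat m;
            vlist [seq vlist [seq Nat (u i j) | j <- enum 'I_m] | i <- enum 'I_k];
            vrat T;
            vlist [seq enc_entry x p | p <- l]].

(* An output is a list, in any order, of pairs (i, j): "good j goes to i". *)
Definition decodes_to (o : sexp) (A : 'I_k -> {set 'I_m}) : Prop :=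
  exists l : seq ('I_k * 'I_m),
    o = vlist [seq Pair (Nat p.1) (Nat p.2) | p : 'I_k * 'I_m <- l] /\
    forall i j, (j \in A i) = ((i, j) \in l).

End MaxMin.

(* Main.v *)
(** Since [lambda k / sqrt k] tends to infinity, for large [k] it is enough to
    give every person a big good or the value [T / O(sqrt k)]; this can even be
    done deterministically.

    Let [E] be the integer square root of [k], and let [n_j] be [E] times the
    part of good [j] not used by singleton configurations, rounded down.  Grow a
    set [X] of persons from the empty set.  The big goods of [X] and the goods
    with [n_j = 0] are killed; a configuration of small goods is alive if it
    keeps the value [T / 2]; a person is needy if alive configurations make up
    less than [1 / E] of its LP mass.  The next [X] is the least set [S] of needy
    persons that maximizes [2 |S| - sum (2 - n_j / E)] over the big goods [j] of
    [S].  At the fixpoint, the needy persons outside [X] satisfy Hall's condition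
    on the goods not killed by [X], even if [n_j / (2 E)] of each is set aside, and a count based on the
    LP constraints shows that dead configurations have total mass at most [1/2].

    While the persons of [X] violate Hall's condition for their big goods, some
    person of the least violating set is served by one of its alive
    configurations and leaves [X].  The configuration is chosen to minimize the
    growth of the potential [sum_j w_j (1 + E / n_j) ^ c_j], where [c_j] counts
    the claims on [j] so far and [w_j] is the LP-weighted share of [j] in the
    alive configurations.  At most half of the value of a configuration is lost
    by refusing a good that already has [16 n_j] claims.

    Finally the fractional shares of the persons served by small goods are
    rounded by slots, each adjacent to goods whose values agree up to a factor
    2.  The loads of slots and of persons waiting for a big good add up to at
    most 1 on every good, so by Hall's theorem, in the form of an auction, all
    of them can be matched at once. *)

Require Import Defs.
From HB Require Import structures.
From mathcomp Require Import all_boot all_order all_algebra.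
From mathcomp Require Import reals sequences exp.
From mathcomp Require Import zify ring lra.

Set Implicit Arguments.
Unset Strict Implicit.
Unset Printing Implicit Defensive.

(** * Polynomial time *)

(** The scale [E] balances three counts: needy persons keep live mass below 1/E each, so at most
    about [E] in total; a person who is not needy can still get value of order T/E; and a
    configuration of goods worth at most T / (C0 E) each dies only after losing order [E] goods. The
    obstacle is a circle: reserving big goods for critical persons kills small configurations, which
    makes further persons needy. Setting aside only half of [n_j / E] breaks it. So little small
    mass is killed. The resulting bound on the dead mass contains the dead mass itself, but with a
    small coefficient, as every dead configuration accounts for order [C0 * E] killed goods. The
    potential is an exponential moment of the claims: it stays polynomial in [k], while a good with
    too many claims would make it larger than that. No coin is flipped, so the success probability
    is 1, whatever the exponent [d]. *)

Class enc (A : Type) := encode : A -> sexp.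
#[export] Instance enc_nat : enc nat := Nat.
#[export] Instance enc_bool : enc bool := fun b : bool => Nat b.
#[export] Instance enc_unit : enc unit := fun=> Nat 0.
#[export] Instance enc_pair A B `{enc A} `{enc B} : enc (A * B) :=
  fun p => Pair (encode p.1) (encode p.2).
#[export] Instance enc_seq A `{enc A} : enc (seq A) :=
  fun l => vlist (map encode l).

Definition esize {A} `{enc A} (a : A) : nat := vsize (encode a).

Lemma vsize_gt0 v : 0 < vsize v. Proof. by case: v. Qed.

Lemma esize_gt0 A `{enc A} (a : A) : 0 < esize a. Proof. exact: vsize_gt0. Qed.

Lemma leq_expl a b n : a <= b -> a ^ n <= b ^ n.
Proof. by case: n => // n ab; rewrite leq_exp2r. Qed.

(** Sizes are positive, so the base is at least 2 and constants, sums and products of bounds again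
    have this one form. *)
Definition pb {A} `{enc A} (h : A -> nat) :=
  exists c, forall a, h a <= (esize a).+1 ^ c.

Section PolyBounds.
Context {A B : Type} `{enc A} `{enc B}.
Implicit Types h : A -> nat.

Lemma pb_le h1 h2 : (forall a, h1 a <= h2 a) -> pb h2 -> pb h1.
Proof. by move=> le12 [c h2c]; exists c => a; exact: leq_trans (h2c a). Qed.

Lemma pb_const n : pb (fun _ : A => n).
Proof.
exists n => a; apply: leq_trans (ltnW (ltn_expl n (isT : 1 < 2))) _.
by rewrite leq_expl // ltnS esize_gt0.
Qed.

Lemma pb_esize : pb (fun a : A => esize a).
Proof. by exists 1 => a; rewrite expn1. Qed.

Lemma pb_mul h1 h2 : pb h1 -> pb h2 -> pb (fun a => h1 a * h2 a).
Proof.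
by move=> [c1 H1] [c2 H2]; exists (c1 + c2) => a; rewrite expnD leq_mul.
Qed.

Lemma pb_add h1 h2 : pb h1 -> pb h2 -> pb (fun a => h1 a + h2 a).
Proof.
move=> [c1 H1] [c2 H2]; exists (c1 + c2).+1 => a.
have b2 : 1 < (esize a).+1 by rewrite ltnS esize_gt0.
have le c c' : c <= c' -> (esize a).+1 ^ c <= (esize a).+1 ^ c'.
  by move=> cc'; rewrite leq_exp2l.
rewrite expnS; apply: leq_trans (leq_mul b2 (leqnn _)).
rewrite mul2n -addnn leq_add //.
  by apply: leq_trans (H1 a) (le _ _ (leq_addr _ _)).
by apply: leq_trans (H2 a) (le _ _ (leq_addl _ _)).
Qed.

Lemma pb_comp (f : A -> B) (h : B -> nat) :
  pb (fun a => esize (f a)) -> pb h -> pb (fun a => h (f a)).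
Proof.
move=> [c Hc] [d Hd]; exists (c.+1 * d) => a.
apply: leq_trans (Hd (f a)) _; rewrite expnM.
case: d {Hd} => [|d]; first by [].
rewrite leq_exp2r //; apply: leq_ltn_trans (Hc a) _.
by rewrite ltn_exp2l // ltnS esize_gt0.
Qed.

End PolyBounds.

(** Variables other than 0 are arbitrary on entry, so that the program can run in the middle of
    another one. The number [n] is a frame condition: a caller keeps its own data in the variables
    from [n] on. The tape comes back unread. *)
Definition computes {A B} `{enc A} `{enc B} (f : A -> B) c n (tm : A -> nat) :=
  forall a s w, s 0 = encode a -> exists s' t,
    [/\ exec c s w s' w t, t <= tm a, s' 0 = encode (f a)
      & forall y, n <= y -> s' y = s y].

(** The output size is bounded together with the cost, because the second program of a composition
    is charged in the size of the intermediate value. *)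
Definition PT {A B} `{enc A} `{enc B} (f : A -> B) :=
  (exists c n tm, pb tm /\ computes f c n tm) /\ pb (fun a => esize (f a)).

Lemma computes_widen A B `{enc A} `{enc B} (f : A -> B) c n n' tm :
  n <= n' -> computes f c n tm -> computes f c n' tm.
Proof.
move=> nn' cf a s w s0; have [s' [t [? ? ? fr]]] := cf a s w s0.
by exists s', t; split=> // y n'y; rewrite fr // (leq_trans nn').
Qed.

Lemma esize_le (x y : nat) : x <= y -> esize x <= esize y.
Proof. by move=> xy; rewrite /esize /= ltnS leq_trunc_log. Qed.

Lemma esize_leS (x : nat) : esize x <= x.+1.
Proof.
rewrite /esize /= ltnS; case: x => [|x]; first by rewrite trunc_log0.
rewrite -ltnS; apply: leq_trans (ltn_expl _ (isT : 1 < 2)) _.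
by apply: leqW; exact: trunc_logP.
Qed.

Lemma esize_bound (x c : nat) : 0 < c -> x < 2 ^ c -> esize x <= c.
Proof.
move=> c0; case: x => [|x] xc; first by rewrite /esize /= trunc_log0.
rewrite /esize /=.
have := leq_ltn_trans (trunc_logP (isT : 1 < 2) (isT : 0 < x.+1)) xc.
by rewrite ltn_exp2l.
Qed.

Lemma lt_2esize (x : nat) : x < 2 ^ esize x.
Proof. exact: trunc_log_ltn. Qed.

Lemma esize_add (x y : nat) : esize (x + y) <= esize x + esize y.
Proof.
have hx := lt_2esize x; have hy := lt_2esize y.
have x0 := @esize_gt0 nat enc_nat x; have y0 := @esize_gt0 nat enc_nat y.
apply: esize_bound; first by rewrite addn_gt0 x0.
case: (leqP (esize x) (esize y)) => le.
  apply: (@leq_trans (2 ^ (esize y).+1)); last by rewrite leq_exp2l //; lia.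
  have : 2 ^ esize x <= 2 ^ esize y by rewrite leq_exp2l.
  rewrite expnS; lia.
apply: (@leq_trans (2 ^ (esize x).+1)); last by rewrite leq_exp2l //; lia.
have : 2 ^ esize y <= 2 ^ esize x by rewrite leq_exp2l // ltnW.
by rewrite expnS; lia.
Qed.

Lemma esize_mul (x y : nat) : esize (x * y) <= esize x + esize y.
Proof.
have hx := lt_2esize x; have hy := lt_2esize y.
case: x hx => [|x] hx; first by rewrite mul0n leq_addr.
case: y hy => [|y] hy; first by rewrite muln0 leq_addl.
apply: esize_bound; first by rewrite addn_gt0 esize_gt0.
by rewrite expnD; exact: ltn_mul.
Qed.

Lemma PT_pb A B `{enc A} `{enc B} (f : A -> B) : PT f -> pb (fun a => esize (f a)).
Proof. by case. Qed.

Lemma PT_ext A B `{enc A} `{enc B} (f g : A -> B) : f =1 g -> PT f -> PT g.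
Proof.
move=> fg [[c [n [tm [ptm cf]]]] sf]; split; last first.
  by apply: pb_le sf => a; rewrite fg.
exists c, n, tm; split=> // a s w s0; rewrite -fg; exact: cf.
Qed.

Lemma PT_comp A B C `{enc A} `{enc B} `{enc C} (f : A -> B) (g : B -> C) :
  PT f -> PT g -> PT (fun a => g (f a)).
Proof.
move=> [[c [n [tm [ptm cf]]]] sf] [[d [m [tn [ptn cg]]]] sg]; split; last first.
  exact: (pb_comp sf sg).
exists (Seq c d), (maxn n m), (fun a => tm a + tn (f a)); split.
  by apply: pb_add => //; exact: (pb_comp sf ptn).
move=> a s w s0.
have [s1 [t1 [e1 l1 r1 fr1]]] := computes_widen (leq_maxl n m) cf w s0.
have [s2 [t2 [e2 l2 r2 fr2]]] := computes_widen (leq_maxr n m) cg w r1.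
exists s2, (t1 + t2); split=> //; first exact: ExSeq e1 e2.
  exact: leq_add.
by move=> y ny; rewrite fr2 // fr1.
Qed.

Lemma PT_id A `{enc A} : PT (fun a : A => a).
Proof.
split; last exact: pb_esize.
exists Skip, 0, (fun=> 1); split; first exact: pb_const.
by move=> a s w s0; exists s, 1; split=> //; exact: ExSkip.
Qed.

Fixpoint qexpr (v : sexp) : expr :=
  match v with Nat n => Const n | Pair a b => Bin OCons (qexpr a) (qexpr b) end.

Lemma eval_qexpr s v : eval s (qexpr v) = v.
Proof. by elim: v => //= a -> b ->. Qed.

Lemma ecost_qexpr s s' v : ecost s (qexpr v) = ecost s' (qexpr v).
Proof. by elim: v => //= a -> b ->; rewrite !eval_qexpr. Qed.

Lemma updE s x v : upd s x v x = v. Proof. by rewrite /upd eqxx. Qed.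
Lemma upd_neq s x v y : y != x -> upd s x v y = s y.
Proof. by rewrite /upd => /negbTE ->. Qed.

Lemma PT_const A B `{enc A} `{enc B} (b : B) : PT (fun _ : A => b).
Proof.
split; last exact: pb_const.
exists (Assign 0 (qexpr (encode b))), 1,
  (fun=> (ecost (fun=> Nat 0) (qexpr (encode b))).+1); split; first exact: pb_const.
move=> a s w s0; eexists; eexists; split; first exact: ExAssign.
- by rewrite (ecost_qexpr _ (fun=> Nat 0)).
- by rewrite updE eval_qexpr.
- by move=> y y0; rewrite upd_neq // -lt0n.
Qed.

Lemma PT_un A B C `{enc A} `{enc B} `{enc C} o (f : A -> B) (h : A -> C) :
  PT f -> (forall a, eval1 o (encode (f a)) = encode (h a)) ->
  pb (fun a => esize (h a)) -> PT h.
Proof.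
move=> [[c [n [tm [ptm cf]]]] sf] oE sh; split=> //.
exists (Seq c (Assign 0 (Un o (Var 0)))), n.+1,
  (fun a => tm a + (esize (h a) + esize (f a) + 1)); split.
  by do !apply: pb_add => //; exact: pb_const.
move=> a s w s0.
have [s1 [t1 [e1 l1 r1 fr1]]] := computes_widen (leqnSn n) cf w s0.
eexists; eexists; split.
- by apply: ExSeq e1 _; exact: ExAssign.
- by rewrite /= r1 oE /esize addn0; lia.
- by rewrite updE /= r1 oE.
- by move=> y ny; rewrite upd_neq ?fr1 // -lt0n (leq_trans _ ny).
Qed.

(** Both operands expect the input in variable 0; it is saved in [N], and the first result in
    [N.+1], outside the frames of both programs. *)
Lemma PT_bin A B C D `{enc A} `{enc B} `{enc C} `{enc D} o
    (f : A -> B) (g : A -> C) (h : A -> D) :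
  PT f -> PT g ->
  (forall a, eval2 o (encode (f a)) (encode (g a)) = encode (h a)) ->
  pb (fun a => esize (h a)) -> PT h.
Proof.
move=> [[c [n [tm [ptm cf]]]] sf] [[d [m [tn [ptn cg]]]] sg] oE sh; split=> //.
pose N := (maxn n m).+1.
exists (Seq (Assign N (Var 0)) (Seq c (Seq (Assign N.+1 (Var 0))
  (Seq (Assign 0 (Var N)) (Seq d
    (Assign 0 (Bin o (Var N.+1) (Var 0)))))))), N.+2,
  (fun a => esize a + tm a + esize (f a) + esize a + tn a +
     (esize (h a) + esize (f a) + esize (g a)) + 4); split.
  by do !apply: pb_add => //; first [exact: pb_esize | exact: pb_const].
have nN : n <= N by rewrite leqW ?leq_maxl.
have mN : m <= N by rewrite leqW ?leq_maxr.
move=> a s w s0.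
have u0 : upd s N (s 0) 0 = encode a by rewrite upd_neq.
have [s1 [t1 [e1 l1 r1 fr1]]] := computes_widen nN cf w u0.
pose s1' := upd s1 N.+1 (s1 0).
have v0 : upd s1' 0 (s1' N) 0 = encode a.
  by rewrite updE /s1' upd_neq ?neq_ltn ?leqnn // fr1 // updE s0.
have [s2 [t2 [e2 l2 r2 fr2]]] := computes_widen mN cg w v0.
have r3 : s2 N.+1 = encode (f a).
  by rewrite fr2 // upd_neq // /s1' updE.
eexists; eexists; split.
- apply: ExSeq (ExAssign _ _ _ _) _; apply: ExSeq e1 _.
  apply: ExSeq (ExAssign _ _ _ _) _; apply: ExSeq (ExAssign _ _ _ _) _.
  apply: ExSeq e2 _; exact: ExAssign.
- rewrite /= r1 r2 r3 upd_neq ?neq_ltn ?leqnn // fr1 // updE s0 oE /esize; lia.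
- by rewrite updE /= r2 r3 oE.
- move=> y Ny; have y0 : y != 0 by rewrite -lt0n (leq_trans _ Ny).
  have yN : y != N by rewrite neq_ltn (leq_trans _ Ny) ?orbT.
  have yN1 : y != N.+1 by rewrite neq_ltn Ny orbT.
  rewrite upd_neq // fr2; last by rewrite (leq_trans _ Ny) //; lia.
  by rewrite /s1' !upd_neq // fr1 ?upd_neq // (leq_trans _ Ny) //; lia.
Qed.

Lemma esize_pair A B `{enc A} `{enc B} (p : A * B) :
  esize p = (esize p.1 + esize p.2).+1.
Proof. by []. Qed.

Lemma esize_cons A `{enc A} (a : A) l : esize (a :: l) = (esize a + esize l).+1.
Proof. by []. Qed.

Section Basic.
Context {E A B : Type} `{enc E} `{enc A} `{enc B}.

Lemma PT_pair (f : E -> A) (g : E -> B) :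
  PT f -> PT g -> PT (fun e => (f e, g e)).
Proof.
move=> pf pg; apply: (PT_bin (o := OCons) pf pg) => //.
by apply: (pb_le (h2 := fun e => esize (f e) + esize (g e) + 1));
  [move=> e; rewrite /esize /= addn1 | do !apply: pb_add => //;
   [exact: PT_pb | exact: PT_pb | exact: pb_const]].
Qed.

Lemma PT_fst (f : E -> A * B) : PT f -> PT (fun e => (f e).1).
Proof.
move=> pf; apply: (PT_un (o := OHd) pf) => //.
by apply: pb_le (PT_pb pf) => e; rewrite esize_pair; lia.
Qed.

Lemma PT_snd (f : E -> A * B) : PT f -> PT (fun e => (f e).2).
Proof.
move=> pf; apply: (PT_un (o := OTl) pf) => //.
by apply: pb_le (PT_pb pf) => e; rewrite esize_pair; lia.
Qed.

Lemma PT_cons (f : E -> A) (g : E -> seq A) :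
  PT f -> PT g -> PT (fun e => f e :: g e).
Proof.
move=> pf pg; apply: (PT_bin (o := OCons) pf pg) => //.
by apply: (pb_le (h2 := fun e => esize (f e) + esize (g e) + 1));
  [move=> e; rewrite /esize /= addn1 | do !apply: pb_add => //;
   [exact: PT_pb | exact: PT_pb | exact: pb_const]].
Qed.

Lemma PT_behead (g : E -> seq A) : PT g -> PT (fun e => behead (g e)).
Proof.
move=> pg; apply: (PT_un (o := OTl) pg) => [e|]; first by case: (g e).
by apply: pb_le (PT_pb pg) => e; case: (g e) => //= a l; rewrite esize_cons; lia.
Qed.

Lemma PT_add (f g : E -> nat) : PT f -> PT g -> PT (fun e => f e + g e).
Proof.
move=> pf pg; apply: (PT_bin (o := OAdd) pf pg) => //.
apply: (pb_le (h2 := fun e => esize (f e) + esize (g e))).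
  by move=> e; exact: esize_add.
by apply: pb_add; exact: PT_pb.
Qed.

Lemma PT_mul (f g : E -> nat) : PT f -> PT g -> PT (fun e => f e * g e).
Proof.
move=> pf pg; apply: (PT_bin (o := OMul) pf pg) => //.
apply: (pb_le (h2 := fun e => esize (f e) + esize (g e))).
  by move=> e; exact: esize_mul.
by apply: pb_add; exact: PT_pb.
Qed.

Lemma PT_sub (f g : E -> nat) : PT f -> PT g -> PT (fun e => f e - g e).
Proof.
move=> pf pg; apply: (PT_bin (o := OSub) pf pg) => //.
by apply: pb_le (PT_pb pf) => e; apply: esize_le; exact: leq_subr.
Qed.

Lemma PT_div (f g : E -> nat) : PT f -> PT g -> PT (fun e => f e %/ g e).
Proof.
move=> pf pg; apply: (PT_bin (o := ODiv) pf pg) => //.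
by apply: pb_le (PT_pb pf) => e; apply: esize_le; exact: leq_div.
Qed.

Lemma pb_bool (f : E -> bool) : pb (fun e => esize (f e)).
Proof.
apply: (pb_le (h2 := fun=> 1)) (pb_const 1) => e.
by case: (f e); rewrite /esize /= ?trunc_log0 ?trunc_log1.
Qed.

Lemma PT_leq (f g : E -> nat) : PT f -> PT g -> PT (fun e => f e <= g e).
Proof. by move=> pf pg; apply: (PT_bin (o := OLeq) pf pg) => //; exact: pb_bool. Qed.

Lemma PT_succ (f : E -> nat) : PT f -> PT (fun e => (f e).+1).
Proof.
move=> pf; apply: (PT_ext (f := fun e => f e + 1)); first by move=> e; rewrite addn1.
by apply: PT_add => //; exact: PT_const.
Qed.

Lemma PT_pred (f : E -> nat) : PT f -> PT (fun e => (f e).-1).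
Proof.
move=> pf; apply: (PT_ext (f := fun e => f e - 1)); first by move=> e; rewrite subn1.
by apply: PT_sub => //; exact: PT_const.
Qed.

Lemma PT_if (b : E -> bool) (f g : E -> A) :
  PT b -> PT f -> PT g -> PT (fun e => if b e then f e else g e).
Proof.
move=> [[cb [nb [tb [ptb cfb]]]] sb] [[c [n [tm [ptm cf]]]] sf]
  [[d [m [tn [ptn cg]]]] sg].
split; last first.
  apply: pb_le (pb_add sf sg) => e; case: (b e); [exact: leq_addr|exact: leq_addl].
pose N := (maxn nb (maxn n m)).+1.
exists (Seq (Assign N (Var 0)) (Seq cb (If (Var 0)
  (Seq (Assign 0 (Var N)) c) (Seq (Assign 0 (Var N)) d)))), N.+1,
  (fun a => esize a + tb a + esize (b a) + (esize a + tm a + tn a) + 2); split.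
  by do !apply: pb_add => //; first [exact: pb_esize | exact: pb_const].
have bN : nb <= N by rewrite leqW ?leq_maxl.
have nN : n <= N by rewrite leqW // !leq_max leqnn !orbT.
have mN : m <= N by rewrite leqW // !leq_max leqnn !orbT.
move=> a s w s0.
have u0 : upd s N (s 0) 0 = encode a by rewrite upd_neq.
have [s1 [t1 [e1 l1 r1 fr1]]] := computes_widen bN cfb w u0.
have v0 : upd s1 0 (s1 N) 0 = encode a by rewrite updE fr1 // updE s0.
have fr y : N < y -> s1 y = s y.
  by move=> Ny; rewrite fr1 ?upd_neq ?neq_ltn ?Ny ?orbT // ltnW.
have vb : vtrue (eval s1 (Var 0)) = b a by rewrite /= r1; case: (b a).
have frv y : N < y -> upd s1 0 (s1 N) y = s y.
  by move=> Ny; rewrite upd_neq ?fr // neq_ltn (leq_ltn_trans _ Ny) ?orbT.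
case E0: (b a) vb => vb.
  have [s2 [t2 [e2 l2 r2 fr2]]] := computes_widen nN cf w v0.
  eexists; eexists; split.
  - apply: ExSeq (ExAssign _ _ _ _) _; apply: ExSeq e1 _; apply: ExIf.
    by rewrite vb; apply: ExSeq e2; exact: ExAssign.
  - by rewrite /= r1 fr1 // updE s0 /esize; lia.
  - exact: r2.
  - by move=> y Ny; rewrite fr2 ?frv // ltnW.
have [s2 [t2 [e2 l2 r2 fr2]]] := computes_widen mN cg w v0.
eexists; eexists; split.
- apply: ExSeq (ExAssign _ _ _ _) _; apply: ExSeq e1 _; apply: ExIf.
  by rewrite vb; apply: ExSeq e2; exact: ExAssign.
- by rewrite /= r1 fr1 // updE s0 /esize; lia.
- exact: r2.
- by move=> y Ny; rewrite fr2 ?frv // ltnW.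
Qed.

End Basic.

(** * Folds and list operations in polynomial time *)

Lemma esize_seq A `{enc A} (l : seq A) :
  esize l = sumn (map (fun a => (esize a).+1) l) + 1.
Proof.
elim: l => [|a l IH]; first by rewrite /esize /= trunc_log0.
by rewrite esize_cons IH /=; lia.
Qed.

Lemma esize_seq_le A `{enc A} (l : seq A) h :
  (forall a, List.In a l -> esize a <= h) -> esize l <= size l * h.+1 + 1.
Proof.
rewrite esize_seq leq_add2r; elim: l => //= a l IH Hl.
rewrite mulSn leq_add //; first by rewrite ltnS Hl //; left.
by apply: IH => b bl; apply: Hl; right.
Qed.

Lemma esize_mem A `{enc A} (l : seq A) a : List.In a l -> esize a <= esize l.
Proof.
rewrite esize_seq; elim: l => //= b l IH [->|/IH]; lia.
Qed.

Lemma size_esize A `{enc A} (l : seq A) : size l <= esize l.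
Proof. by rewrite esize_seq; elim: l => //= b l IH; lia. Qed.

(** Polynomial steps do not make a polynomial fold: repeated squaring blows up the accumulator.
    Hence one polynomial [h] has to bound the accumulators of all prefixes; every round then costs
    at most [G e]. *)
Lemma PT_foldl E X B {eE : enc E} {eX : enc X} {eB : enc B} (F : E -> B -> X -> B)
    (z : E -> B) (l : E -> seq X) (h : E -> nat) :
  PT (fun p : (E * X) * B => F p.1.1 p.2 p.1.2) -> PT z -> PT l -> pb h ->
  (forall e i, esize (foldl (F e) (z e) (take i (l e))) <= h e) ->
  PT (fun e => foldl (F e) (z e) (l e)).
Proof.
move=> [[cf [n [tm [ptm ccf]]]] sf] [[cz [nz [tz [ptz ccz]]]] sz]
  [[cl [nl [tl [ptl ccl]]]] sl] pbh Hh.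
have [d Hd] := ptm.
pose zE e := @esize E eE e; pose zl e := @esize _ (@enc_seq X eX) (l e).
pose T e := ((zE e + zl e + h e + 3).+1) ^ d.
pose G e := T e + 12 * (zE e + zl e + h e + 3).
have pbT : pb T.
  have [c Hc] : pb (fun e => zE e + zl e + h e + 3).
    by do !apply: pb_add => //; [exact: pb_esize | exact: pb_const].
  exists (c.+1 * d) => e; rewrite /T expnM.
  case: (d) => [|d']; first by [].
  rewrite leq_exp2r //; apply: leq_ltn_trans (Hc e) _.
  by rewrite ltn_exp2l // ltnS esize_gt0.
have pbG : pb G.
  by do !(apply: pb_add || apply: pb_mul) => //;
    first [exact: pb_const | exact: pb_esize].
split; last first.
  apply: (pb_le _ pbh) => e; by have := Hh e (size (l e)); rewrite take_size.
pose N := (maxn n (maxn nz nl)).+1.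
pose body := Seq (Assign 0 (Bin OCons (Bin OCons (Var N) (Un OHd (Var N.+1))) (Var 0)))
  (Seq (Assign N.+1 (Un OTl (Var N.+1))) cf).
exists (Seq (Assign N (Var 0)) (Seq cl (Seq (Assign N.+1 (Var 0))
  (Seq (Assign 0 (Var N)) (Seq cz (While (Var N.+1) body)))))), N.+2,
  (fun e => esize e + tl e + esize (l e) + esize e + tz e + (esize (l e)).+1 * G e + 3).
split.
  by do !(apply: pb_add || apply: pb_mul) => //;
    first [exact: pb_const | exact: pb_esize | apply: (pb_le _ (pb_add sl (pb_const 1))) => e; rewrite addn1].
have nN : n <= N by rewrite leqW ?leq_maxl.
have zN : nz <= N by rewrite leqW // !leq_max leqnn !orbT.
have lN : nl <= N by rewrite leqW // !leq_max leqnn !orbT.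
move=> e s w s0.
have u0 : upd s N (s 0) 0 = encode e by rewrite upd_neq.
have [s1 [t1 [e1 l1 r1 fr1]]] := computes_widen lN ccl w u0.
pose s1' := upd s1 N.+1 (s1 0).
have v0 : upd s1' 0 (s1' N) 0 = encode e.
  by rewrite updE /s1' upd_neq ?neq_ltn ?leqnn // fr1 // updE s0.
have [s2 [t2 [e2 l2 r2 fr2]]] := computes_widen zN ccz w v0.
have rN : s2 N = encode e.
  by rewrite fr2 // upd_neq // /s1' upd_neq ?fr1 ?updE // neq_ltn leqnn.
have rN1 : s2 N.+1 = encode (l e) by rewrite fr2 // upd_neq // /s1' updE.
have loop : forall ll b s3, s3 N = encode e -> s3 N.+1 = encode ll -> s3 0 = encode b ->
    (forall x, List.In x ll -> List.In x (l e)) -> esize ll <= esize (l e) ->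
    (forall i, esize (foldl (F e) b (take i ll)) <= h e) ->
    exists s4 t, [/\ exec (While (Var N.+1) body) s3 w s4 w t,
      t <= (size ll).+1 * G e, s4 0 = encode (foldl (F e) b ll) &
      forall y, N.+1 < y -> s4 y = s3 y].
  elim=> [|x ll IH] b s3 q1 q2 q3 sub le Hb.
    exists s3, (ecost s3 (Var N.+1)); split=> //.
      by apply: ExWhileF; rewrite /= q2.
    by rewrite /= q2 /= trunc_log0 /G; lia.
  pose s4 := upd s3 0 (Pair (Pair (@encode E eE e) (@encode X eX x)) (@encode B eB b)).
  pose s5 := upd s4 N.+1 (@encode _ (@enc_seq X eX) ll).
  have q50 : s5 0 = encode ((e, x), b) by rewrite /s5 upd_neq // /s4 updE.
  have [s6 [t6 [e6 l6 r6 fr6]]] := computes_widen nN ccf w q50.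
  have q6N : s6 N = encode e.
    by rewrite fr6 // /s5 upd_neq ?neq_ltn ?leqnn // /s4 upd_neq.
  have q6N1 : s6 N.+1 = encode ll by rewrite fr6 // /s5 updE.
  have xs : esize x <= esize (l e) by apply: esize_mem; apply: sub; left.
  have lel : esize ll <= esize (l e).
    by apply: leq_trans le; rewrite esize_cons; lia.
  have [s7 [t7 [e7 l7 r7 fr7]]] := IH (F e b x) s6 q6N q6N1 r6
     (fun x xl => sub x (or_intror xl)) lel (fun i => Hb i.+1).
  eexists; eexists; split.
  - apply: ExWhileT e7; first by rewrite /= q2.
    apply: ExSeq; first exact: ExAssign.
    have -> : eval s3 (Bin OCons (Bin OCons (Var N) (Un OHd (Var N.+1))) (Var 0)) =
       Pair (Pair (encode e) (encode x)) (encode b) by rewrite /= q1 q2 q3.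
    apply: ExSeq; first exact: ExAssign.
    have -> : eval (upd s3 0 (Pair (Pair (encode e) (encode x)) (encode b)))
       (Un OTl (Var N.+1)) = encode ll by rewrite /= upd_neq // q2.
    exact: e6.
  - have b_le : esize b <= h e by have := Hb 0; rewrite take0.
    have t6_le : t6 <= T e.
      apply: leq_trans l6 _; apply: leq_trans (Hd _) _; rewrite /T.
      case: (d) => [|d']; first by [].
      by rewrite leq_exp2r // !esize_pair /= /zE /zl; move: xs b_le; lia.
    have -> : (size (x :: ll)).+1 * G e = G e + (size ll).+1 * G e by rewrite /= mulSn.
    rewrite /= upd_neq // q1 q2 q3 /=.
    rewrite -![vsize (vlist _)]/(@esize _ (@enc_seq X eX) ll).
    change (vsize (encode e)) with (zE e); change (vsize (encode b)) with (esize b).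
    change (vsize (encode x)) with (esize x).
    move: t6_le xs b_le lel le; rewrite esize_cons /G /zl => t6_le xs b_le lel le.
    apply: leq_add l7; rewrite /G /zl; lia.
  - exact: r7.
  - move=> y Ny; rewrite fr7 // fr6; last by lia.
    rewrite /s5 upd_neq; last by lia.
    by rewrite /s4 upd_neq //; lia.
have [s3 [t3 [e3 l3 r3 fr3]]] := loop (l e) (z e) s2 rN rN1 r2 (fun x xl => xl) (leqnn _) (Hh e).
eexists; eexists; split.
- apply: ExSeq (ExAssign _ _ _ _) _; apply: ExSeq e1 _.
  apply: ExSeq (ExAssign _ _ _ _) _; apply: ExSeq (ExAssign _ _ _ _) _.
  exact: ExSeq e2 e3.
- rewrite /= r1 upd_neq; last by rewrite neq_ltn leqnn.
  rewrite fr1 // updE s0.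
  have : (size (l e)).+1 * G e <= (esize (l e)).+1 * G e.
    by rewrite leq_mul2r ltnS size_esize orbT.
  move: l1 l2 l3; rewrite /esize; set g1 := _ * G e; set g2 := _ * G e; lia.
- exact: r3.
- move=> y Ny; rewrite fr3 // fr2; last by lia.
  by rewrite /s1' !upd_neq ?fr1 ?upd_neq //; lia.
Qed.

(** A bound in the size of [(e, x)] becomes one in [e] alone, since an element is no larger than its
    list. *)
Lemma pb_mem E X {eE : enc E} {eX : enc X} (l : E -> seq X) (h : E * X -> nat) :
  PT l -> pb h ->
  exists2 H, pb H & forall e x, List.In x (l e) -> h (e, x) <= H e.
Proof.
move=> pl [c Hc].
have [d Hd] : pb (fun e => @esize E eE e + @esize _ (@enc_seq X eX) (l e) + 1).
  by do !apply: pb_add; [exact: pb_esize | exact: PT_pb | exact: pb_const].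
exists (fun e => (@esize E eE e + @esize _ (@enc_seq X eX) (l e) + 2) ^ c).
  exists (d.+1 * c) => e; rewrite expnM leq_expl // addnS.
  apply: leq_ltn_trans (Hd e) _; rewrite ltn_exp2l // ltnS esize_gt0 //.
move=> e x xl; apply: leq_trans (Hc _) _; rewrite leq_expl // esize_pair /=.
by have := @esize_mem X eX (l e) x xl; lia.
Qed.

Section Lists.
Context {E A B : Type} {eE : enc E} {eA : enc A} {eB : enc B}.

Lemma pb_size (l : E -> seq A) : PT l -> pb (fun e => size (l e)).
Proof. by move=> pl; apply: pb_le (PT_pb pl) => e; exact: size_esize. Qed.

Lemma esize_catrev (l z : seq A) : esize (catrev l z) + 1 = esize l + esize z.
Proof.
elim: l z => [|a l IH] z /=; last by rewrite IH !esize_cons; lia.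
by rewrite [esize [::]]esize_seq /= addnC.
Qed.

Lemma esize_nil : esize ([::] : seq A) = 1.
Proof. by rewrite esize_seq. Qed.

Lemma esize_cat (l z : seq A) : esize (l ++ z) + 1 = esize l + esize z.
Proof. by elim: l => [|a l IH] /=; rewrite ?esize_cons ?esize_nil; lia. Qed.

Lemma esize_rev (l : seq A) : esize (rev l) = esize l.
Proof. by have := esize_catrev l [::]; rewrite /rev esize_nil; lia. Qed.

Lemma esize_take i (l : seq A) : esize (take i l) <= esize l.
Proof. by have := esize_cat (take i l) (drop i l); rewrite cat_take_drop; have := @esize_gt0 _ (@enc_seq A eA) (drop i l); lia. Qed.

Lemma esize_drop i (l : seq A) : esize (drop i l) <= esize l.
Proof. by have := esize_cat (take i l) (drop i l); rewrite cat_take_drop; have := @esize_gt0 _ (@enc_seq A eA) (take i l); lia. Qed.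

Lemma PT_rev (l : E -> seq A) : PT l -> PT (fun e => rev (l e)).
Proof.
move=> pl.
have fE s z : foldl (fun acc (x : A) => x :: acc) z s = catrev s z by elim: s z => /=.
apply: (PT_ext (f := fun e => foldl (fun acc x => x :: acc) [::] (l e))).
  by move=> e; rewrite fE.
apply: (PT_foldl (h := fun e => esize (l e))) => //.
- apply: PT_cons; last exact: PT_snd PT_id.
  by apply: PT_snd; apply: PT_fst; exact: PT_id.
- exact: PT_const.
- exact: PT_pb.
- by move=> e i; rewrite fE -/(rev _) esize_rev esize_take.
Qed.

Lemma PT_foldr (F : E -> A -> B -> B) (z : E -> B) (l : E -> seq A) (h : E -> nat) :
  PT (fun p : (E * A) * B => F p.1.1 p.1.2 p.2) -> PT z -> PT l -> pb h ->
  (forall e i, esize (foldr (F e) (z e) (drop i (l e))) <= h e) ->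
  PT (fun e => foldr (F e) (z e) (l e)).
Proof.
move=> pF pz pl ph Hh.
apply: (PT_ext (f := fun e => foldl (fun b x => F e x b) (z e) (rev (l e)))).
  by move=> e; rewrite foldl_rev.
apply: (PT_foldl (h := h)) => //; first exact: PT_rev.
move=> e i; rewrite take_rev foldl_rev; exact: Hh.
Qed.

End Lists.

Section Lists1.
Context {E A B : Type} {eE : enc E} {eA : enc A} {eB : enc B}.

Lemma PT_map (F : E -> A -> B) (l : E -> seq A) :
  PT (fun p : E * A => F p.1 p.2) -> PT l -> PT (fun e => map (F e) (l e)).
Proof.
move=> pF pl.
have [H pH HH] := pb_mem pl (PT_pb pF).
apply: (PT_ext (f := fun e => foldr (fun x acc => F e x :: acc) [::] (l e))).
  by move=> e; elim: (l e) => //= x s ->.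
apply: (PT_foldr (h := fun e => size (l e) * (H e).+1 + 1)) => //.
- apply: PT_cons; last exact: PT_snd PT_id.
  by apply: (PT_comp (f := fun p : E * A * seq B => p.1) _ pF); exact: PT_fst PT_id.
- exact: PT_const.
- apply: pb_add; last exact: pb_const.
  apply: pb_mul; first exact: pb_size.
  by apply: (pb_le _ (pb_add pH (pb_const 1))) => e; rewrite addn1.
- move=> e i.
  have -> : foldr (fun x acc => F e x :: acc) [::] (drop i (l e)) = map (F e) (drop i (l e)).
    by elim: (drop i (l e)) => //= x s ->.
  apply: leq_trans (esize_seq_le (h := H e) _) _.
    move=> b /List.in_map_iff [a [<- ai]]; apply: (HH e a).
    have : List.In a (take i (l e) ++ drop i (l e)) by apply/List.in_app_iff; right.
    by rewrite cat_take_drop.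
  by rewrite leq_add2r leq_mul2r size_map size_drop leq_subr orbT.
Qed.

Lemma esize_filter p (l : seq A) : esize (filter p l) <= esize l.
Proof. by elim: l => //= a l IH; case: (p a); rewrite !esize_cons; lia. Qed.

Lemma PT_filter (P : E -> A -> bool) (l : E -> seq A) :
  PT (fun p : E * A => P p.1 p.2) -> PT l -> PT (fun e => filter (P e) (l e)).
Proof.
move=> pP pl.
apply: (PT_ext (f := fun e => foldr (fun x acc => if P e x then x :: acc else acc) [::] (l e))).
  by move=> e; elim: (l e) => //= x s ->.
apply: (PT_foldr (h := fun e => esize (l e))) => //.
- apply: PT_if; last exact: PT_snd PT_id.
  + by apply: (PT_comp (f := fun p : E * A * seq A => p.1) _ pP); exact: PT_fst PT_id.
  + apply: PT_cons; last exact: PT_snd PT_id.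
    by apply: PT_snd; apply: PT_fst; exact: PT_id.
- exact: PT_const.
- exact: PT_pb.
- move=> e i.
  have -> : foldr (fun x acc => if P e x then x :: acc else acc) [::] (drop i (l e))
            = filter (P e) (drop i (l e)) by elim: (drop i (l e)) => //= x s ->.
  exact: leq_trans (esize_filter _ _) (esize_drop _ _).
Qed.

Lemma PT_cat (l s : E -> seq A) : PT l -> PT s -> PT (fun e => l e ++ s e).
Proof.
move=> pl ps.
apply: (PT_ext (f := fun e => foldr cons (s e) (l e))).
  by move=> e; elim: (l e) => //= x t ->.
apply: (PT_foldr (h := fun e => esize (l e) + esize (s e))) => //.
- apply: PT_cons; last exact: PT_snd PT_id.
  by apply: PT_snd; apply: PT_fst; exact: PT_id.
- by apply: pb_add; exact: PT_pb.
- move=> e i.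
  have -> : foldr cons (s e) (drop i (l e)) = drop i (l e) ++ s e.
    by elim: (drop i (l e)) => //= x t ->.
  by have := @esize_cat A eA (drop i (l e)) (s e); have := @esize_drop A eA i (l e); lia.
Qed.

Lemma PT_size (l : E -> seq A) : PT l -> PT (fun e => size (l e)).
Proof.
move=> pl.
apply: (PT_ext (f := fun e => foldr (fun _ n => n.+1) 0 (l e))).
  by move=> e; elim: (l e) => //= x t ->.
apply: (PT_foldr (h := fun e => (size (l e)).+1)) => //.
- by apply: PT_succ; exact: PT_snd PT_id.
- exact: PT_const.
- by apply: (pb_le _ (pb_add (pb_size pl) (pb_const 1))) => e; rewrite addn1.
- move=> e i.
  have -> : foldr (fun _ n => n.+1) 0 (drop i (l e)) = size (drop i (l e)).
    by elim: (drop i (l e)) => //= x t ->.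
  by apply: leq_trans (esize_leS _) _; rewrite ltnS size_drop leq_subr.
Qed.

End Lists1.

Lemma esize_seq_nat (l : seq nat) n : all (fun x => x <= n) l -> esize l <= size l * n.+2 + 1.
Proof.
move=> al; apply: (esize_seq_le (h := n.+1)) => a al'.
apply: leq_trans (esize_leS a) _; rewrite ltnS.
by elim: l al al' => //= b l IH /andP[bn ln] [<-//|]; exact: IH.
Qed.

Section Lists2.
Context {E A B : Type} {eE : enc E} {eA : enc A} {eB : enc B}.

Lemma PT_iota_size (l : E -> seq A) : PT l -> PT (fun e => iota 0 (size (l e))).
Proof.
move=> pl.
have revE (s : seq A) z : foldl (fun p (_ : A) => size p :: p) z s
    = rev (iota (size z) (size s)) ++ z.
  elim: s z => [|x s IH] z //=.
  by rewrite IH /= rev_cons cat_rcons.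
apply: (PT_ext (f := fun e => rev (foldl (fun p (_ : A) => size p :: p) [::] (l e)))).
  by move=> e; rewrite revE /= cats0 revK.
apply: PT_rev.
apply: (PT_foldl (h := fun e => size (l e) * (size (l e)).+2 + 1)) => //.
- by apply: PT_cons; [apply: PT_size|]; exact: PT_snd PT_id.
- exact: PT_const.
- do !(apply: pb_add || apply: pb_mul); try exact: pb_size; try exact: pb_const.
  by apply: (pb_le _ (pb_add (pb_size pl) (pb_const 2))) => e; rewrite addn2.
- move=> e i; rewrite revE cats0 esize_rev.
  apply: leq_trans (esize_seq_nat (n := size (l e)) _) _.
    apply/allP => x; rewrite mem_iota /= add0n => xi.
    by apply: ltnW; apply: leq_trans xi _; rewrite size_take; case: ltnP => // /ltnW.
  rewrite size_iota leq_add2r leq_mul2r size_take; apply/orP; right.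
  by case: ltnP => // /ltnW.
Qed.

(** The list serves as a unary counter, which keeps the number of rounds polynomial. *)
Lemma PT_iter (G : E -> B -> B) (z : E -> B) (l : E -> seq A) (h : E -> nat) :
  PT (fun p : E * B => G p.1 p.2) -> PT z -> PT l -> pb h ->
  (forall e i, i <= size (l e) -> esize (iter i (G e) (z e)) <= h e) ->
  PT (fun e => iter (size (l e)) (G e) (z e)).
Proof.
move=> pG pz pl ph Hh.
have fE e s : foldr (fun (_ : A) b => G e b) (z e) s = iter (size s) (G e) (z e).
  by elim: s => //= x s ->.
apply: (PT_ext (f := fun e => foldr (fun (_ : A) b => G e b) (z e) (l e))) => //.
apply: (PT_foldr (h := h)) => //; last by move=> e i; rewrite fE; apply: Hh; rewrite size_drop leq_subr.
apply: (PT_comp (f := fun p : E * A * B => (p.1.1, p.2)) _ pG).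
by apply: PT_pair; [do 2!apply: PT_fst; exact: PT_id | exact: PT_snd PT_id].
Qed.

Lemma PT_negb (b : E -> bool) : PT b -> PT (fun e => ~~ b e).
Proof.
move=> pb_; apply: (PT_ext (f := fun e => if b e then false else true)) => //.
by apply: PT_if => //; exact: PT_const.
Qed.

Lemma PT_andb (b c : E -> bool) : PT b -> PT c -> PT (fun e => b e && c e).
Proof.
move=> pb_ pc; apply: (PT_ext (f := fun e => if b e then c e else false)) => //.
by apply: PT_if => //; exact: PT_const.
Qed.

Lemma PT_orb (b c : E -> bool) : PT b -> PT c -> PT (fun e => b e || c e).
Proof.
move=> pb_ pc; apply: (PT_ext (f := fun e => if b e then true else c e)) => //.
by apply: PT_if => //; exact: PT_const.
Qed.

Lemma PT_eqn (f g : E -> nat) : PT f -> PT g -> PT (fun e => f e == g e).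
Proof.
move=> pf pg; apply: (PT_ext (f := fun e => (f e <= g e) && (g e <= f e))).
  by move=> e; rewrite eqn_leq.
by apply: PT_andb; exact: PT_leq.
Qed.

Lemma PT_has (P : E -> A -> bool) (l : E -> seq A) :
  PT (fun p : E * A => P p.1 p.2) -> PT l -> PT (fun e => has (P e) (l e)).
Proof.
move=> pP pl.
apply: (PT_ext (f := fun e => 0 < size (filter (P e) (l e)))).
  by move=> e; rewrite size_filter has_count.
by apply: PT_leq; [exact: PT_const | apply: PT_size; exact: PT_filter].
Qed.

Lemma PT_amin (f : E -> A -> nat) (d : E -> A) (l : E -> seq A) :
  PT (fun p : E * A => f p.1 p.2) -> PT d -> PT l ->
  PT (fun e => foldr (fun x y => if f e x <= f e y then x else y) (d e) (l e)).
Proof.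
move=> pf pd pl.
apply: (PT_foldr (h := fun e => esize (d e) + esize (l e))) => //.
- have p1 : PT (fun p : E * A * A => p.1.2).
    by apply: PT_snd; apply: PT_fst; exact: PT_id.
  have p2 : PT (fun p : E * A * A => p.2) by exact: PT_snd PT_id.
  have p3 : PT (fun p : E * A * A => p.1.1).
    by do 2!apply: PT_fst; exact: PT_id.
  apply: PT_if => //; apply: PT_leq.
    by apply: (PT_comp (f := fun p : E * A * A => (p.1.1, p.1.2)) _ pf); exact: PT_pair.
  by apply: (PT_comp (f := fun p : E * A * A => (p.1.1, p.2)) _ pf); exact: PT_pair.
- by apply: pb_add; exact: PT_pb.
- move=> e i; have hd := @esize_drop A eA i (l e).
  apply: (@leq_trans (@esize A eA (d e) + @esize _ (@enc_seq A eA) (drop i (l e)))); last by lia.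
  elim: (drop i (l e)) => [|x s IH] /=; first by rewrite leq_addr.
  by case: ifP; rewrite esize_cons; lia.
Qed.

End Lists2.

Section Lists2'.
Context {E A : Type} {eE : enc E} {eA : enc A}.

(** Programs reach a list only through its head, so a fold carries the current position along with
    the entry found so far. *)
Lemma PT_nth (d : A) (l : E -> seq A) (n : E -> nat) :
  PT l -> PT n -> PT (fun e => nth d (l e) (n e)).
Proof.
move=> pl pn.
pose F (i : nat) (p : nat * A) (x : A) := (p.1.+1, if p.1 == i then x else p.2).
have F1 i s p : (foldl (F i) p s).1 = p.1 + size s.
  by elim: s p => [|x s IH] p /=; rewrite ?addn0 // IH /= addSnnS.
have F2 i s p : p.2 = d \/ p.1 > i ->
    (foldl (F i) p s).2 = if p.1 <= i then nth d s (i - p.1) else p.2.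
  elim: s p => [|x s IH] p hp /=.
    by rewrite nth_nil; case: leqP hp => // h [->|]//; lia.
  rewrite IH /=; last by case: eqP => [->|_] /=; [right | case: hp; [left | right; lia]].
  case: eqP => [->|ne]; first by rewrite ltnn leqnn subnn.
  case: ltnP => h; first by rewrite (ltnW h) -(subnSK h).
  by case: leqP => // h'; lia.
apply: (PT_ext (f := fun e => (foldl (F (n e)) (0, d) (l e)).2)).
  by move=> e; rewrite F2 /= ?subn0 //; left.
apply: PT_snd.
apply: (PT_foldl (h := fun e => (size (l e)).+1 + (esize d + esize (l e)) + 1)) => //.
- have p1 : PT (fun p : E * A * (nat * A) => p.2.1).
    by apply: PT_fst; apply: PT_snd; exact: PT_id.
  have p2 : PT (fun p : E * A * (nat * A) => p.2.2).
    by do 2!apply: PT_snd; exact: PT_id.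
  have p3 : PT (fun p : E * A * (nat * A) => p.1.2).
    by apply: PT_snd; apply: PT_fst; exact: PT_id.
  have p4 : PT (fun p : E * A * (nat * A) => n p.1.1).
    by apply: (PT_comp _ pn); do 2!apply: PT_fst; exact: PT_id.
  apply: PT_pair; first exact: PT_succ.
  by apply: PT_if => //; exact: PT_eqn.
- exact: PT_const.
- do !apply: pb_add; try exact: PT_pb; try exact: pb_const.
  by apply: (pb_le _ (pb_add (pb_size pl) (pb_const 1))) => e; rewrite addn1.
- move=> e i; rewrite esize_pair F1 /= add0n.
  have h1 : @esize nat enc_nat (size (take i (l e))) <= (size (l e)).+1.
    apply: leq_trans (esize_leS _) _; rewrite ltnS size_take.
    by case: ltnP => // /ltnW.
  have h2 : @esize A eA (foldl (F (n e)) (0, d) (take i (l e))).2 <= @esize A eA d + @esize _ (@enc_seq A eA) (take i (l e)); last first.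
    by have := @esize_take A eA i (l e); move: h1 h2; lia.
  rewrite F2 /= ?subn0; last by left.
  have [h|h] := ltnP (n e) (size (take i (l e))); last by rewrite nth_default // leq_addr.
  apply: leq_trans (esize_mem (l := take i (l e)) _) (leq_addl _ _).
  elim: (take i (l e)) (n e) h => [|x s IH] [|j] //= h; first by left.
  by right; exact: IH.
Qed.

End Lists2'.

Section Lists3.
Context {E A : Type} {eE : enc E} {eA : enc A}.

Lemma PT_flatten (l : E -> seq (seq A)) : PT l -> PT (fun e => flatten (l e)).
Proof.
move=> pl; apply: (PT_foldr (h := fun e => esize (l e))) => //.
- apply: PT_cat; last exact: PT_snd PT_id.
  by apply: PT_snd; apply: PT_fst; exact: PT_id.
- exact: PT_const.
- exact: PT_pb.
- move=> e i; apply: leq_trans (esize_drop i (l e)).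
  elim: (drop i (l e)) => [|s t IH] /=; first by rewrite !esize_nil.
  by rewrite esize_cons; have := @esize_cat A eA s (flatten t); rewrite /flatten; move: IH; lia.
Qed.

Lemma esize_sumn s : esize (sumn s) <= esize s.
Proof.
elim: s => [|x s IH]; first by rewrite esize_nil /esize /= trunc_log0.
by rewrite esize_cons /=; apply: leq_trans (esize_add _ _) _; lia.
Qed.

Lemma PT_sumn (l : E -> seq nat) : PT l -> PT (fun e => sumn (l e)).
Proof.
move=> pl; apply: (PT_foldr (F := fun _ => addn) (h := fun e => esize (l e))) => //.
- apply: PT_add; last exact: PT_snd PT_id.
  by apply: PT_snd; apply: PT_fst; exact: PT_id.
- exact: PT_const.
- exact: PT_pb.
- by move=> e i; apply: leq_trans (esize_sumn _) _; exact: esize_drop.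
Qed.

Definition prodn := foldr muln 1.

Lemma PT_prodn (l : E -> seq nat) : PT l -> PT (fun e => prodn (l e)).
Proof.
move=> pl; apply: (PT_foldr (F := fun _ => muln) (h := fun e => esize (l e))) => //.
- apply: PT_mul; last exact: PT_snd PT_id.
  by apply: PT_snd; apply: PT_fst; exact: PT_id.
- exact: PT_const.
- exact: PT_pb.
- move=> e i; apply: leq_trans (esize_drop i _).
  elim: (drop i (l e)) => [|x s IH].
    by rewrite esize_nil.
  by rewrite esize_cons /=; apply: leq_trans (esize_mul _ _) _; lia.
Qed.

Lemma PT_memn (x : E -> nat) (l : E -> seq nat) :
  PT x -> PT l -> PT (fun e => x e \in l e).
Proof.
move=> px pl; apply: (PT_ext (f := fun e => has (fun y => y == x e) (l e))).
  by move=> e; rewrite -has_pred1.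
apply: (PT_has (P := fun e y => y == x e)) => //.
by apply: PT_eqn; [exact: PT_snd PT_id | apply: PT_comp px; exact: PT_fst PT_id].
Qed.

Lemma PT_nseq_size B {eB : enc B} (s : E -> seq B) (a : E -> A) :
  PT s -> PT a -> PT (fun e => nseq (size (s e)) (a e)).
Proof.
move=> ps pa; apply: (PT_ext (f := fun e => map (fun=> a e) (s e))).
  by move=> e; elim: (s e) => //= _ t ->.
apply: (PT_map (F := fun e _ => a e)) => //.
by apply: PT_comp pa; exact: PT_fst PT_id.
Qed.

End Lists3.

(** * Powers of two up to a bound *)

Definition pows (n : nat) : seq nat :=
  rev [seq 2 ^ c | c <- iota 0 (if n == 0 then 0 else (trunc_log 2 n).+1)].

(** The number of rounds is the binary length of the argument, and no list of that length is at hand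
    to fold over; hence a separate loop, which halves the argument and doubles the current power. *)
Lemma PT_pows E {eE : enc E} (f : E -> nat) : PT f -> PT (fun e => pows (f e)).
Proof.
have nlog n : n != 0 -> (if n %/ 2 == 0 then 0 else (trunc_log 2 (n %/ 2)).+1) = trunc_log 2 n.
  case: n => [|[|n]] // _.
  by rewrite [RHS]trunc_log2S // -divn2; case: eqP => // /eqP; rewrite -leqn0 leqNgt divn_gt0.
(* One round: halving [n] removes one exponent, and doubling the first power [p] compensates for
   it. *)
have powsS n p l : n != 0 ->
    rev [seq p * 2 * 2 ^ c | c <- iota 0 (if n %/ 2 == 0 then 0 else (trunc_log 2 (n %/ 2)).+1)] ++ p :: l =
    rev [seq p * 2 ^ c | c <- iota 0 (if n == 0 then 0 else (trunc_log 2 n).+1)] ++ l.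
  move=> n0; rewrite nlog // (negbTE n0) /= rev_cons cat_rcons muln1; congr (rev _ ++ _).
  rewrite -[1]addn0 iotaDl -map_comp; apply: eq_map => c /=.
  by rewrite add1n expnS mulnA.
move=> pf; apply: (PT_comp pf) => {f pf}.
have size_pows n : size (pows n) <= esize n.
  by rewrite /pows size_rev size_map size_iota /esize /=; case: eqP.
have pows_le n : all (fun x => x <= n) (pows n).
  apply/allP => x; rewrite mem_rev => /mapP[c]; rewrite mem_iota add0n /= => cn ->.
  case: eqP cn => // /eqP n0; rewrite ltnS => cn.
  by apply: leq_trans (trunc_logP (isT : 1 < 2) _); rewrite ?lt0n // leq_exp2l.
have esz n : esize (pows n) <= esize n * (esize n).+1 + 1.
  apply: leq_trans (esize_seq_le (h := esize n) _) _; last first.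
    by rewrite leq_add2r leq_mul2r size_pows orbT.
  move=> a al; apply: esize_le; have /allP := pows_le n; apply.
  elim: (pows n) al => //= b l IH [->|/IH]; rewrite inE ?eqxx // => ->; exact: orbT.
split; last first.
  apply: (pb_le (h2 := fun n => esize n * (esize n + 1) + 1)).
    by move=> n; rewrite (addn1 (esize n)); exact: esz.
  by do !(apply: pb_add || apply: pb_mul); first [exact: pb_esize | exact: pb_const].
pose body := Seq (Assign 0 (Bin OCons (Var 2) (Var 0)))
  (Seq (Assign 2 (Bin OMul (Var 2) (Const 2))) (Assign 1 (Bin ODiv (Var 1) (Const 2)))).
exists (Seq (Assign 1 (Var 0)) (Seq (Assign 2 (Const 1)) (Seq (Assign 0 (Const 0))
  (While (Var 1) body)))), 3,
  (fun n => (esize n).+1 * (20 * (esize n * (esize n + 1) + esize n + 2)) + esize n + 5).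
split.
  apply: (pb_le (h2 := fun n => (esize n + 1) * (20 * (esize n * (esize n + 1) + esize n + 2)) + esize n + 5)).
    by move=> n; rewrite !(addn1 (esize n)).
  by do !(apply: pb_add || apply: pb_mul); first [exact: pb_esize | exact: pb_const].
move=> n s w s0.
have loop : forall sz x p l s3, (if x == 0 then 0 else (trunc_log 2 x).+1) = sz ->
    s3 0 = encode l -> s3 1 = encode x -> s3 2 = encode p ->
    rev [seq p * 2 ^ c | c <- iota 0 (if x == 0 then 0 else (trunc_log 2 x).+1)] ++ l = pows n ->
    x <= n -> (x != 0 -> p <= n) ->
    exists s4 t, [/\ exec (While (Var 1) body) s3 w s4 w t,
      t <= sz.+1 * (20 * (esize n * (esize n).+1 + esize n + 2)), s4 0 = encode (pows n) &
      forall y, 3 <= y -> s4 y = s3 y].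
  elim=> [|sz IH] x p l s3 hx q0 q1 q2 hl xn pn.
    case: eqP hx => // x0 _; exists s3, (ecost s3 (Var 1)); split=> //.
    - by apply: ExWhileF; rewrite /= q1 x0.
    - by rewrite /= q1 x0 /= trunc_log0; lia.
    - by rewrite q0 -hl x0.
  have x0 : x != 0 by case: eqP hx.
  have {}pn := pn x0.
  have e1 : (if x %/ 2 == 0 then 0 else (trunc_log 2 (x %/ 2)).+1) = sz.
    by rewrite nlog //; move: hx; rewrite (negbTE x0) => -[].
  pose s4 := upd s3 0 (@encode _ (@enc_seq nat enc_nat) (p :: l)).
  pose s5 := upd s4 2 (@encode nat enc_nat (p * 2)).
  pose s6 := upd s5 1 (@encode nat enc_nat (x %/ 2)).
  have q60 : s6 0 = @encode _ (@enc_seq nat enc_nat) (p :: l) by [].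
  have q61 : s6 1 = @encode nat enc_nat (x %/ 2) by [].
  have q62 : s6 2 = @encode nat enc_nat (p * 2) by [].
  have [||s7 [t7 [e7 l7 r7 fr7]]] := IH _ _ _ _ e1 q60 q61 q62 (etrans (powsS x p l x0) hl).
  - exact: leq_trans (leq_div _ _) xn.
  - move=> x20; have : p * 2 \in pows n.
      rewrite -hl mem_cat mem_rev; apply/orP; left; apply/mapP; exists 1 => //.
      rewrite (negbTE x0) mem_iota /= add0n ltnS trunc_log_gt0 //=.
      by move: x20; rewrite -lt0n divn_gt0.
    by move/(allP (pows_le n)).
  eexists; eexists; split.
  - apply: ExWhileT; first by rewrite /= q1; case: (x) x0.
      apply: ExSeq; first exact: ExAssign.
      apply: ExSeq; first exact: ExAssign.
      exact: ExAssign.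
    have -> : upd (upd (upd s3 0 (eval s3 (Bin OCons (Var 2) (Var 0)))) 2
        (eval (upd s3 0 (eval s3 (Bin OCons (Var 2) (Var 0)))) (Bin OMul (Var 2) (Const 2)))) 1
        (eval (upd (upd s3 0 (eval s3 (Bin OCons (Var 2) (Var 0)))) 2
        (eval (upd s3 0 (eval s3 (Bin OCons (Var 2) (Var 0)))) (Bin OMul (Var 2) (Const 2)))) (Bin ODiv (Var 1) (Const 2)))
        = s6.
      by rewrite /= /upd /= q0 q1 q2.
    exact: e7.
  - have lsz : @esize _ (@enc_seq nat enc_nat) (p :: l) <= esize n * (esize n).+1 + 1.
      apply: leq_trans (esz n); rewrite -hl -powsS //.
      by have := @esize_cat nat enc_nat (rev [seq p * 2 * 2 ^ c | c <- iota 0 (if x %/ 2 == 0 then 0 else (trunc_log 2 (x %/ 2)).+1)]) (p :: l);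
        have := @esize_gt0 _ (@enc_seq nat enc_nat) (rev [seq p * 2 * 2 ^ c | c <- iota 0 (if x %/ 2 == 0 then 0 else (trunc_log 2 (x %/ 2)).+1)]); lia.
    have xs := esize_le xn; have ps := esize_le pn.
    have ps2 := esize_mul p 2.
    have xs2 := esize_le (leq_trans (leq_div x 2) xn).
    have t2 : trunc_log 2 2 = 1 by [].
    rewrite /= /upd /= q0 q1 q2 /= t2.
    rewrite -![vsize (vlist _)]/(@esize _ (@enc_seq nat enc_nat) l).
    change ((trunc_log 2 x).+1) with (@esize nat enc_nat x).
    change ((trunc_log 2 p).+1) with (@esize nat enc_nat p).
    change ((trunc_log 2 (p * 2)).+1) with (@esize nat enc_nat (p * 2)).
    change ((trunc_log 2 (x %/ 2)).+1) with (@esize nat enc_nat (x %/ 2)).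
    move: lsz ps2 l7; rewrite esize_cons.
    have -> : @esize nat enc_nat 2 = 2 by [].
    move: xs ps xs2; set M := _ * _.+1 => xs ps xs2 lsz ps2 l7.
    rewrite [sz.+2 * _]mulSn; move: l7; set Y := sz.+1 * _; lia.
  - exact: r7.
  - by move=> y; rewrite ltnNge => y3; rewrite fr7 ?ltnNge // /s6 /s5 /s4 !upd_neq //; apply: contra y3 => /eqP ->.
pose s1 := upd (upd (upd s 1 (s 0)) 2 (Nat 1)) 0 (Nat 0).
have [||||||s2 [t2 [e2 l2 r2 fr2]]] := loop _ n 1 [::] s1 erefl => //.
- by rewrite cats0 /pows; congr rev; apply: eq_map => c; rewrite mul1n.
- by rewrite -lt0n.
eexists; eexists; split.
- do 3!(apply: ExSeq; first exact: ExAssign).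
  exact: e2.
- rewrite /= /upd /= s0 /= trunc_log0 trunc_log1.
  change ((trunc_log 2 n).+1) with (@esize nat enc_nat n).
  set z := @esize nat enc_nat n; rewrite (addn1 z).
  have ht : t2 <= z.+1 * (20 * (z * z.+1 + z + 2)); last by move: ht; set Y := _ * (20 * _); lia.
  apply: leq_trans l2 _; rewrite leq_mul2r ltnS; apply/orP; right.
  by case: eqP; rewrite // /esize /= leqnn.
- exact: r2.
- by move=> y; rewrite ltnNge => y3; rewrite fr2 ?ltnNge // /s1 !upd_neq //; apply: contra y3 => /eqP ->.
Qed.

(** * Minimisers, list update and the syntax-directed search for [PT] *)

Definition amin A (f : A -> nat) d s := foldr (fun x y => if f x <= f y then x else y) d s.

Definition setn (s : seq nat) j v : seq nat :=
  [seq if c == j then v else nth 0 s c | c <- iota 0 (size s)].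

(** A hook, redefined whenever a new notion has been shown to be in [PT], so that the search treats
    this notion as a primitive. *)
Ltac pt_user := fail.

Ltac pt1 := cbv beta; lazymatch goal with
  | |- PT (fun e => e) => exact: PT_id
  | |- PT fst => exact: (PT_fst PT_id)
  | |- PT snd => exact: (PT_snd PT_id)
  | |- PT (fun _ => ?c) => exact: (PT_const c)
  | |- PT (fun e => (@?a e, @?b e)) => apply: (PT_pair (f := a) (g := b))
  | |- PT (fun e => (@?a e).1) => apply: (PT_fst (f := a))
  | |- PT (fun e => (@?a e).2) => apply: (PT_snd (f := a))
  | |- PT (fun e => @?a e :: @?b e) => apply: (PT_cons (f := a) (g := b))
  | |- PT (fun e => behead (@?a e)) => apply: (PT_behead (g := a))
  | |- PT (fun e => @?a e ++ @?b e) => apply: (PT_cat (l := a) (s := b))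
  | |- PT (fun e => @?a e + @?b e) => apply: (PT_add (f := a) (g := b))
  | |- PT (fun e => @?a e * @?b e) => apply: (PT_mul (f := a) (g := b))
  | |- PT (fun e => @?a e - @?b e) => apply: (PT_sub (f := a) (g := b))
  | |- PT (fun e => @?a e %/ @?b e) => apply: (PT_div (f := a) (g := b))
  | |- PT (fun e => (@?a e).+1 <= @?b e) => refine (@PT_leq _ _ (fun e => (a e).+1) b _ _)
  | |- PT (fun e => @?a e <= @?b e) => apply: (PT_leq (f := a) (g := b))
  | |- PT (fun e => (@?a e).+1) => apply: (PT_succ (f := a))
  | |- PT (fun e => (@?a e).-1) => apply: (PT_pred (f := a))
  | |- PT (fun e => (@?a e) && (@?b e)) => apply: (PT_andb (b := a) (c := b))
  | |- PT (fun e => (@?a e) || (@?b e)) => apply: (PT_orb (b := a) (c := b))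
  | |- PT (fun e => ~~ (@?a e)) => apply: (PT_negb (b := a))
  | |- PT (fun e => @eq_op _ (@?a e) (@?b e)) => apply: (PT_eqn (f := a) (g := b))
  | |- PT (fun e => map (@?F e) (@?l e)) => apply: (PT_map (F := F) (l := l))
  | |- PT (fun e => filter (@?F e) (@?l e)) => apply: (PT_filter (P := F) (l := l))
  | |- PT (fun e => has (@?F e) (@?l e)) => apply: (PT_has (P := F) (l := l))
  | |- PT (fun e => sumn (@?l e)) => apply: (PT_sumn (l := l))
  | |- PT (fun e => prodn (@?l e)) => apply: (PT_prodn (l := l))
  | |- PT (fun e => flatten (@?l e)) => apply: (PT_flatten (l := l))
  | |- PT (fun e => iota 0 (size (@?l e))) => apply: (PT_iota_size (l := l))
  | |- PT (fun e => nseq (size (@?l e)) (@?a e)) => apply: (PT_nseq_size (s := l) (a := a))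
  | |- PT (fun e => size (@?l e)) => apply: (PT_size (l := l))
  | |- PT (fun e => nth ?d (@?l e) (@?n e)) => apply: (PT_nth d (l := l) (n := n))
  | |- PT (fun e => pows (@?l e)) => apply: (PT_pows (f := l))
  | |- PT (fun e => amin (@?f e) (@?d e) (@?l e)) => apply: (PT_amin (f := f) (d := d) (l := l))
  | |- PT (fun e => in_mem (@?x e) (@mem _ _ (@?l e))) => apply: (PT_memn (x := x) (l := l))
  | |- PT (fun e => mem_seq (@?l e) (@?x e)) => apply: (PT_memn (x := x) (l := l))
  | |- _ => first [pt_user | apply: PT_if]
  end.
Ltac pt_hyp := match goal with
  | H : PT ?h |- PT (fun e => ?h (@?g e)) => apply: (PT_comp (f := g) _ H)
  end.
Ltac pt := repeat (first [assumption | pt_hyp | pt1]).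

Lemma PT_setn E {eE : enc E} (s : E -> seq nat) j v :
  PT s -> PT j -> PT v -> PT (fun e => setn (s e) (j e) (v e)).
Proof. by move=> ps pj pv; rewrite /setn; pt. Qed.

Ltac pbt := repeat first [assumption | exact: pb_const | apply: pb_add | apply: pb_mul].

(** * The algorithm *)

Section Auction.
Variables (us : seq nat) (adj : seq (seq nat)).

(* The bidders are the positions in [adj].  The owner of good [j] is recorded as
   [l.+1] for bidder [l], and as [0] if there is none. *)
Definition astate := ((seq nat * seq nat) * (seq nat * seq nat))%type.
Implicit Types st : astate.
Definition queue st := st.1.1.
Definition dropped st := st.1.2.
Definition owner st := st.2.1.
Definition price st := st.2.2.

Definition bidder st := nth 0 (queue st) 0.
Definition wanted st := nth [::] adj (bidder st).
Definition best st := amin (fun j => nth 0 (price st) j) (nth 0 (wanted st) 0) (wanted st).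

Definition adrop st : astate :=
  ((behead (queue st), bidder st :: dropped st), (owner st, price st)).

Definition aassign st : astate :=
  ((if nth 0 (owner st) (best st) == 0 then behead (queue st)
    else (nth 0 (owner st) (best st)).-1 :: behead (queue st), dropped st),
   (setn (owner st) (best st) (bidder st).+1,
    setn (price st) (best st) (nth 0 (price st) (best st)).+1)).

Definition astep st : astate :=
  if size (queue st) == 0 then st else
  if (size (wanted st) == 0) || (size adj < nth 0 (price st) (best st))
  then adrop st else aassign st.

Definition ainit : astate :=
  ((iota 0 (size adj), [::]), (nseq (size us) 0, nseq (size us) 0)).

(* Every step raises a price or drops a bidder, and prices never exceed
   [(size adj).+1]. *)
Definition fuel : seq nat :=
  flatten [seq nseq (size ([::] :: adj)) 0 | _ <- us] ++ nseq (size ([::] :: adj)) 0.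

Definition auction : astate := iter (size fuel) astep ainit.

End Auction.

Lemma size_setn s j v : size (setn s j v) = size s.
Proof. by rewrite size_map size_iota. Qed.

Lemma nth_setn s j v i : j < size s -> nth 0 (setn s j v) i = if i == j then v else nth 0 s i.
Proof.
move=> js; have [is_|is_] := ltnP i (size s).
  by rewrite (nth_map 0) ?size_iota // nth_iota.
rewrite !nth_default ?size_map ?size_iota //.
by case: eqP js => // <-; rewrite ltnNge is_.
Qed.

Lemma all_setn (P : pred nat) s j v : all P s -> P v -> all P (setn s j v).
Proof.
move=> al Pv; apply/allP => x /mapP[i]; rewrite mem_iota add0n => /andP[_ lt] ->.
by case: eqP => // _; apply: (allP al); rewrite mem_nth.
Qed.

(** Bounds after [t] steps that assume nothing about [adj]: the cost must be polynomial on every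
    value of the input type, whether or not its indices are in range. *)
Definition abound n g t (st : astate) :=
  [/\ size (queue st) <= n, all (fun x => x <= n) (queue st),
      size (dropped st) <= t, all (fun x => x <= n) (dropped st) &
      [/\ size (owner st) = g, all (fun x => x <= n.+1) (owner st),
          size (price st) = g & all (fun x => x <= t) (price st)]].

Lemma abound_step adj g t st : abound (size adj) g t st ->
  abound (size adj) g t.+1 (astep adj st).
Proof.
have wk s : all (fun x => x <= t) s -> all (fun x => x <= t.+1) s.
  by apply: sub_all => x; exact: leqW.
case: st => [[q d] [ow pr]]; rewrite /abound /astep /queue /dropped /owner /price /=.
move=> [sq aq sd ad [so ao sp ap]]; case: eqP => [q0|q0]; first by split=> //=; [exact: leqW | split=> //; exact: wk].
case: q q0 sq aq => [|l q] //= _ sq /andP[ln aq]; case: ifP => _.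
  by split=> //=; rewrite /bidder /= ?ln //; [exact: ltnW | split=> //; exact: wk].
rewrite /aassign /bidder /dropped /queue /owner /price /=; set j := best _ _.
split=> //=.
- by case: eqP => /= _; [exact: ltnW|].
- case: eqP => //= _; rewrite aq andbT.
  have [lt|ge] := ltnP j (size ow); last by rewrite nth_default.
  by have /= := allP ao _ (mem_nth 0 lt); lia.
- exact: leqW.
- rewrite !size_setn; split=> //; first exact: all_setn.
  apply: all_setn; first exact: wk.
  rewrite ltnS; have [lt|ge] := ltnP j (size pr); last by rewrite nth_default.
  by apply: (allP ap); rewrite mem_nth.
Qed.

Lemma abound_iter us adj t :
  abound (size adj) (size us) t (iter t (astep adj) (ainit us adj)).
Proof.
elim: t => [|t IH] /=; last exact: abound_step.
split=> //=; rewrite ?size_iota //.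
  by apply/allP => x; rewrite mem_iota add0n => /ltnW.
by rewrite !size_nseq !all_nseq !orbT.
Qed.

Lemma PT_best E {eE : enc E} (adj : E -> seq (seq nat)) (st : E -> astate) :
  PT adj -> PT st -> PT (fun e => best (adj e) (st e)).
Proof. by move=> pa ps; rewrite /best /wanted /bidder /queue /price; pt. Qed.

Ltac pt_user ::= lazymatch goal with
  | |- PT (fun e => best _ _) => apply: PT_best
  | |- PT (fun e => setn _ _ _) => apply: PT_setn
  end.

Lemma PT_auction E {eE : enc E} (us : E -> seq nat) (adj : E -> seq (seq nat)) :
  PT us -> PT adj -> PT (fun e => auction (us e) (adj e)).
Proof.
move=> pu pa.
have pF : PT (fun e => fuel (us e) (adj e)).
  by rewrite /fuel; pt.
pose n e := size (adj e); pose g e := size (us e); pose t e := size (fuel (us e) (adj e)).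
have [pn pg pt'] : [/\ pb n, pb g & pb t] by split; exact: pb_size.
rewrite /auction.
apply: (PT_iter (h := fun e => n e * (n e + 2) + t e * (n e + 2) + g e * (n e + 3) + g e * (t e + 2) + 7)) => //.
- by rewrite /astep /adrop /aassign /wanted /bidder /queue /owner /price /dropped; pt. 
- by rewrite /ainit; pt.
- by pbt.
- move=> e i it; have := abound_iter (us e) (adj e) i.
  case: (iter _ _ _) => [[q d] [ow pr]].
  rewrite /abound /queue /dropped /owner /price /= -/(n e) -/(g e) => -[sq aq sd ad [so ao sp ap]].
  rewrite !esize_pair /=.
  have hs (l : seq nat) a b : size l <= a -> all (fun x => x <= b) l ->
      @esize _ (@enc_seq nat enc_nat) l <= a * (b + 2) + 1.
    by move=> la al; apply: leq_trans (esize_seq_nat al) _; rewrite addn2 leq_add2r leq_mul2r la orbT.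
  have h1 := hs _ _ _ sq aq; have h2 := hs _ _ _ sd ad.
  have h3 := hs _ _ _ (eq_leq so) ao; have h4 := hs _ _ _ (eq_leq sp) ap.
  have h5 : i * (n e + 2) <= t e * (n e + 2) by rewrite leq_mul2r it orbT.
  have h6 : g e * (i + 2) <= g e * (t e + 2) by rewrite leq_mul2l leq_add2r it orbT.
  by move: h1 h2 h3 h4 h5 h6; rewrite -addnS addSnnS; lia.
Qed.

(* A configuration with its LP value: person, goods, integer weight. *)
Definition entry := (nat * (seq nat * nat))%type.
Definition inst := (seq (seq nat) * ((nat * nat) * (nat * seq entry)))%type.
(* The small persons served so far with their goods, the critical persons left,
   and for every good the number [c] of claims and the power [M ^ c]. *)
Definition pstate := (seq (nat * seq nat) * (seq nat * (seq nat * seq nat)))%type.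
Definition node := (nat * (nat * seq nat))%type.

Section Algorithm.
Variable I : inst.
Implicit Types (X S : seq nat) (e : entry) (st : pstate) (i j fl p d : nat).

Definition mat := I.1.
Definition pers := iota 0 (size mat).
Definition goods := iota 0 (size (nth [::] mat 0)).
Definition ut i j := nth 0 (nth [::] mat i) j.
Definition tnum := I.2.1.1.
Definition tden := I.2.1.2.
Definition den := I.2.2.1.
Definition ents := I.2.2.2.
(* A bounded loop runs over a list, so that numbers bounding a loop are given
   as the sizes of lists: [rtl] for [rt], and [two], [unitl] for [2 rt], [1]. *)
Definition rtl := [seq c <- pers | c.+1 * c.+1 <= size mat].
Definition rt := size rtl.

(** Singletons are exactly the big configurations: a single small good is worth less than [T], so a
    valid configuration of small goods never has one element. *)
Definition sgl e := size e.2.1 == 1.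
(** Only the big goods that the LP solution actually uses for [i]: the counting arguments charge
    them to LP mass. *)
Definition adj i :=
  [seq j <- goods | has (fun e => sgl e && ((e.1 == i) && (j \in e.2.1))) ents].
Definition bload j := sumn [seq e.2.2 | e <- [seq e <- ents | sgl e && (j \in e.2.1)]].
Definition nn j := (rt * (den - bload j)) %/ den.
Definition ncov X j := has (fun i => j \in adj i) X.
Definition kill X j := (nn j == 0) || ncov X j.
Definition aval X e := sumn [seq ut e.1 j | j <- [seq j <- e.2.1 | ~~ kill X j]].
Definition alive X e := ~~ sgl e && (tnum <= 2 * (tden * aval X e)).
Definition amass X i := sumn [seq e.2.2 | e <- [seq e <- ents | alive X e && (e.1 == i)]].
Definition needy X := [seq i <- pers | rt * amass X i < den].

(* [size tw] copies of every person in [S] bid for the copies of the goods;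
   good [j] has [size tw - fl * nn j] of them. *)
Definition copies (tw : seq nat) fl i :=
  flatten [seq [seq j * size tw + c | c <- [seq c <- iota 0 (size tw) | c + fl * nn j < size tw]]
          | j <- adj i].
Definition cgoods (tw : seq nat) := iota 0 (size (flatten [seq tw | _ <- goods])).
Definition cadj tw fl S := flatten [seq nseq (size tw) (copies tw fl i) | i <- S].
Definition defi tw fl S := size (dropped (auction (cgoods tw) (cadj tw fl S))).
Definition del i S : seq nat := [seq i' <- S | ~~ (i' == i)].
Definition crit tw fl S := [seq i <- S | defi tw fl (del i S) < defi tw fl S].

Definition two := rtl ++ rtl.
Definition tight X := crit two 1 (needy X).
Definition tightfix := iter (size ([::] :: mat)) tight [::].

Definition unitl : seq nat := [:: 0].
(* A common multiple clearing the denominators of the costs, so that they can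
   be compared as natural numbers. *)
Definition scale X := prodn [seq aval X e | e <- [seq e <- ents | alive X e]].
Definition vv X e j := ut e.1 j * (scale X %/ aval X e).
Definition ww X j :=
  sumn [seq e.2.2 * vv X e j | e <- [seq e <- ents | alive X e && (j \in e.2.1)]].
(** Up to a common factor, the first summand is the growth of the potential if [e] is chosen. The
    second measures how much of the value of [e] lies on crowded goods. Minimising the sum controls
    both with a single choice. *)
Definition cost X (pw : seq nat) e :=
  sumn [seq (ww X j * (rt %/ nn j) + den * vv X e j) * nth 0 pw j
       | j <- [seq j <- e.2.1 | ~~ kill X j]].
Definition served st := st.1.
Definition rest st := st.2.1.
Definition cnt st := st.2.2.1.
Definition pwr st := st.2.2.2.
Definition cands X S := [seq e <- ents | alive X e && (e.1 \in crit unitl 0 S)].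
Definition nilent : entry := (0, ([::], 0)).
Definition chosen X st : entry :=
  amin (cost X (pwr st)) (nth nilent (cands X (rest st)) 0) (cands X (rest st)).
(** A refused good still counts as claimed: the potential follows the claims, whereas [grant] caps
    what is handed out. *)
Definition claimed X e j := (j \in e.2.1) && ~~ kill X j.
Definition grant X st e := [seq j <- e.2.1 | ~~ kill X j && (nth 0 (cnt st) j < 16 * nn j)].
Definition pgo X st : pstate :=
  ((((chosen X st).1), grant X st (chosen X st)) :: served st,
   (del (chosen X st).1 (rest st),
    ([seq (if claimed X (chosen X st) j then (nth 0 (cnt st) j).+1 else nth 0 (cnt st) j) | j <- goods],
     [seq (if claimed X (chosen X st) j then nth 0 (pwr st) j * (rt %/ nn j).+1
           else nth 0 (pwr st) j) | j <- goods]))).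
Definition pstep X st : pstate := if defi unitl 0 (rest st) == 0 then st else pgo X st.
Definition pinit X : pstate := ([::], (X, ([seq 0 | _ <- goods], [seq 1 | _ <- goods]))).
Definition prun X := iter (size mat) (pstep X) (pinit X).

Definition cls i p (G : seq (nat * nat)) :=
  [seq g <- G | (p <= ut i g.1) && (ut i g.1 < 2 * p)].
(* The shares [g.2] are at most [d], hence there are [_ %/ d] slots: the range
   [iota 0 (size G)] is long enough. *)
Definition slot i d p G : seq node :=
  [seq (i, (p, [seq g.1 | g <- cls i p G]))
  | c <- [seq c <- iota 0 (size G) | c < sumn [seq g.2 | g <- cls i p G] %/ d]].
(** The sum of a row bounds each of its utilities, so every positive utility falls into exactly one
    of the classes. *)
Definition slots i d G := flatten [seq slot i d p G | p <- pows (sumn (nth [::] mat i))].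

Definition smass X i j :=
  sumn [seq e.2.2 | e <- [seq e <- ents | alive X e && ((e.1 == i) && (j \in e.2.1))]].
Definition gshare X i := [seq (j, smass X i j) | j <- [seq j <- goods | ~~ kill X j]].
Definition bigs X st := [seq i <- needy X | ~~ (i \in X)] ++ rest st.
(** A node is a person, a guaranteed value and the goods it accepts; the value is 0 for a person
    waiting for a big good. The divisors [8 * den] and [64 * rt] make each of the two kinds of slots
    load a good by at most n_j / (4 E). *)
Definition nodes X st : seq node :=
  [seq (i, (0, adj i)) | i <- bigs X st] ++
  (flatten [seq slots i (8 * den) (gshare X i) | i <- [seq i <- pers | ~~ (i \in needy X)]] ++
   flatten [seq slots q.1 (64 * rt) [seq (j, 1) | j <- q.2] | q <- served st]).
Definition assign (ns : seq node) : seq (nat * nat) :=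
  [seq ((nth (0, (0, [::])) ns (nth 0 (owner (auction goods [seq nd.2.2 | nd <- ns])) j).-1).1, j)
  | j <- [seq j <- goods | ~~ (nth 0 (owner (auction goods [seq nd.2.2 | nd <- ns])) j == 0)]].
Definition solve := assign (nodes tightfix (prun tightfix)).
End Algorithm.

(* The types follow [enc_input]; [unit] encodes as the end of a list. *)
Definition rentry := (nat * (seq nat * ((nat * nat) * unit)))%type.
Definition rinput :=
  (nat * (nat * (seq (seq nat) * ((nat * nat) * (seq rentry * unit)))))%type.
Definition rden (l : seq rentry) := prodn [seq r.2.2.1.2 | r <- l].
Definition toinst (v : rinput) : inst :=
  (v.2.2.1, (v.2.2.2.1, (rden v.2.2.2.2.1,
    [seq (r.1, (r.2.1, r.2.2.1.1 * (rden v.2.2.2.2.1 %/ r.2.2.1.2))) | r <- v.2.2.2.2.1]))).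
Definition main (v : rinput) := solve (toinst v).

(** * Running time of the algorithm *)

Ltac pt_unf :=
  rewrite /rt /rtl /pers /goods /ut /tnum /tden /den /ents /sgl /mat.

Lemma PT_adj E {eE : enc E} I i : PT I -> PT i -> PT (fun e : E => adj (I e) (i e)).
Proof. by move=> ? ?; rewrite /adj; pt_unf; pt. Qed.

Lemma PT_nn E {eE : enc E} I j : PT I -> PT j -> PT (fun e : E => nn (I e) (j e)).
Proof. by move=> ? ?; rewrite /nn /bload; pt_unf; pt. Qed.

Ltac pt_alg1 := lazymatch goal with
  | |- PT (fun e => adj _ _) => apply: PT_adj
  | |- PT (fun e => nn _ _) => apply: PT_nn
  end.
Ltac pt_user ::= pt_alg1.

Lemma PT_ncov E {eE : enc E} I X j : PT I -> PT X -> PT j -> PT (fun e : E => ncov (I e) (X e) (j e)).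
Proof. by move=> ? ? ?; rewrite /ncov; pt. Qed.

Lemma PT_defi E {eE : enc E} I tw fl S : PT I -> PT tw -> PT fl -> PT S ->
  PT (fun e : E => defi (I e) (tw e) (fl e) (S e)).
Proof.
move=> ? ? ? ?; rewrite /defi /cgoods /cadj /copies /goods /mat /dropped; pt.
apply: PT_auction; pt.
Qed.

Ltac pt_alg2 := lazymatch goal with
  | |- PT (fun e => ncov _ _ _) => apply: PT_ncov
  | |- PT (fun e => defi _ _ _ _) => apply: PT_defi
  | |- _ => pt_alg1
  end.
Ltac pt_user ::= pt_alg2.

Lemma PT_kill E {eE : enc E} I X j : PT I -> PT X -> PT j -> PT (fun e : E => kill (I e) (X e) (j e)).
Proof. by move=> ? ? ?; rewrite /kill; pt. Qed.

Lemma PT_crit E {eE : enc E} I tw fl S : PT I -> PT tw -> PT fl -> PT S ->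
  PT (fun e : E => crit (I e) (tw e) (fl e) (S e)).
Proof. by move=> ? ? ? ?; rewrite /crit /del; pt. Qed.

Ltac pt_alg3 := lazymatch goal with
  | |- PT (fun e => kill _ _ _) => apply: PT_kill
  | |- PT (fun e => crit _ _ _ _) => apply: PT_crit
  | |- _ => pt_alg2
  end.
Ltac pt_user ::= pt_alg3.

Lemma PT_aval E {eE : enc E} I X en : PT I -> PT X -> PT en -> PT (fun e : E => aval (I e) (X e) (en e)).
Proof. by move=> ? ? ?; rewrite /aval; pt_unf; pt. Qed.

Ltac pt_alg4 := lazymatch goal with
  | |- PT (fun e => aval _ _ _) => apply: PT_aval
  | |- _ => pt_alg3
  end.
Ltac pt_user ::= pt_alg4.

Lemma PT_alive E {eE : enc E} I X en : PT I -> PT X -> PT en -> PT (fun e : E => alive (I e) (X e) (en e)).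
Proof. by move=> ? ? ?; rewrite /alive; pt_unf; pt. Qed.

Ltac pt_alg5 := lazymatch goal with
  | |- PT (fun e => alive _ _ _) => apply: PT_alive
  | |- _ => pt_alg4
  end.
Ltac pt_user ::= pt_alg5.

Lemma PT_needy E {eE : enc E} I X : PT I -> PT X -> PT (fun e : E => needy (I e) (X e)).
Proof. by move=> ? ?; rewrite /needy /amass; pt_unf; pt. Qed.

Lemma PT_vv E {eE : enc E} I X en j : PT I -> PT X -> PT en -> PT j ->
  PT (fun e : E => vv (I e) (X e) (en e) (j e)).
Proof. by move=> ? ? ? ?; rewrite /vv /scale; pt_unf; pt. Qed.

Ltac pt_alg6 := lazymatch goal with
  | |- PT (fun e => needy _ _) => apply: PT_needy
  | |- PT (fun e => vv _ _ _ _) => apply: PT_vv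
  | |- _ => pt_alg5
  end.
Ltac pt_user ::= pt_alg6.

Lemma PT_tightfix E {eE : enc E} I : PT I -> PT (fun e : E => tightfix (I e)).
Proof.
move=> pI.
have pp : PT (fun e => pers (I e)) by pt_unf; pt.
rewrite /tightfix.
apply: (PT_iter (h := fun e => esize (pers (I e)) + 1)).
- by rewrite /tight /crit /del /two; pt_unf; pt.
- exact: PT_const.
- by pt_unf; pt.
- by pbt; exact: PT_pb.
- move=> e [|i] _ /=; first by rewrite esize_nil leq_addl.
  apply: leq_trans (leq_addr _ _); rewrite /tight /crit /needy.
  by apply: leq_trans (esize_filter _ _) _; exact: esize_filter.
Qed.

Lemma amin_mem (A : Type) (f : A -> nat) d s : List.In (amin f d s) (d :: s).
Proof.
elim: s => [|x s IH] /=; first by left.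
case: ifP => _; first by right; left.
by case: IH => [e|h]; [left | right; right].
Qed.

(** The entries of [pwr] may grow exponentially in [t], but a step multiplies them by at most E + 1,
    so their binary length is linear in [t]. The 5 is the size of the default configuration
    [nilent]. *)
Definition pbound (I : inst) (X : seq nat) t (st : pstate) :=
  [/\ size (served st) <= t,
      forall q, List.In q (served st) -> esize q <= esize (ents I) + 5,
      esize (rest st) <= esize X,
      size (cnt st) = size (goods I) /\ all (fun x => x <= t) (cnt st) &
      size (pwr st) = size (goods I) /\
      forall x, List.In x (pwr st) -> esize x <= 1 + t * esize (rt I).+1].

Lemma In_filter (A : Type) (P : pred A) a s : List.In a (filter P s) -> List.In a s.
Proof.
elim: s => //= b s IH; case: ifP => _ /=; last by move/IH; right.
by case=> [->|/IH]; [left | right].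
Qed.

Lemma pick_esize I X st : esize (chosen I X st) <= esize (ents I) + 5.
Proof.
have : List.In (chosen I X st) (nilent :: ents I).
  rewrite /chosen; case: (amin_mem (cost I X (pwr st)) (nth nilent (cands I X (rest st)) 0) (cands I X (rest st))) => [<-|].
    have sub : forall s, List.In (nth nilent [seq e <- s | alive I X e & e.1 \in crit I unitl 0 (rest st)] 0) (nilent :: s).
      elim=> [|e s IH] /=; first by left.
      case: ifP => _ /=; first by right; left.
      by case: IH => [h|h]; [left | right; right].
    exact: sub.
  by move=> h; right; exact: In_filter h.
case=> [<-|h]; first exact: leq_addl.
by apply: leq_trans (leq_addr _ _); exact: esize_mem.
Qed.

Lemma pbound_step I X t st : pbound I X t st -> pbound I X t.+1 (pstep I X st).
Proof.
rewrite /pstep; case: eqP => _ [h1 h2 h3 [h4 h5] [h6 h7]].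
  split=> //; first exact: leqW.
    by split=> //; apply: sub_all h5 => x; exact: leqW.
  by split=> // x /h7 h; apply: leq_trans h _; rewrite leq_add2l leq_mul2r leqnSn orbT.
set e := chosen I X st; have he := pick_esize I X st; rewrite -/e in he.
split=> /=; rewrite /served /rest /cnt /pwr /=.
- by [].
- move=> q [<-|/h2//]; rewrite -/e; move: he; rewrite !esize_pair /= => he.
  by have := @esize_filter nat enc_nat (fun j => ~~ kill I X j && (nth 0 (cnt st) j < 16 * nn I j)) e.2.1; rewrite -/(grant I X st e); move: he; lia.
- exact: leq_trans (esize_filter _ _) h3.
- rewrite size_map; split=> //; apply/allP => x /mapP[j jg ->].
  have : nth 0 (cnt st) j <= t by apply: (allP h5); rewrite mem_nth // h4; move: jg; rewrite /goods size_iota mem_iota.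
  by case: ifP => _ // /leqW.
- rewrite size_map; split=> // x /List.in_map_iff [j [<- jg]].
  have hj : esize (nth 0 (pwr st) j) <= 1 + t * esize (rt I).+1.
    have [lt|ge] := ltnP j (size (pwr st)); last by rewrite nth_default //.
    by apply: h7; elim: (pwr st) j lt {jg} => [|y s IH] [|j] //= lt; [left | right; exact: IH].
  case: ifP => _; last by apply: leq_trans hj _; rewrite leq_add2l leq_mul2r leqnSn orbT.
  apply: leq_trans (esize_mul _ _) _; rewrite mulSn addnCA addnC leq_add //.
  by apply: esize_le; rewrite ltnS leq_div.
Qed.

Lemma pbound_iter I X t : pbound I X t (iter t (pstep I X) (pinit I X)).
Proof.
elim: t => [|t IH]; last exact: pbound_step.
split=> //=; rewrite /cnt /pwr /= size_map; split=> //.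
  by apply/allP => x /mapP[j _ ->].
by move=> x /List.in_map_iff [j [<- _]].
Qed.

Lemma PT_cost E {eE : enc E} I X pw en : PT I -> PT X -> PT pw -> PT en ->
  PT (fun e : E => cost (I e) (X e) (pw e) (en e)).
Proof. by move=> ? ? ? ?; rewrite /cost /ww; pt_unf; pt. Qed.

Ltac pt_alg8 := lazymatch goal with
  | |- PT (fun e => cost _ _ _ _) => apply: PT_cost
  | |- _ => pt_alg6
  end.
Ltac pt_user ::= pt_alg8.
Lemma PT_chosen E {eE : enc E} I X st : PT I -> PT X -> PT st -> PT (fun e : E => chosen (I e) (X e) (st e)).
Proof. by move=> ? ? ?; rewrite /chosen /cands /rest /pwr; pt_unf; pt. Qed.

Ltac pt_alg9 := lazymatch goal with
  | |- PT (fun e => chosen _ _ _) => apply: PT_chosen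
  | |- _ => pt_alg8
  end.
Ltac pt_user ::= pt_alg9.
Lemma PT_prun E {eE : enc E} I X : PT I -> PT X -> PT (fun e : E => prun (I e) (X e)).
Proof.
move=> pI pX.
pose n e := size (mat (I e)); pose g e := size (goods (I e)).
pose (z := fun e => esize (ents (I e))); pose (y := fun e => esize (X e)).
pose (r := fun e => esize (rt (I e)).+1).
have pn : pb n by apply: pb_size; pt_unf; pt.
have pg : pb g by apply: pb_size; pt_unf; pt.
have pz : pb z by apply: PT_pb; pt_unf; pt.
have py : pb y by apply: PT_pb; pt_unf; pt.
have pr : pb r by apply: (PT_pb (f := fun e => (rt (I e)).+1)); pt_unf; pt.
rewrite /prun.
apply: (PT_iter (h := fun e => n e * (z e + 6) + y e + g e * (n e + 2) + g e * (n e * r e + 2) + 6)).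
- by rewrite /pstep /pgo /del /grant /claimed /served /rest /cnt /pwr; pt_unf; pt.
- by rewrite /pinit; pt_unf; pt.
- by pt_unf; pt.
- by pbt.
- move=> e i it; have := pbound_iter (I e) (X e) i.
  case: (iter _ _ _) => [sv [rs [cn pw]]].
  rewrite /pbound /served /rest /cnt /pwr /= -/(n e) -/(g e) -/(z e) -/(y e) -/(r e).
  move=> [h1 h2 h3 [h4 h5] [h6 h7]]; rewrite !esize_pair /=.
  have k1 := esize_seq_le h2; have k2 := esize_seq_nat h5; have k3 := esize_seq_le h7.
  have l1 : size sv * (z e + 5).+1 <= n e * (z e + 6) by rewrite -addnS leq_mul2r (leq_trans h1) ?orbT.
  have l2 : size cn * i.+2 <= g e * (n e + 2) by rewrite h4 leq_mul2l addn2 !ltnS it orbT.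
  have l3 : size pw * (1 + i * r e).+1 <= g e * (n e * r e + 2).
    by rewrite h6 leq_mul2l add1n addn2 !ltnS leq_mul2r it !orbT.
  by move: h3 k1 k2 k3 l1 l2 l3; lia.
Qed.

Lemma PT_slots E {eE : enc E} I i d G : PT I -> PT i -> PT d -> PT G ->
  PT (fun e : E => slots (I e) (i e) (d e) (G e)).
Proof. by move=> ? ? ? ?; rewrite /slots /slot /cls; pt_unf; pt. Qed.

Ltac pt_alg10 := lazymatch goal with
  | |- PT (fun e => prun _ _) => apply: PT_prun
  | |- PT (fun e => tightfix _) => apply: PT_tightfix
  | |- PT (fun e => auction _ _) => apply: PT_auction
  | |- PT (fun e => slots _ _ _ _) => apply: PT_slots
  | |- _ => pt_alg9
  end.
Ltac pt_user ::= pt_alg10.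

Lemma PT_main : PT main.
Proof.
have pi : PT toinst by rewrite /toinst /rden; pt.
rewrite /main; apply: (PT_comp pi).
have pX : PT tightfix by apply: (PT_tightfix PT_id).
have pP : PT (fun I => prun I (tightfix I)) by pt.
rewrite /solve.
have pn : PT (fun I => nodes I (tightfix I) (prun I (tightfix I))).
  by rewrite /nodes /bigs /gshare /smass /served /rest; pt_unf; pt.
by rewrite /assign /owner; pt_unf; pt; exact: (PT_comp (PT_fst PT_id) pn).
Qed.

(** * Correctness of the auction *)

Definition owned (ow : seq nat) := [seq o.-1 | o <- ow & o != 0].

Lemma setn_cat s j v : j < size s -> setn s j v = take j s ++ v :: drop j.+1 s.
Proof.
move=> js; apply: (@eq_from_nth _ 0).
  by rewrite size_setn size_cat /= size_take size_drop js; lia.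
move=> i; rewrite size_setn => is_; rewrite nth_setn // nth_cat size_take js.
case: (ltngtP i j) => [lt|gt|->]; first by rewrite nth_take.
  by rewrite -(subnSK gt) /= nth_drop; congr nth; lia.
by rewrite subnn.
Qed.

Lemma count_owned_setn a ow j l : j < size ow ->
  count a (owned (setn ow j l.+1)) + ((nth 0 ow j != 0) && a (nth 0 ow j).-1) =
  a l + count a (owned ow).
Proof.
move=> js; rewrite setn_cat // /owned.
rewrite -[in RHS](cat_take_drop j ow) (drop_nth 0 js) !filter_cat !map_cat !count_cat /=.
by case: (nth 0 ow j) => [|o] /=; lia.
Qed.

Lemma count_owned a ow :
  count a (owned ow) = count (fun j => (nth 0 ow j != 0) && a (nth 0 ow j).-1) (iota 0 (size ow)).
Proof.
rewrite /owned count_map count_filter -{1}(mkseq_nth 0 ow) /mkseq count_map.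
by apply: eq_count => j /=; rewrite andbC.
Qed.

Lemma amin_min (T : eqType) (f : T -> nat) d s x : x \in s -> f (amin f d s) <= f x.
Proof.
elim: s => //= y s IH; rewrite inE; case: ifP => h /orP[/eqP->|/IH] //.
  by move=> h'; apply: leq_trans h h'.
by move: h; case: ltnP => // /ltnW.
Qed.

Lemma amin_in (T : eqType) (f : T -> nat) d s : d \in s -> amin f d s \in s.
Proof.
have : forall s, amin f d s \in d :: s.
  elim=> [|y s' IH] /=; first by rewrite inE.
  case: ifP => _; first by rewrite !inE eqxx orbT.
  by move: IH; rewrite !inE => /orP[->|->] //; rewrite !orbT.
by move=> /(_ s); rewrite inE => /orP[/eqP->|].
Qed.

Section AuctionSpec.
Variables (us : seq nat) (adj : seq (seq nat)).
Let n := size adj.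
Let g := size us.
Hypothesis adj_lt : forall l j, j \in nth [::] adj l -> j < g.

(** The fourth clause is complementary slackness up to 1: an owner's good costs at most one more
    than its cheapest alternative. By the third, a good keeps an owner from its first sale on. *)
Definition ainv (st : astate) :=
  [/\ perm_eq (queue st ++ dropped st ++ owned (owner st)) (iota 0 n),
      size (owner st) = g /\ size (price st) = g,
      forall j, (nth 0 (owner st) j == 0) = (nth 0 (price st) j == 0),
      forall j l, nth 0 (owner st) j = l.+1 -> j \in nth [::] adj l /\
        forall j', j' \in nth [::] adj l -> nth 0 (price st) j <= (nth 0 (price st) j').+1 &
      (forall l j, l \in dropped st -> j \in nth [::] adj l -> n < nth 0 (price st) j) /\
      (forall j, nth 0 (price st) j <= n.+1)].

Lemma ainv_init : ainv (ainit us adj).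
Proof.
have n0 s : nth 0 (nseq s 0) =1 (fun=> 0) by move=> j; rewrite nth_nseq if_same.
split; rewrite /queue /dropped /owner /price /=.
- by rewrite (_ : owned _ = [::]) ?cats0 // /owned; elim: (size us).
- by rewrite !size_nseq.
- by move=> j; rewrite !n0.
- by move=> j l; rewrite n0.
- by split=> // j; rewrite n0.
Qed.

Lemma ainv_step st : ainv st -> ainv (astep adj st).
Proof.
case: st => [[q d] [ow pr]]; rewrite /ainv /astep /queue /dropped /owner /price /=.
move=> [hp [so sp] hz ho [hd hb]]; case: eqP => [//|q0].
case: q q0 hp => [|l q] // _ hp; rewrite /wanted /bidder /queue /=.
rewrite -/n; set a := nth [::] adj l; set j := best _ _.
case: ifP => hdrop /=.
  rewrite /dropped /owner /price /bidder /queue /=; split=> //.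
    apply/permP => P; rewrite -(permP hp P) /bidder /= !count_cat /= !count_cat; lia.
  split=> // l' j'; rewrite /bidder /= inE => /orP[/eqP->|]; last exact: hd.
  rewrite -/a => ja; case/orP: hdrop => [/eqP/size0nil a0|]; first by rewrite a0 in ja.
  move=> h; apply: leq_trans h _; exact: (amin_min (fun j => nth 0 pr j) _ ja).
move/negbT: hdrop; rewrite negb_or -leqNgt size_eq0 => /andP[a0 hj].
have ja : j \in a.
  rewrite /j /best (_ : wanted _ _ = a) //; apply: amin_in.
  by case: (a) a0 => // x s _; rewrite inE eqxx.
have jg : j < g by apply: adj_lt ja.
have jmin j' : j' \in a -> nth 0 pr j <= nth 0 pr j'.
  by move=> ja'; exact: (amin_min (fun j => nth 0 pr j) _ ja').
have jo : j < size ow by rewrite so.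
have jp : j < size pr by rewrite sp.
split; rewrite /aassign /bidder /queue /dropped /owner /price /= -?/j.
- apply/permP => P; rewrite -(permP hp P) !count_cat /=.
  have := count_owned_setn P l jo; rewrite /bidder /=.
  case E : (nth 0 ow j) => [|o] /=; rewrite ?E -?/j /= ?count_cat; lia.
- by rewrite !size_setn.
- by move=> i; rewrite !nth_setn //; case: (i =P j) => // _; rewrite hz.
- move=> i l'; rewrite !nth_setn //; case: eqP => [->|ne].
    move=> [<-]; split=> // j' ja'; rewrite nth_setn //.
    by case: eqP => // _; rewrite ltnS jmin.
  move=> /ho[h1 h2]; split=> // j' /h2 h; rewrite nth_setn //.
  by case: eqP h => [-> h|//]; apply: leqW.
- split.
    move=> l' i /hd h /h hi; rewrite nth_setn //; case: eqP hi => [->|//].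
    by move=> hi; apply: leqW.
  by move=> i; rewrite nth_setn //; case: eqP => // _; rewrite ltnS.
Qed.

Definition ameas (st : astate) := sumn (price st) + size (dropped st).

Lemma ameas_step st : ainv st -> queue st != [::] -> ameas (astep adj st) = (ameas st).+1.
Proof.
case: st => [[q d] [ow pr]]; rewrite /ainv /ameas /astep /queue /dropped /owner /price /=.
move=> [hp [so sp] hz ho [hd hb]] q0; rewrite size_eq0 (negbTE q0).
case: ifP => [_|/negbT]; first by rewrite /= addnS.
rewrite negb_or size_eq0 => /andP[a0 _].
rewrite /aassign /price /= -addSn; congr (_ + _); set j := best _ _.
have jp : j < size pr.
  rewrite sp; apply: (adj_lt (l := bidder (q, d, (ow, pr)))).
  rewrite /j /best; apply: amin_in; rewrite /wanted in a0 *.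
  by case: (nth _ _ _) a0 => // x s _; rewrite inE eqxx.
rewrite setn_cat // -[in RHS](cat_take_drop j pr) (drop_nth 0 jp) !sumn_cat /=; lia.
Qed.

Lemma ameas_le st : ainv st -> ameas st <= g * n.+1 + n.
Proof.
case: st => [[q d] [ow pr]]; rewrite /ainv /ameas /queue /dropped /owner /price /=.
move=> [hp [so sp] hz ho [hd hb]]; apply: leq_add.
  rewrite -sp; have : all (fun x => x <= n.+1) pr by apply/(all_nthP 0) => i _.
  by elim: (pr) => //= x s IH /andP[xn /IH]; rewrite mulSn; lia.
by have := perm_size hp; rewrite !size_cat size_iota => <-; rewrite addnCA leq_addr.
Qed.

Lemma auction_inv : ainv (auction us adj) /\ queue (auction us adj) = [::].
Proof.
have hi t : ainv (iter t (astep adj) (ainit us adj)).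
  by elim: t => [|t IH] /=; [exact: ainv_init | exact: ainv_step].
split; first exact: hi.
have ht t : queue (iter t (astep adj) (ainit us adj)) = [::] \/
    t <= ameas (iter t (astep adj) (ainit us adj)).
  elim: t => [|t IH]; first by right.
  rewrite iterS; case: (altP (queue (iter t (astep adj) (ainit us adj)) =P [::])) => h.
    by left; rewrite /astep h.
  right; rewrite ameas_step //; case: IH => // e; by rewrite e in h.
have szf : size (fuel us adj) = g * n.+1 + n.+1.
  rewrite /fuel size_cat size_nseq /=; congr (_ + _).
  by rewrite /g; elim: (us) => //= _ s IH; rewrite size_cat IH size_nseq mulSn.
have [//|h] := ht (size (fuel us adj)).
by have := leq_trans h (ameas_le (hi _)); rewrite szf; lia.
Qed.

Let st := auction us adj.

Definition nbh (Y : pred nat) j := has (fun l => Y l && (j \in nth [::] adj l)) (iota 0 n).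

Lemma auction_perm : perm_eq (dropped st ++ owned (owner st)) (iota 0 n).
Proof. by have [[hp _ _ _ _] q0] := auction_inv; rewrite q0 in hp. Qed.

Lemma size_owner : size (owner st) = g.
Proof. by have [[_ [so _] _ _ _] _] := auction_inv. Qed.

Lemma owned_lt l : l \in owned (owner st) -> l < n.
Proof.
have := perm_mem auction_perm l.
by rewrite mem_cat mem_iota add0n /= => <- ->; rewrite orbT.
Qed.

Lemma ownerP j l : nth 0 (owner st) j = l.+1 -> [/\ j < g, l < n & j \in nth [::] adj l].
Proof.
move=> E; have jg : j < g.
  by rewrite -size_owner ltnNge; apply/negP => h; rewrite nth_default in E.
split=> //; last by have [[_ _ _ ho _] _] := auction_inv; case: (ho _ _ E).
apply: owned_lt; apply/mapP; exists l.+1 => //; rewrite mem_filter /= -E mem_nth //.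
by rewrite size_owner.
Qed.

(** Those bidders of [Y] that were not dropped own distinct goods in the neighbourhood of [Y]. *)
Lemma auction_le (Y : pred nat) :
  count Y (iota 0 n) <= count (nbh Y) (iota 0 g) + size (dropped st).
Proof.
rewrite -(permP auction_perm) count_cat addnC leq_add ?count_size //.
rewrite count_owned size_owner; apply: sub_count => j /andP[].
case E: (nth _ _ _) => [|l] //= _ Yl; apply/hasP; exists l; last by case: (ownerP E) => _ _ ->; rewrite Yl.
by rewrite mem_iota; case: (ownerP E).
Qed.

(* Between the prices [0] and [n + 2] some level is empty; the bidders that were
   dropped or own a good above it form a set of maximal deficiency. *)
Lemma auction_ge :
  exists Y : pred nat, count Y (iota 0 n) = count (nbh Y) (iota 0 g) + size (dropped st).
Proof.
have [[hp [so sp] hz ho [hd hb]] q0] := auction_inv; rewrite -/st in hp so sp hz ho hd hb q0.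
have [lvl /andP[l1 ln] hl] : exists2 t, 0 < t <= n.+1 & t \notin price st.
  (* If all levels from 1 to n + 1 occurred, at least n + 1 goods would have a positive price, hence
     an owner, but there are only [n] bidders. *)
  have [h|/allPn[t]] := boolP (all (fun t => t \in price st) (iota 1 n.+1)); last first.
    by rewrite mem_iota => ht nt; exists t.
  have sub : {subset iota 1 n.+1 <= [seq p <- price st | p != 0]}.
    move=> t ti; rewrite mem_filter (allP h) // andbT.
    by move: ti; rewrite mem_iota => /andP[]; case: t.
  have := uniq_leq_size (iota_uniq _ _) sub; rewrite size_iota size_filter.
  have -> : count (fun p => p != 0) (price st) = size (owned (owner st)).
    rewrite /owned size_map size_filter -(mkseq_nth 0 (price st)) -(mkseq_nth 0 (owner st)).
    by rewrite /mkseq sp so !count_map; apply: eq_count => j /=; rewrite hz.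
  by have := perm_size auction_perm; rewrite size_cat size_iota => <-; rewrite ltnNge leq_addl.
have hl' j : nth 0 (price st) j >= lvl -> nth 0 (price st) j > lvl.
  rewrite leq_eqVlt => /orP[/eqP e|//].
  have jg : j < size (price st) by rewrite ltnNge; apply/negP => h; rewrite nth_default // in e; lia.
  by have := mem_nth 0 jg; rewrite -e (negbTE hl).
pose Y l := (l \in dropped st) || has (fun j => (nth 0 (owner st) j == l.+1) && (lvl < nth 0 (price st) j)) (iota 0 g).
have Yadj l j : Y l -> j \in nth [::] adj l -> lvl < nth 0 (price st) j.
  case/orP => [ld ja|/hasP[i _ /andP[/eqP e lt]] ja].
    by apply: hl'; have := hd _ _ ld ja; lia.
  by have [_ /(_ j ja) h] := ho _ _ e; apply: hl'; lia.
exists Y; rewrite -(permP auction_perm) count_cat addnC; congr (_ + _); last first.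
  by apply/eqP; rewrite -all_count; apply/allP => l ld; rewrite /Y ld.
rewrite count_owned so; apply: eq_in_count => j; rewrite mem_iota add0n => /andP[_ jg].
apply/idP/idP => [/andP[]|/hasP[l _ /andP[Yl ja]]].
  case E: (nth _ _ _) => [|l] //= _ Yl; apply/hasP; exists l; last by case: (ownerP E) => _ _ ->; rewrite Yl.
  by rewrite mem_iota; case: (ownerP E).
have hj := Yadj _ _ Yl ja.
have : nth 0 (owner st) j != 0 by rewrite hz; lia.
case E: (nth _ _ _) => [|l'] //= _; rewrite /Y; apply/orP; right.
by apply/hasP; exists j; rewrite ?mem_iota // E eqxx.
Qed.

End AuctionSpec.

(** * Deficiency and critical persons *)

(** Copy [c] of good [j] is coded as [j * K + c]; this turns a count of copies into a sum over
    goods. *)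
Lemma count_iota_divmod (f : nat -> nat -> bool) s K :
  count (fun l => f (l %/ K) (l %% K)) (iota 0 (s * K)) =
  sumn [seq count (f j) (iota 0 K) | j <- iota 0 s].
Proof.
elim: s => [|s IH]; first by rewrite mul0n.
rewrite mulSn addnC iotaD add0n count_cat IH -addn1 iotaD map_cat sumn_cat /= addn0 add0n.
congr (_ + _); rewrite -[s * K]addn0 iotaDl count_map; apply: eq_in_count => c.
rewrite mem_iota add0n => /andP[_ cK] /=.
by rewrite divnMDl ?(leq_ltn_trans _ cK) // modnMDl divn_small // modn_small // addn0.
Qed.

Lemma count_iota_ltn K d : count (fun c => c + d < K) (iota 0 K) = K - d.
Proof.
have [le|lt] := leqP d K; last first.
  rewrite (_ : K - d = 0); last by lia.
  by apply/eqP; rewrite -leqn0 leqNgt -has_count; apply/hasPn => c _; lia.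
rewrite -{2}(subnK le) iotaD count_cat add0n.
rewrite (_ : count _ (iota (K - d) d) = 0); last first.
  by apply/eqP; rewrite -leqn0 leqNgt -has_count; apply/hasPn => c; rewrite mem_iota; lia.
rewrite addn0 -[RHS](size_iota 0); apply/eqP; rewrite -all_count.
by apply/allP => c; rewrite mem_iota; lia.
Qed.

Lemma nth_flatten_nseq (T U : Type) (x0 : T) (y0 : U) (F : T -> U) s K l :
  l < size s * K -> nth y0 (flatten [seq nseq K (F x) | x <- s]) l = F (nth x0 s (l %/ K)).
Proof.
elim: s l => [|x s IH] l /=; first by rewrite mul0n.
rewrite mulSn nth_cat size_nseq nth_nseq => lt; case: ltnP => lK.
  by rewrite divn_small.
have K0 : 0 < K by case: (K) lt lK => // ; rewrite muln0.
rewrite IH; last by lia.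
have -> // : l %/ K = ((l - K) %/ K).+1.
by rewrite -{1}(subnK lK) divnDr ?dvdnn // divnn K0 addn1.
Qed.

Lemma size_flatten_nseq (T U : Type) (F : T -> U) s K :
  size (flatten [seq nseq K (F x) | x <- s]) = size s * K.
Proof. by elim: s => //= x s IH; rewrite size_cat size_nseq IH mulSn. Qed.

Lemma sub_in_count (T : eqType) (a b : pred T) s :
  {in s, forall x, a x -> b x} -> count a s <= count b s.
Proof.
elim: s => //= x s IH h; rewrite leq_add ?IH //.
  by have := h x; rewrite inE eqxx => /(_ isT); case: (a x) => // ->.
by move=> y ys; apply: h; rewrite inE ys orbT.
Qed.

Section Deficiency.
Variables (I : inst) (tw : seq nat) (fl : nat).
Let K := size tw.
Hypothesis K0 : 0 < K.

Definition cap j := size tw - fl * nn I j.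
Definition kap S := sumn [seq cap j | j <- goods I & ncov I S j].

Lemma mem_copies r i : (r \in copies I tw fl i) =
  (r %/ K \in adj I i) && (r %% K + fl * nn I (r %/ K) < K).
Proof.
apply/flatten_mapP/andP => [[j ji /mapP[c]]|[ri rK]].
  rewrite mem_filter mem_iota add0n => /andP[h /andP[_ cK]] ->.
  by rewrite divnMDl // divn_small // addn0 modnMDl modn_small.
exists (r %/ K) => //; apply/mapP; exists (r %% K); last by rewrite -divn_eq.
by rewrite mem_filter rK mem_iota add0n ltn_mod.
Qed.

Lemma mem_adj i j : j \in adj I i -> j < size (nth [::] (mat I) 0).
Proof. by rewrite mem_filter mem_iota => /andP[_ /andP[_]]. Qed.

Let pl S l := nth 0 S (l %/ K).

Lemma nth_cadj S l : l < size S * K -> nth [::] (cadj I tw fl S) l = copies I tw fl (pl S l).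
Proof. exact: nth_flatten_nseq. Qed.

Lemma size_cadj S : size (cadj I tw fl S) = size S * K.
Proof. exact: size_flatten_nseq. Qed.

Lemma size_cgoods : size (cgoods I tw) = size (nth [::] (mat I) 0) * K.
Proof.
rewrite size_iota /goods; set k := size (nth _ _ _); rewrite -[in RHS](size_iota 0 k).
by elim: (iota 0 k) => //= _ s IH; rewrite size_cat IH mulSn.
Qed.

Lemma cadj_lt S l j : j \in nth [::] (cadj I tw fl S) l -> j < size (cgoods I tw).
Proof.
have [lt|ge] := ltnP l (size S * K); last by rewrite nth_default ?size_cadj.
rewrite nth_cadj // mem_copies => /andP[/mem_adj h _].
by rewrite size_cgoods -ltn_divLR.
Qed.

Lemma count_pl Z S : count (fun l => Z (pl S l)) (iota 0 (size (cadj I tw fl S))) = K * count Z S.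
Proof.
rewrite size_cadj (count_iota_divmod (fun t _ => Z (nth 0 S t))).
rewrite -[in RHS](mkseq_nth 0 S) count_map.
elim: (iota 0 (size S)) => [|t s IH] /=; first by rewrite muln0.
by rewrite IH mulnDr; case: (Z _) => /=; rewrite ?count_predT ?count_pred0 ?size_iota ?muln1 ?muln0.
Qed.

Lemma count_nbh (Y : pred nat) Z S :
  (forall r, nbh (cadj I tw fl S) Y r =
     has (fun i => Z i && (r \in copies I tw fl i)) S) ->
  count (nbh (cadj I tw fl S) Y) (iota 0 (size (cgoods I tw))) = kap (filter Z S).
Proof.
move=> nE; rewrite size_cgoods.
rewrite (eq_count (a2 := fun r => ncov I (filter Z S) (r %/ K) &&
    (r %% K + fl * nn I (r %/ K) < K))); last first.
  move=> r; rewrite nE /ncov; apply/hasP/andP.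
    move=> [i iS /andP[Zi]]; rewrite mem_copies => /andP[ri ->]; split=> //.
    by apply/hasP; exists i; rewrite // mem_filter Zi.
  move=> [/hasP[i]]; rewrite mem_filter => /andP[Zi iS] ri h; exists i => //.
  by rewrite Zi mem_copies ri h.
rewrite (count_iota_divmod (fun j c => ncov I (filter Z S) j && (c + fl * nn I j < K))).
rewrite /kap /goods; elim: (iota 0 (size (nth _ _ _))) => //= j s ->.
by case: (ncov _ _ _) => /=; rewrite ?count_pred0 // count_iota_ltn.
Qed.

Lemma defi_le Z S : K * count Z S <= kap (filter Z S) + defi I tw fl S.
Proof.
rewrite -count_pl; apply: leq_trans (auction_le (@cadj_lt S) _) _.
rewrite leq_add2r (count_nbh (Z := Z)) // => r; apply/hasP/hasP => [[l]|[i]].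
  rewrite mem_iota add0n size_cadj => /andP[_ lt] /andP[Zl]; rewrite nth_cadj // => h.
  by exists (pl S l); rewrite ?Zl // mem_nth // ltn_divLR.
move=> /(nthP 0)[t tS <-] /andP[Zi h]; exists (t * K).
  by rewrite mem_iota add0n size_cadj ltn_mul2r K0.
by rewrite nth_cadj ?ltn_mul2r ?K0 // /pl mulnK // Zi.
Qed.

(** The extremal set of the auction may contain only some of the copies of a person. All copies bid
    for the same list, so adding the missing ones raises the count and keeps the neighbourhood. *)
Lemma defi_ge S : exists Z, kap (filter Z S) + defi I tw fl S <= K * count Z S.
Proof.
have [Y hY] := auction_ge (@cadj_lt S).
pose Z i := has (fun l => Y l && (pl S l == i)) (iota 0 (size (cadj I tw fl S))).
exists Z; rewrite -count_pl -(count_nbh (Y := Y)).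
  rewrite -hY; apply: sub_in_count => l ln Yl; apply/hasP; exists l => //.
  by rewrite Yl /=.
move=> r; apply/hasP/hasP => [[l ln /andP[Yl h]]|[i iS /andP[/hasP[l ln /andP[Yl /eqP <-]] h]]].
  move: (ln); rewrite mem_iota add0n size_cadj => /andP[_ lt]; rewrite nth_cadj // in h.
  exists (pl S l); first by rewrite mem_nth // ltn_divLR.
  by rewrite h andbT; apply/hasP; exists l; rewrite ?Yl /=.
exists l; rewrite // Yl nth_cadj //.
by move: ln; rewrite mem_iota add0n size_cadj.
Qed.

(** Weighted coverage is submodular, as is seen good by good. *)
Lemma kap_submod (A B : pred nat) S :
  kap [seq i <- S | A i && B i] + kap [seq i <- S | A i || B i] <=
  kap (filter A S) + kap (filter B S).
Proof.
rewrite /kap; elim: (goods I) => //= j s IH.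
have E P : ncov I (filter P S) j = has (fun i => P i && (j \in adj I i)) S.
  rewrite /ncov; elim: (S) => //= i t IH'; case: (P i) => //=; by rewrite IH'.
rewrite !E.
have h1 : has (fun i => A i && B i && (j \in adj I i)) S ->
   has (fun i => A i && (j \in adj I i)) S && has (fun i => B i && (j \in adj I i)) S.
  by move=> /hasP[i iS /andP[/andP[Ai Bi] ji]]; apply/andP; split; apply/hasP; exists i; rewrite ?Ai ?Bi.
have h2 : has (fun i => (A i || B i) && (j \in adj I i)) S =
   has (fun i => A i && (j \in adj I i)) S || has (fun i => B i && (j \in adj I i)) S.
  by rewrite -has_predU; apply: eq_has => i /=; rewrite andb_orl.
rewrite h2; move: h1; case: (has _ S) => [/(_ isT)/andP[-> ->]|_] /=; first by lia.
by case: (has _ S); case: (has _ S) => /=; lia.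
Qed.

Lemma kap_sub S S' : {subset S <= S'} -> kap S <= kap S'.
Proof.
move=> sub; rewrite /kap; elim: (goods I) => //= j s IH.
have : ncov I S j -> ncov I S' j by move=> /hasP[i /sub iS' ji]; apply/hasP; exists i.
by case: (ncov I S j) => [->|_] //=; [rewrite leq_add2l | case: ifP => _ //=; lia].
Qed.

(* The critical persons form the least set of maximal deficiency. *)
Lemma crit_least S (Z : pred nat) : kap (filter Z S) + defi I tw fl S <= K * count Z S ->
  {subset crit I tw fl S <= Z}.
Proof.
move=> hZ i; rewrite mem_filter => /andP[lt iS]; apply/negPn/negP => nZ.
have {}nZ : Z i = false by apply: negbTE nZ.
have := defi_le Z (del i S).
have E : (filter Z (del i S)) = (filter Z S).
  rewrite /del -filter_predI; apply: eq_filter => i' /=.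
  by case: eqP => [->|_]; rewrite ?andbT //= nZ.
by rewrite -size_filter E size_filter; lia.
Qed.

(** By submodularity the sets of maximal deficiency are closed under intersection. If such a set [Z]
    contains a person [i] that is not critical, a maximiser for [S] without [i] is also one for [S],
    and intersecting [Z] with it removes [i]. When only critical persons are left, all of them are,
    by [crit_least]. *)
Lemma crit_max S : K * size (crit I tw fl S) = kap (crit I tw fl S) + defi I tw fl S.
Proof.
pose P i := defi I tw fl (del i S) < defi I tw fl S.
pose mx (Z : pred nat) := kap (filter Z S) + defi I tw fl S <= K * count Z S.
suff : mx P.
  rewrite /mx -size_filter -/(crit I tw fl S) => h; apply/eqP; rewrite eqn_leq h andbT.
  by have := defi_le P S; rewrite -size_filter -/(crit I tw fl S).
have ext (Z Z' : pred nat) : {in S, Z =1 Z'} -> mx Z -> mx Z'.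
  by move=> e; rewrite /mx (eq_in_filter e) (eq_in_count e).
have [Z] := defi_ge S; rewrite -/(mx Z).
have [n] := ubnP (count Z S); elim: n Z => // n IH Z lt mZ.
have [/allP h|/allPn[i iS]] := boolP (all (fun i => Z i ==> P i) S).
  apply: (ext Z P _ mZ) => i iS; apply/idP/idP => [Zi|Pi]; first by have := h i iS; rewrite Zi.
  by apply: (crit_least mZ); rewrite mem_filter iS andbT.
rewrite negb_imply => /andP[Zi nP].
have [Z' hZ'] := defi_ge (del i S).
pose Y j := ~~ (j == i) && Z' j.
have mY : mx Y.
  have E : (filter Y S) = (filter Z' (del i S)).
    by rewrite /del -filter_predI; apply: eq_filter => j; rewrite /= andbC.
  by rewrite /mx -size_filter E size_filter; move: nP; rewrite /P -leqNgt; lia.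
apply: (IH (fun j => Z j && Y j)).
  rewrite ltnS in lt; apply: leq_trans lt; rewrite -size_filter.
  have -> : [seq j <- S | Z j && Y j] = [seq j <- (filter Z S) | Y j].
    by rewrite -filter_predI; apply: eq_filter => j; rewrite /= andbC.
  have := count_predC Y (filter Z S); rewrite !size_filter => <-.
  have : 0 < count (predC Y) (filter Z S).
    by rewrite -has_count; apply/hasP; exists i; rewrite /= /Y ?eqxx // mem_filter Zi.
  by move=> h; rewrite -[X in X < _]addn0 ltn_add2l.
have := kap_submod Z Y S; have := defi_le (fun j => Z j || Y j) S.
have := count_predUI Z Y S; rewrite (@eq_count _ (predU Z Y) (fun j => Z j || Y j)) //.
rewrite (@eq_count _ (predI Z Y) (fun j => Z j && Y j)) // => hc.
have : K * count (fun j => Z j || Y j) S + K * count (fun j => Z j && Y j) S =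
  K * count Z S + K * count Y S by rewrite -!mulnDr hc.
by move: mZ mY; rewrite /mx; lia.
Qed.

(** The union of both critical sets [U] and [U'] cannot exceed the deficiency of [S']. By
    submodularity their intersection then attains the deficiency of [S], and since [U] is the least
    such set, it lies inside [U']. *)
Lemma crit_mono S S' : uniq S -> uniq S' -> {subset S <= S'} ->
  {subset crit I tw fl S <= crit I tw fl S'}.
Proof.
move=> uS uS' sub i ic.
have iS : i \in S by move: ic; rewrite mem_filter => /andP[].
set U := crit I tw fl S; set U' := crit I tw fl S'.
pose A j := j \in U; pose B j := j \in U'.
have AU : kap (filter A S') = kap U.
  have e : perm_eq (filter A S') U.
    apply: uniq_perm; [exact: filter_uniq | exact: filter_uniq|] => j.
    rewrite mem_filter /A; case: (boolP (j \in U)) => //= jU.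
    by apply: sub; move: jU; rewrite mem_filter => /andP[].
  by apply/eqP; rewrite eqn_leq !kap_sub // => j; rewrite (perm_mem e).
have cA : count A S' = size U.
  rewrite -size_filter; apply: perm_size.
  apply: uniq_perm; [exact: filter_uniq | exact: filter_uniq|] => j.
  rewrite mem_filter /A; case: (boolP (j \in U)) => //= jU.
  by apply: sub; move: jU; rewrite mem_filter => /andP[].
have fB : (filter B S') = U'.
  rewrite /U' /crit; apply: eq_in_filter => j jS'.
  by rewrite /B /U' mem_filter jS' andbT.
have cB : count B S' = size U' by rewrite -size_filter fB.
have h1 := crit_max S; have h2 := crit_max S'; rewrite -/U -/U' in h1 h2.
pose C : pred nat := fun j => A j && B j; pose D : pred nat := fun j => A j || B j.
have h3 : K * count D S' <= kap (filter D S') + defi I tw fl S' := defi_le D S'.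
have h4 : kap (filter C S') + kap (filter D S') <= kap U + kap U'.
  by rewrite -AU -fB; exact: kap_submod.
have h5 : count D S' + count C S' = size U + size U'.
  by rewrite -cA -cB; exact: (count_predUI A B S').
have h6 : K * count D S' + K * count C S' = K * size U + K * size U'.
  by rewrite -!mulnDr h5.
have e : perm_eq (filter C S') (filter C S).
  apply: uniq_perm; [exact: filter_uniq | exact: filter_uniq|] => j.
  rewrite !mem_filter; case: (boolP (C j)) => //= /andP[jU _].
  have jS : j \in S by move: jU; rewrite /A mem_filter => /andP[].
  by rewrite jS (sub _ jS).
have h7 : count C S' = count C S by rewrite -!size_filter (perm_size e).
have h8 : kap (filter C S') = kap (filter C S).
  by apply/eqP; rewrite eqn_leq !kap_sub // => j; rewrite (perm_mem e).
have : kap (filter C S) + defi I tw fl S <= K * count C S.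
  by rewrite -h7 -h8; lia.
by move/crit_least => /(_ i ic) /andP[].
Qed.

Lemma crit_del S i : i \in crit I tw fl S -> defi I tw fl (del i S) < defi I tw fl S.
Proof. by rewrite mem_filter => /andP[]. Qed.

End Deficiency.

Import Order.TTheory GRing.Theory Num.Theory.
Local Open Scope ring_scope.

(** * The tight set and the mass of dead configurations *)

(** The numbers [c.+1] with square at most [k] are those from 1 to the integer square root, so
    counting them computes it. *)
Lemma rt_spec (I : inst) : (rt I * rt I <= size (mat I) < (rt I).+1 * (rt I).+1)%N.
Proof.
set k := size _.
have ex : exists s, (s * s <= k)%N by exists 0%N.
have bd s : (s * s <= k -> s <= k)%N by case: s => // s; apply: leq_trans; rewrite leq_pmulr.
case: (ex_maxnP ex bd) => s sk smax.
suff -> : rt I = s by rewrite sk ltnNge /=; apply/negP => /smax; rewrite ltnn.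
rewrite /rt /rtl /pers -/k size_filter -[RHS](size_iota 0).
have le : (s <= k)%N := bd _ sk.
rewrite -(subnKC le) iotaD count_cat add0n subnKC //.
rewrite (_ : count _ (iota s _) = 0)%N; last first.
  apply/eqP; rewrite -leqn0 leqNgt -has_count; apply/hasPn => c; rewrite mem_iota => /andP[sc _].
  by apply/negP => /smax; lia.
rewrite addn0 -[RHS](count_predT); apply: eq_in_count => c; rewrite mem_iota add0n => /andP[_ cs].
by apply: leq_trans sk; apply: leq_mul.
Qed.

Lemma size_two I : size (two I) = (2 * rt I)%N.
Proof. by rewrite size_cat addnn mul2n. Qed.

(** * Monotonicity and the fixpoint [tightfix] *)

Section Mono.
Variable I : inst.
Hypothesis rt0 : (0 < rt I)%N.
Implicit Types X S : seq nat.

Lemma ncov_sub X X' j : {subset X <= X'} -> ncov I X j -> ncov I X' j.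
Proof. by move=> sub /hasP[i /sub iX ji]; apply/hasP; exists i. Qed.

Lemma kill_sub X X' j : {subset X <= X'} -> kill I X j -> kill I X' j.
Proof. by move=> sub /orP[h|/(ncov_sub sub) h]; apply/orP; [left | right]. Qed.

Lemma sumn_filter_sub (T : eqType) (f : T -> nat) (P Q : pred T) s :
  {in s, forall x, P x -> Q x} ->
  (sumn [seq f x | x <- [seq x <- s | P x]] <= sumn [seq f x | x <- [seq x <- s | Q x]])%N.
Proof.
elim: s => //= x s IH h.
have {}IH : (sumn [seq f x | x <- s & P x] <= sumn [seq f x | x <- s & Q x])%N.
  by apply: IH => y ys; apply: h; rewrite inE ys orbT.
have := h x; rewrite inE eqxx => /(_ isT); case: (P x) => [-> //=|_].
  by rewrite leq_add2l.
by case: (Q x) => //=; apply: leq_trans IH (leq_addl _ _).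
Qed.

Lemma alive_sub X X' e : {subset X <= X'} -> alive I X' e -> alive I X e.
Proof.
rewrite /alive => sub /andP[-> /= h]; apply: leq_trans h _; rewrite !leq_mul2l; apply/orP; right; apply/orP; right.
by apply: sumn_filter_sub => j _; apply: contra; exact: kill_sub.
Qed.

Lemma needy_sub X X' : {subset X <= X'} -> {subset needy I X <= needy I X'}.
Proof.
move=> sub i; rewrite !mem_filter => /andP[h ->]; rewrite andbT.
apply: leq_ltn_trans h; rewrite leq_mul2l; apply/orP; right.
by apply: sumn_filter_sub => e _ /andP[/(alive_sub sub)-> ->].
Qed.

Lemma uniq_pers : uniq (pers I). Proof. exact: iota_uniq. Qed.
Lemma uniq_needy X : uniq (needy I X). Proof. exact: filter_uniq uniq_pers. Qed.

Lemma two_gt0 : (0 < size (two I))%N.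
Proof. by rewrite size_two; lia. Qed.

Lemma tight_sub X X' : {subset X <= X'} -> {subset tight I X <= tight I X'}.
Proof. by move=> sub; apply: crit_mono (needy_sub sub); rewrite ?two_gt0 ?uniq_needy. Qed.

Lemma tight_needy X : {subset tight I X <= needy I X}.
Proof. by move=> i; rewrite mem_filter => /andP[]. Qed.

Lemma tightfixP : tight I (tightfix I) = tightfix I.
Proof.
pose it n := iter n (tight I) [::].
have inc n : {subset it n <= it n.+1}.
  by elim: n => // n IH; exact: tight_sub IH.
(* Every iterate keeps the order of [pers I]; so along the increasing chain equal sizes give equal
   lists, not merely equal sets. *)
have filt n : exists P : pred nat, it n = [seq i <- pers I | P i].
  case: n => [|n]; first by exists pred0; rewrite filter_pred0.
  rewrite /it /= /tight /crit /needy -filter_predI; eexists; reflexivity.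
have eqs n : size (it n.+1) = size (it n) -> it n.+1 = it n.
  move=> sz; have [P eP] := filt n; have [P' eP'] := filt n.+1.
  have sub := inc n; have uP : uniq (it n) by rewrite eP filter_uniq // uniq_pers.
  have [|_ eqm] := uniq_min_size uP sub; first by rewrite sz.
  rewrite eP eP'; apply: eq_in_filter => i ip.
  by have := eqm i; rewrite eP eP' !mem_filter ip !andbT.
have szle n : (size (it n) <= size (mat I))%N.
  by have [P ->] := filt n; rewrite size_filter -[X in (_ <= X)%N](size_iota 0) count_size.
have step n : it n.+1 = it n \/ (n < size (it n.+1))%N.
  elim: n => [|n [IH|IH]].
  - case: (posnP (size (it 1%N))) => [z|]; last by right.
    by left; apply: eqs; rewrite z.
  - by left; rewrite {1}/it iterS -/(it n.+1) IH.
  - have [e|ne] := eqVneq (size (it n.+2)) (size (it n.+1)); first by left; apply: eqs.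
    right; apply: (leq_ltn_trans IH); rewrite ltn_neqAle eq_sym ne /=.
    have un : uniq (it n.+1) by have [P ->] := filt n.+1; rewrite filter_uniq // uniq_pers.
    exact: (uniq_leq_size un (inc n.+1)).
have [//|] := step (size (mat I)).+1.
by move/leq_trans => /(_ _ (szle _)); lia.
Qed.

End Mono.

Lemma natr_sumn (T : Type) (f : T -> nat) (P : pred T) s :
  (sumn [seq f x | x <- [seq x <- s | P x]])%:R = \sum_(x <- s | P x) (f x)%:R :> rat.
Proof. by rewrite sumnE big_map big_filter natr_sum. Qed.

Lemma natr_count (T : Type) (P : pred T) s :
  (count P s)%:R = \sum_(x <- s | P x) 1 :> rat.
Proof. by rewrite -sum1_count natr_sum. Qed.

Lemma natr_size (T : Type) (s : seq T) : (size s)%:R = \sum_(x <- s) 1 :> rat.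
Proof. by rewrite -(count_predT s) natr_count. Qed.

(** * LP mass of singletons, of killed goods and of dead configurations *)

Section Instance.
Variable I : inst.
Let k := size (mat I).
Let m := size (nth [::] (mat I) 0).
Let E := rt I.
Variable C0 : nat.

Definition wt (e : entry) : rat := e.2.2%:R / (den I)%:R.
Definition tgt : rat := (tnum I)%:R / (tden I)%:R.

(** The interface between the LP and the analysis, entirely over the rationals: the real number
    [lambda] is replaced by its lower bound [C0 * E], which weakens smallness to [wf_small]. The
    threshold on [E] is spent in [big_power], that on [C0] in [tgt_t0]. *)
Record wf : Prop := Wf {
  wf_C0 : (256 * 6 <= C0)%N;
  wf_rt : (2 ^ 16 <= E)%N;
  wf_den : (0 < den I)%N;
  wf_tnum : (0 < tnum I)%N;
  wf_tden : (0 < tden I)%N;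
  wf_pers : forall e, e \in ents I -> (e.1 < k)%N;
  wf_uniq : forall e, e \in ents I -> uniq e.2.1;
  wf_goods : forall e j, e \in ents I -> j \in e.2.1 -> (j < m)%N;
  wf_one : forall i, (i < k)%N -> \sum_(e <- ents I | e.1 == i) wt e = 1;
  wf_cap : forall j, (j < m)%N -> \sum_(e <- ents I | j \in e.2.1) wt e <= 1;
  wf_big : forall e, e \in ents I -> ~~ sgl e ->
    tgt <= \sum_(j <- e.2.1) (ut I e.1 j)%:R;
  wf_small : forall e j, e \in ents I -> ~~ sgl e -> j \in e.2.1 ->
    (C0 * E)%:R * (ut I e.1 j)%:R <= tgt
}.

Hypothesis W : wf.

Definition bmass j := \sum_(e <- ents I | sgl e && (j \in e.2.1)) wt e.
Definition small_mass j := \sum_(e <- ents I | ~~ sgl e && (j \in e.2.1)) wt e.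
Definition pmass i := \sum_(e <- ents I | ~~ sgl e && (e.1 == i)) wt e.
Definition live_mass X i := \sum_(e <- ents I | alive I X e && (e.1 == i)) wt e.
Definition dead_mass X := \sum_(e <- ents I | ~~ sgl e && ~~ alive I X e) wt e.

Lemma wt_ge0 e : 0 <= wt e. Proof. by rewrite divr_ge0. Qed.
Hint Resolve wt_ge0 : core.

Lemma rt_ge512 : (512 <= rt I)%N.
Proof.
have h : (512 <= 2 ^ 16)%N by rewrite (_ : 512 = 2 ^ 9)%N ?leq_exp2l.
exact: leq_trans h (wf_rt W).
Qed.

Lemma rt_gt0 : (0 < rt I)%N. Proof. exact: leq_trans rt_ge512. Qed.

Lemma ratE_gt0 : (0 : rat) < E%:R. Proof. by rewrite ltr0n rt_gt0. Qed.

Lemma tgt_gt0 : 0 < tgt.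
Proof. by rewrite divr_gt0 // ltr0n ?(wf_tnum W) ?(wf_tden W). Qed.

Lemma big_small_le1 j : (j < m)%N -> bmass j + small_mass j <= 1.
Proof.
move=> jm; apply: le_trans (wf_cap W jm).
by rewrite [leRHS](bigID (@sgl)) /bmass /small_mass /=; under eq_bigl do rewrite andbC;
   rewrite lerD2l; under eq_bigl do rewrite andbC.
Qed.

Lemma bmass_ge0 j : 0 <= bmass j. Proof. exact: sumr_ge0. Qed.
Lemma small_mass_ge0 j : 0 <= small_mass j. Proof. exact: sumr_ge0. Qed.

Lemma bmass_le1 j : (j < m)%N -> bmass j <= 1.
Proof. by move=> /big_small_le1; have := small_mass_ge0 j; lra. Qed.

Lemma bloadE j : (bload I j)%:R / (den I)%:R = bmass j.
Proof. by rewrite natr_sumn mulr_suml. Qed.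

Lemma nn_bounds j : (j < m)%N ->
  (nn I j)%:R <= E%:R * (1 - bmass j) /\ E%:R * (1 - bmass j) < (nn I j)%:R + 1.
Proof.
move=> jm; have d0 : (0 : rat) < (den I)%:R by rewrite ltr0n (wf_den W).
have bl : (bload I j <= den I)%N.
  by rewrite -(ler_nat rat) -[leRHS]mul1r -ler_pdivrMr // bloadE bmass_le1.
have e : E%:R * (1 - bmass j) = (E * (den I - bload I j))%:R / (den I)%:R.
  by rewrite natrM natrB // -bloadE; field; rewrite lt0r_neq0.
rewrite e ler_pdivlMr // ltr_pdivrMr // natr1 -!natrM ler_nat ltr_nat /nn -/E.
by rewrite leq_trunc_div ltn_ceil // (wf_den W).
Qed.

Lemma pmass_one i : (i < k)%N ->
  \sum_(e <- ents I | sgl e && (e.1 == i)) wt e = 1 - pmass i.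
Proof.
move=> ik; rewrite -(wf_one W ik) [X in _ = X - _](bigID (@sgl)) /pmass /=.
rewrite [X in _ = X + _ - _](eq_bigl (fun e => sgl e && (e.1 == i))); last by move=> e; rewrite andbC.
rewrite [X in _ = _ + X - _](eq_bigl (fun e => ~~ sgl e && (e.1 == i))) ?addrK // => e.
by rewrite andbC.
Qed.

Lemma exchange_ents (T : eqType) (s : seq T) (A : pred T) (P : pred entry)
    (Q : entry -> pred T) (F : entry -> T -> rat) :
  \sum_(i <- s | A i) \sum_(e <- ents I | P e && Q e i) F e i =
  \sum_(e <- ents I | P e) \sum_(i <- s | A i && Q e i) F e i.
Proof.
rewrite (exchange_big_dep P) /=; last by move=> i e _ /andP[].
by apply: eq_bigr => e Pe; apply: eq_bigl => i; rewrite Pe.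
Qed.

Lemma pers_lt i : (i \in pers I) = (i < k)%N.
Proof. by rewrite mem_iota add0n. Qed.

Lemma goods_lt j : (j \in goods I) = (j < m)%N.
Proof. by rewrite mem_iota add0n. Qed.

Lemma sgl_good e : e \in ents I -> sgl e -> exists2 j, e.2.1 = [:: j] & j \in adj I e.1.
Proof.
move=> eI s1; move: (s1); rewrite {1}/sgl; case E2 : (e.2.1) => [|j [|? ?]] // _.
exists j => //; rewrite mem_filter goods_lt (wf_goods W eI) ?E2 ?inE // andbT.
by apply/hasP; exists e; rewrite // s1 eqxx E2 inE eqxx.
Qed.

(** Each singleton configuration of a person in [S] sits on a good counted by [ncov I S], where it
    contributes to [bmass]. *)
Lemma big_mass_ncov S : uniq S -> {subset S <= pers I} ->
  \sum_(i <- S) (1 - pmass i) <= \sum_(j <- goods I | ncov I S j) bmass j.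
Proof.
move=> uS sub.
rewrite (eq_big_seq (fun i => \sum_(e <- ents I | sgl e && (e.1 == i)) wt e)); last first.
  by move=> i /sub; rewrite pers_lt => ik; rewrite pmass_one.
rewrite /bmass (exchange_ents _ _ _ (fun e i => e.1 == i)) (exchange_ents _ _ _ (fun e j => j \in e.2.1)).
rewrite big_seq_cond [leRHS]big_seq_cond; apply: ler_sum => e /andP[eI s1].
have [j ej ja] := sgl_good eI s1.
have jg : j \in goods I by rewrite goods_lt (wf_goods W eI) // ej inE.
case: (boolP (e.1 \in S)) => eS; last first.
  rewrite big1_seq ?sumr_ge0 // => i /andP[/andP[_ /eqP <-]] iS.
  by rewrite iS in eS.
have c1 : ncov I S j by apply/hasP; exists e.1.
rewrite [leRHS](big_rem j) //= c1 ej inE eqxx /=.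
rewrite (big_rem e.1) //= eqxx big1_seq ?addr0.
  by rewrite ler_wpDr ?sumr_ge0.
by move=> i /andP[/eqP <-]; rewrite mem_rem_uniq // inE eqxx.
Qed.

Lemma size_ncov_pmass S : uniq S -> {subset S <= pers I} ->
  (size S)%:R <= (count (ncov I S) (goods I))%:R + \sum_(i <- S) pmass i.
Proof.
move=> uS sub; have := big_mass_ncov uS sub.
rewrite sumrB -natr_size.
have : \sum_(j <- goods I | ncov I S j) bmass j <= (count (ncov I S) (goods I))%:R.
  rewrite natr_count big_seq_cond [leRHS]big_seq_cond; apply: ler_sum => j /andP[jg _].
  by rewrite bmass_le1 // -goods_lt.
by lra.
Qed.

Let X := tightfix I.

Lemma Xneedy : {subset X <= needy I X}.
Proof. by move=> i; have := @tight_needy I X i; rewrite /X (tightfixP rt_gt0). Qed.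

Lemma Xpers : {subset X <= pers I}.
Proof. by move=> i /Xneedy; rewrite mem_filter => /andP[]. Qed.

Lemma uniq_X : uniq X.
Proof. by rewrite /X -(tightfixP rt_gt0) filter_uniq // uniq_needy. Qed.

Lemma kap_two S : (kap I (two I) 1 S)%:R =
  \sum_(j <- goods I | ncov I S j) (2 * E%:R - (nn I j)%:R : rat).
Proof.
rewrite natr_sumn big_seq_cond [RHS]big_seq_cond; apply: eq_bigr => j /andP[jg _].
rewrite goods_lt in jg; have [h _] := nn_bounds jg.
have hb := bmass_ge0 j; have e0 := ratE_gt0.
have h2 : (nn I j <= 2 * E)%N.
  rewrite -(ler_nat rat) natrM; apply: le_trans h _.
  have : E%:R * (1 - bmass j) <= E%:R * 1 by rewrite ler_pM2l //; lra.
  by move: e0; lra.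
by rewrite /cap size_two mul1n natrB // natrM.
Qed.

Definition slack S := \sum_(j <- goods I | ncov I S j) (1 - bmass j).

(** The deficiency of [X] is not negative, so its big goods satisfy 2 number - slack <= 2 |X|, using
    n_j <= E (1 - bmass j). The LP gives |X| - small mass <= number - slack. Doubling the second and
    inserting the first leaves slack <= 2 small mass. *)
Lemma slack_X : slack X <= 2 * \sum_(i <- X) pmass i.
Proof.
have e0 := ratE_gt0.
have h1 := big_mass_ncov uniq_X Xpers.
have h2 : (kap I (two I) 1 X)%:R <= (2 * E)%:R * (size X)%:R :> rat.
  have := crit_max I 1 (two_gt0 rt_gt0) (needy I X).
  rewrite -/(tight I X) (tightfixP rt_gt0) -/X size_two => e.
  by rewrite -natrM ler_nat e leq_addr.
rewrite kap_two sumrB in h2.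
have h3 : \sum_(j <- goods I | ncov I X j) (nn I j)%:R <= E%:R * slack X.
  rewrite /slack mulr_sumr big_seq_cond [leRHS]big_seq_cond; apply: ler_sum => j /andP[jg _].
  by rewrite goods_lt in jg; have [] := nn_bounds jg.
have e1 : \sum_(j <- goods I | ncov I X j) (2 * E%:R : rat) = 2 * E%:R * (count (ncov I X) (goods I))%:R :> rat.
  by rewrite natr_count mulr_sumr; apply: eq_bigr => j _; rewrite mulr1.
have e2 : slack X = (count (ncov I X) (goods I))%:R - \sum_(j <- goods I | ncov I X j) bmass j.
  by rewrite /slack sumrB natr_count.
have e3 : \sum_(i <- X) (1 - pmass i) = (size X)%:R - \sum_(i <- X) pmass i.
  by rewrite sumrB -natr_size.
rewrite e1 natrM in h2; rewrite e3 in h1; rewrite e2 in h3 *.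
set c := (count _ _)%:R in h1 h2 h3 *; set B := \sum_(j <- _ | _) bmass j in h1 h2 h3 *.
set P := \sum_(i <- X) pmass i in h1 h2 h3 *; set s := (size X)%:R in h1 h2 h3 *.
have : E%:R * (2 * c) <= E%:R * (2 * s + (c - B)) by lra.
by rewrite ler_pM2l // => h4; lra.
Qed.

Lemma sum_bmass : \sum_(j <- goods I) bmass j <= k%:R.
Proof.
rewrite /bmass (exchange_ents _ _ _ (fun e j => j \in e.2.1)).
apply: (@le_trans _ _ (\sum_(e <- ents I) wt e)).
  rewrite [leRHS](bigID (@sgl)) /= ler_wpDr ?sumr_ge0 //.
  rewrite big_seq_cond [leRHS]big_seq_cond; apply: ler_sum => e /andP[eI s1].
  have [j ej ja] := sgl_good eI s1; rewrite ej.
  under eq_bigl do rewrite inE /=.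
  rewrite -big_filter (_ : [seq i <- goods I | i == j] = [:: j]) ?big_seq1 //.
  by rewrite filter_pred1_uniq ?iota_uniq // goods_lt (wf_goods W eI) // ej inE.
have -> : \sum_(e <- ents I) wt e = \sum_(i <- pers I) \sum_(e <- ents I | true && (e.1 == i)) wt e.
  rewrite (exchange_ents _ _ xpredT (fun e i => e.1 == i)) big_seq [RHS]big_seq.
  apply: eq_bigr => e eI /=.
  under eq_bigl do rewrite eq_sym.
  rewrite -big_filter filter_pred1_uniq ?iota_uniq ?big_seq1 //.
  by rewrite pers_lt (wf_pers W).
rewrite -(size_iota 0 k) -/(pers I) natr_size big_seq [leRHS]big_seq.
by apply: ler_sum => i; rewrite pers_lt => ik; rewrite /= wf_one.
Qed.

Lemma k_over_E : k%:R <= E%:R * (E%:R + 2) :> rat.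
Proof.
have /andP[_] := rt_spec I; rewrite -/k -/E => h.
have : (k <= E * (E + 2))%N by lia.
by rewrite -(ler_nat rat) natrM natrD.
Qed.

(** A good covered by [X] has small mass at most its slack. If [nn] is 0, singletons leave less than
    1/E of the good; they use more than half of it, so its small mass is at most 2/E times [bmass],
    and all [bmass] together is at most [k]. *)
Lemma killed_mass : \sum_(j <- goods I | kill I X j) small_mass j <=
  2 * (E%:R + 2) + 2 * \sum_(i <- X) pmass i.
Proof.
have e0 := ratE_gt0.
have E2 : (2 : rat) <= E%:R by rewrite (ler_nat _ 2); exact: leq_trans rt_ge512.
apply: (@le_trans _ _ (\sum_(j <- goods I | nn I j == 0%N) (2 / E%:R * bmass j) + slack X)).
  have -> : slack X = \sum_(j <- goods I) if ncov I X j then 1 - bmass j else 0 by rewrite -big_mkcond.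
  rewrite [leLHS]big_mkcond [X in X + _]big_mkcond -big_split /= big_seq [leRHS]big_seq.
  apply: ler_sum => j; rewrite goods_lt => jm.
  have h1 := big_small_le1 jm; have [h2 h3] := nn_bounds jm.
  have b0 := bmass_ge0 j; have b1 := bmass_le1 jm.
  have q0 : 0 <= 2 / E%:R * bmass j by rewrite mulr_ge0 // divr_ge0 // ltW.
  have h4 : nn I j == 0%N -> small_mass j <= 2 / E%:R * bmass j.
    move=> /eqP n0; rewrite n0 add0r in h3.
    have h5 : 2 * (1 - bmass j) <= E%:R * (1 - bmass j) by rewrite ler_wpM2r //; lra.
    have : E%:R * small_mass j <= 2 * bmass j.
      apply: (@le_trans _ _ (E%:R * (1 - bmass j))); last by lra.
      by rewrite ler_pM2l //; lra.
    by move=> h6; rewrite -mulrAC ler_pdivlMr // mulrC.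
  rewrite /kill; case: eqP h4 => [_ /(_ isT) h4|_ _] /=.
    by case: ifP => _; lra.
  by case: ifP => _; lra.
rewrite lerD ?slack_X //.
have : \sum_(j <- goods I | nn I j == 0%N) 2 / E%:R * bmass j <= 2 / E%:R * k%:R.
  rewrite -mulr_sumr ler_wpM2l //; first by rewrite divr_ge0 // ltW.
  apply: le_trans sum_bmass; rewrite [leRHS](bigID (fun j => nn I j == 0%N)) /=.
  by rewrite lerDl; apply: sumr_ge0 => j _; exact: bmass_ge0.
move/le_trans; apply.
rewrite mulrAC ler_pdivrMr // -mulrA ler_pM2l // [leRHS]mulrC; exact: k_over_E.
Qed.

Lemma live_needy i : i \in needy I X -> live_mass X i <= 1 / E%:R.
Proof.
rewrite mem_filter => /andP[h _]; have e0 := ratE_gt0.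
have d0 : (0 : rat) < (den I)%:R by rewrite ltr0n (wf_den W).
rewrite ler_pdivlMr // /live_mass /wt -mulr_suml mulrAC ler_pdivrMr // mul1r.
by rewrite /amass -natr_sumn -natrM ler_nat mulnC ltnW.
Qed.

Lemma pmass_split Y i : pmass i = live_mass Y i +
  \sum_(e <- ents I | (~~ sgl e && ~~ alive I Y e) && (e.1 == i)) wt e.
Proof.
rewrite /pmass (bigID (alive I Y)) /=; congr (_ + _); apply: eq_bigl => e.
  by rewrite /alive; case: sgl => //=; rewrite andbC.
by rewrite andbAC.
Qed.

Lemma dead_sum S Y : uniq S -> \sum_(i <- S)
  \sum_(e <- ents I | (~~ sgl e && ~~ alive I Y e) && (e.1 == i)) wt e <= dead_mass Y.
Proof.
move=> uS; rewrite (exchange_ents _ _ _ (fun e i => e.1 == i)) /dead_mass.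
apply: ler_sum => e _.
under eq_bigl do rewrite eq_sym.
rewrite -big_filter; case: (boolP (e.1 \in S)) => eS.
  by rewrite filter_pred1_uniq // big_seq1.
by rewrite (_ : filter _ _ = [::]) ?big_nil // -(filter_pred0 S); apply: eq_in_filter => i iS /=;
   apply/eqP => h; rewrite -h iS in eS.
Qed.

(** Needy persons have live mass at most 1/E each, which sums to at most k/E; the rest of their
    small mass is dead. *)
Lemma pmass_X : \sum_(i <- X) pmass i <= E%:R + 2 + dead_mass X.
Proof.
have e0 := ratE_gt0.
rewrite (eq_bigr _ (fun i _ => pmass_split X i)) big_split /= lerD ?dead_sum ?uniq_X //.
apply: (@le_trans _ _ (\sum_(i <- X) 1 / E%:R)).
  by rewrite big_seq [leRHS]big_seq; apply: ler_sum => i /Xneedy; exact: live_needy.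
have -> : \sum_(i <- X) 1 / E%:R = (size X)%:R / E%:R :> rat.
  by rewrite -mulr_suml -natr_size.
rewrite ler_pdivrMr // mulrC; apply: le_trans k_over_E.
rewrite ler_nat -(size_iota 0 k); exact: uniq_leq_size uniq_X Xpers.
Qed.

(** A dead configuration has lost at least T/2, in pieces of at most T / (C0 E). *)
Lemma dead_killed e : e \in ents I -> ~~ sgl e -> ~~ alive I X e ->
  (C0 * E)%:R <= 2 * (count (kill I X) e.2.1)%:R :> rat.
Proof.
move=> eI ns; rewrite /alive ns /= -ltnNge => h.
have t0 := tgt_gt0; have td : (0 : rat) < (tden I)%:R by rewrite ltr0n (wf_tden W).
have h1 : 2 * (aval I X e)%:R < tgt.
  by rewrite /tgt ltr_pdivlMr // -!natrM ltr_nat -mulnA (mulnC (aval I X e)).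
have := wf_big W eI ns; rewrite (bigID (kill I X)) /= -[X in _ <= _ + X]natr_sumn -/(aval I X e) => h2.
have h3 : (C0 * E)%:R * \sum_(j <- e.2.1 | kill I X j) (ut I e.1 j)%:R <=
    tgt * (count (kill I X) e.2.1)%:R.
  rewrite natr_count !mulr_sumr big_seq_cond [leRHS]big_seq_cond; apply: ler_sum => j /andP[je _].
  by rewrite mulr1; exact: wf_small.
have h4 : tgt <= 2 * \sum_(j <- e.2.1 | kill I X j) (ut I e.1 j)%:R by lra.
have c0 : 0 <= (C0 * E)%:R :> rat by [].
have h5 := ler_wpM2l c0 h4.
rewrite -(ler_pM2l t0); set A := (C0 * E)%:R in h3 h5 *; lra.
Qed.

(** Double counting of pairs of a dead configuration and a killed good in it gives C0 E D <= 8 (E +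
    2) + 4 D for the dead mass D. The D on the right is absorbed by the left; the lower bound 100
    for [C0] is ample for this. *)
Lemma dead_small : dead_mass X <= 2^-1.
Proof.
have e0 := ratE_gt0.
have h1 : (C0 * E)%:R * dead_mass X <= 2 * \sum_(j <- goods I | kill I X j) small_mass j.
  rewrite /small_mass (exchange_ents _ _ _ (fun e j => j \in e.2.1)) /dead_mass !mulr_sumr.
  rewrite [leRHS](bigID (alive I X)) /=.
  apply: (@le_trans _ _ (\sum_(e <- ents I | ~~ sgl e && ~~ alive I X e) (2 * (\sum_(j <- goods I | kill I X j && (j \in e.2.1)) wt e)))); last first.
    rewrite lerDr; apply: sumr_ge0 => e _; rewrite mulr_ge0 // sumr_ge0 //.
  rewrite big_seq_cond [leRHS]big_seq_cond; apply: ler_sum => e /andP[eI /andP[ns na]].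
  have -> : \sum_(j <- goods I | kill I X j && (j \in e.2.1)) wt e = (count (kill I X) e.2.1)%:R * wt e.
    rewrite natr_count mulr_suml -big_filter -[RHS]big_filter; under [RHS]eq_bigr do rewrite mul1r.
    apply: perm_big; apply: uniq_perm; rewrite ?filter_uniq ?iota_uniq ?(wf_uniq W) // => j.
    rewrite !mem_filter; case: (boolP (j \in e.2.1)) => je; rewrite ?andbF // !andbT.
    by rewrite goods_lt (wf_goods W eI je) andbT.
  by rewrite mulrA ler_wpM2r // dead_killed.
have h2 := killed_mass; have h3 := pmass_X.
have h4 : (100 : rat) * E%:R <= (C0 * E)%:R.
  rewrite natrM ler_pM2r; last exact: e0.
  apply: (@le_trans _ _ 256%:R); first by rewrite ler_nat.
  by rewrite ler_nat; apply: (leq_trans _ (wf_C0 W)); exact: leq_pmulr.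
have E2 : (2 : rat) <= E%:R by rewrite (ler_nat _ 2); exact: leq_trans rt_ge512.
have d0 : 0 <= dead_mass X by exact: sumr_ge0.
have h5 : 100 * E%:R * dead_mass X <= (C0 * E)%:R * dead_mass X by rewrite ler_wpM2r.
set D := dead_mass X in h1 h3 d0 h5 *.
rewrite leNgt; apply/negP => hD.
have h6 : 100 * E%:R * 2^-1 < 100 * E%:R * D by rewrite ltr_pM2l; lra.
have h7 : 4 * D <= 4 * (E%:R * D) .
  by rewrite ler_pM2l; [apply: ler_peMl; lra | lra].
lra.
Qed.

End Instance.

(** * Choosing configurations for the critical persons *)

Lemma bernoulli_nat d n : (1 + n * d <= d.+1 ^ n)%N.
Proof.
elim: n => // n IH; rewrite expnS.
have : (d.+1 * (1 + n * d) <= d.+1 * d.+1 ^ n)%N by rewrite leq_mul2l IH orbT.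
by apply: leq_trans; rewrite !mulnDr !mulSn muln1; lia.
Qed.

(** With q = E / n >= 1 rounded down, E < n (q + 1) <= 2 n q, and Bernoulli's inequality bounds n q
    by (q + 1) ^ n. Thus [n] claims multiply the power of a good by at least E/2, whatever [n]
    is. *)
Lemma expn_div_ge E n : (0 < n <= E)%N -> (E <= 2 * (E %/ n).+1 ^ n)%N.
Proof.
move=> /andP[n0 nE]; have h := bernoulli_nat (E %/ n) n.
have h1 : (n <= n * (E %/ n))%N by rewrite leq_pmulr // divn_gt0.
have h2 := ltn_ceil E n0; rewrite mulSn mulnC in h2.
lia.
Qed.

(* Bounds the potential: [rise6 d.+1 / rise6 d] is the factor
   [1 + 6 / d.+1] by which a step with deficiency [d.+1] may raise it. *)
Definition rise6 (d : nat) : nat :=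
  (d.+1 * d.+2 * (d + 3) * (d + 4) * (d + 5) * (d + 6))%N.

Lemma rise6S d : (d.+1 * rise6 d.+1 = (d + 7) * rise6 d)%N.
Proof. rewrite /rise6; ring. Qed.

Lemma rise6_mono d d' : (d <= d')%N -> (rise6 d <= rise6 d')%N.
Proof. by move=> h; rewrite /rise6; do !apply: leq_mul => //; rewrite ?ltnS ?leq_add2r. Qed.

Lemma rise6_ge d : (6 <= rise6 d)%N.
Proof. by apply: leq_trans (rise6_mono (leq0n d)). Qed.

Lemma rise6_le k : (k * rise6 k <= (k + 6) ^ 7)%N.
Proof.
rewrite /rise6 !expnS expn0 muln1 mulnA.
have h a : (a <= 6)%N -> (k + a <= k + 6)%N by move=> ?; rewrite leq_add2l.
have h1 := h 1%N isT; have h2 := h 2%N isT; rewrite addn1 in h1; rewrite addn2 in h2.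
rewrite -!mulnA; do !apply: leq_mul => //; rewrite ?h ?leq_addr //.
Qed.

Lemma dvdn_prodn x s : x \in s -> (x %| prodn s)%N.
Proof.
elim: s => //= y s IH; rewrite inE => /orP[/eqP->|/IH h]; first exact: dvdn_mulr.
exact: dvdn_mull.
Qed.

Lemma prodn_gt0 s : all (leq 1) s -> (0 < prodn s)%N.
Proof. by elim: s => //= x s IH /andP[x0 /IH]; rewrite muln_gt0 x0. Qed.

(** * The potential and its growth *)

Section Phase2.
Variables (I : inst) (C0 : nat).
Hypothesis W : wf I C0.
Let k := size (mat I).
Let m := size (nth [::] (mat I) 0).
Let E := rt I.
Let X := tightfix I.
Implicit Types (e : entry) (j : nat) (st : pstate) (S : seq nat).

Lemma aval_gt0 e : alive I X e -> (0 < aval I X e)%N.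
Proof.
rewrite /alive => /andP[_]; case: (aval I X e) => // h.
by have := wf_tnum W; rewrite muln0 muln0 leqn0 in h; rewrite (eqP h).
Qed.

Definition vr e j : rat := (ut I e.1 j)%:R / (aval I X e)%:R.
Definition wr j : rat := \sum_(e <- ents I | alive I X e && (j \in e.2.1)) wt I e * vr e j.
Definition dd j := (E %/ nn I j)%N.
Definition costr (pw : seq nat) e : rat :=
  \sum_(j <- e.2.1 | ~~ kill I X j) (wr j * (dd j)%:R + vr e j) * (nth 0%N pw j)%:R.

Lemma vr_ge0 e j : 0 <= vr e j. Proof. by rewrite divr_ge0. Qed.
Lemma wr_ge0 j : 0 <= wr j.
Proof. by apply: sumr_ge0 => e _; rewrite mulr_ge0 ?wt_ge0 ?vr_ge0. Qed.

Lemma scale_gt0 : (0 < scale I X)%N.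
Proof.
apply: prodn_gt0; apply/allP => x /mapP[e]; rewrite mem_filter => /andP[ae _] ->.
exact: aval_gt0.
Qed.

Lemma vvE e j : e \in ents I -> alive I X e -> (vv I X e j)%:R = (scale I X)%:R * vr e j.
Proof.
move=> eI ae; have a0 : (aval I X e)%:R != 0 :> rat by rewrite pnatr_eq0 -lt0n aval_gt0.
have dv : (aval I X e %| scale I X)%N.
  by apply: dvdn_prodn; apply/mapP; exists e; rewrite // mem_filter ae.
rewrite /vv /vr natrM -[in RHS](divnK dv) natrM; field.
exact: a0.
Qed.

Lemma wwE j : (ww I X j)%:R = (den I)%:R * (scale I X)%:R * wr j.
Proof.
rewrite /ww natr_sumn /wr mulr_sumr big_seq_cond [RHS]big_seq_cond.
apply: eq_bigr => e /andP[eI /andP[ae _]].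
have d0 : (den I)%:R != 0 :> rat by rewrite pnatr_eq0 -lt0n (wf_den W).
rewrite natrM vvE // /wt; field; exact: d0.
Qed.

(** The factor is positive and does not depend on [e], so the minimum found among natural numbers is
    one for the rational costs. *)
Lemma costE pw e : e \in ents I -> alive I X e ->
  (cost I X pw e)%:R = (den I)%:R * (scale I X)%:R * costr pw e.
Proof.
move=> eI ae; rewrite /cost natr_sumn /costr mulr_sumr; apply: eq_bigr => j _.
by rewrite natrM natrD [(ww I X j * _)%:R]natrM [(den I * _)%:R]natrM wwE vvE //; ring.
Qed.

Lemma sum_vr e : alive I X e -> \sum_(j <- e.2.1 | ~~ kill I X j) vr e j = 1.
Proof.
move=> ae; rewrite /vr -mulr_suml -natr_sumn -/(aval I X e) divff //.
by rewrite pnatr_eq0 -lt0n aval_gt0.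
Qed.

Definition pot (pw : seq nat) : rat :=
  \sum_(j <- goods I | ~~ kill I X j) wr j * (nth 0%N pw j)%:R.

Lemma pot_ge0 pw : 0 <= pot pw.
Proof. by apply: sumr_ge0 => j _; rewrite mulr_ge0 ?wr_ge0. Qed.

Lemma sum_entry_goods e (P : pred nat) (F : nat -> rat) : e \in ents I ->
  \sum_(j <- goods I | P j && (j \in e.2.1)) F j = \sum_(j <- e.2.1 | P j) F j.
Proof.
move=> eI; rewrite -big_filter -[RHS]big_filter; apply: perm_big; apply: uniq_perm.
- exact: filter_uniq (iota_uniq _ _).
- exact: filter_uniq (wf_uniq W eI).
move=> j; rewrite !mem_filter; case: (boolP (j \in e.2.1)) => je; rewrite ?andbF // !andbT.
by rewrite goods_lt (wf_goods W eI je) andbT.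
Qed.

Lemma sum_wr : \sum_(j <- goods I | ~~ kill I X j) wr j <= k%:R.
Proof.
rewrite /wr (exchange_ents _ _ _ _ (fun e j => j \in e.2.1)).
apply: (@le_trans _ _ (\sum_(e <- ents I) wt I e)).
  rewrite [leRHS](bigID (alive I X)) /= ler_wpDr ?sumr_ge0 // => [e _|]; first exact: wt_ge0.
  rewrite big_seq_cond [leRHS]big_seq_cond; apply: ler_sum => e /andP[eI ae].
  by rewrite (sum_entry_goods _ _ eI) -mulr_sumr sum_vr // mulr1.
have -> : \sum_(e <- ents I) wt I e = \sum_(i <- pers I) \sum_(e <- ents I | true && (e.1 == i)) wt I e.
  rewrite (exchange_ents _ _ _ xpredT (fun e i => e.1 == i)) big_seq [RHS]big_seq.
  apply: eq_bigr => e eI /=.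
  under eq_bigl do rewrite eq_sym.
  rewrite -big_filter filter_pred1_uniq ?iota_uniq ?big_seq1 //.
  by rewrite pers_lt (wf_pers W).
rewrite -(size_iota 0 k) -/(pers I) natr_size big_seq [leRHS]big_seq.
by apply: ler_sum => i; rewrite pers_lt => ik; rewrite /= (wf_one W).
Qed.

Lemma nn_le j : (j < m)%N -> (nn I j <= E)%N.
Proof.
move=> jm; have [h _] := nn_bounds W jm; have b0 := bmass_ge0 I j.
rewrite -(ler_nat rat); apply: le_trans h _; have e0 := ratE_gt0 W.
by rewrite -[leRHS]mulr1 ler_pM2l //; lra.
Qed.

Definition claim_mass j : rat := \sum_(e <- ents I | alive I X e && (j \in e.2.1)) wt I e.

Lemma claim_mass_ge0 j : 0 <= claim_mass j.
Proof. by apply: sumr_ge0 => e _; exact: wt_ge0. Qed.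

(** Here it pays that goods with [nn] equal to 0 are killed: n_j >= 1 absorbs the rounding, as E (1
    - bmass j) < n_j + 1 <= 2 n_j. *)
Lemma claim_load j : (j < m)%N -> ~~ kill I X j -> E%:R * claim_mass j <= 2 * (nn I j)%:R.
Proof.
move=> jm; rewrite /kill negb_or => /andP[n0 _]; rewrite -lt0n in n0.
have [_ h] := nn_bounds W jm; have e0 := ratE_gt0 W.
have h1 := big_small_le1 W jm.
have h2 : claim_mass j <= small_mass I j.
  rewrite /small_mass [leRHS](bigID (alive I X)) /= ler_wpDr ?sumr_ge0 // => [e _|]; first exact: wt_ge0.
  rewrite le_eqVlt; apply/orP; left; apply/eqP; apply: eq_bigl => e.
  by rewrite /alive; case: sgl => //=; rewrite andbC.
have n1 : (1 : rat) <= (nn I j)%:R by rewrite ler1n.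
have : E%:R * claim_mass j <= E%:R * (1 - bmass I j) by rewrite ler_pM2l //; lra.
by lra.
Qed.

Lemma claim_rate j : (j < m)%N -> ~~ kill I X j -> claim_mass j * (dd j)%:R <= 2.
Proof.
move=> jm nk; have h3 := claim_load jm nk; have s0 := claim_mass_ge0 j.
have n0 : (0 : rat) < (nn I j)%:R.
  by move: nk; rewrite /kill negb_or ltr0n lt0n => /andP[].
have h4 : (dd j)%:R * (nn I j)%:R <= E%:R :> rat by rewrite -natrM ler_nat leq_trunc_div.
have h5 : claim_mass j * ((dd j)%:R * (nn I j)%:R) <= claim_mass j * E%:R by rewrite ler_wpM2l.
rewrite -(ler_pM2r n0); lra.
Qed.

(** After exchanging the sums, good [j] contributes its term of the potential times claim_mass * dd
    + 1. The product is at most 2 by [claim_rate], whence the 3. *)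
Lemma avg_cost pw : \sum_(e <- ents I | alive I X e) wt I e * costr pw e <= 3 * pot pw.
Proof.
have -> : \sum_(e <- ents I | alive I X e) wt I e * costr pw e =
   \sum_(j <- goods I | ~~ kill I X j)
     \sum_(e <- ents I | alive I X e && (j \in e.2.1))
        wt I e * ((wr j * (dd j)%:R + vr e j) * (nth 0%N pw j)%:R).
  rewrite (exchange_ents _ _ _ _ (fun e j => j \in e.2.1)) big_seq_cond [RHS]big_seq_cond.
  by apply: eq_bigr => e /andP[eI ae]; rewrite (sum_entry_goods _ _ eI) mulr_sumr.
rewrite /pot mulr_sumr big_seq_cond [leRHS]big_seq_cond; apply: ler_sum => j /andP[jg nk].
rewrite goods_lt in jg; have h := claim_rate jg nk.
set s := claim_mass j in h.
have -> : \sum_(e <- ents I | alive I X e && (j \in e.2.1))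
        wt I e * ((wr j * (dd j)%:R + vr e j) * (nth 0%N pw j)%:R) =
   (s * (dd j)%:R * wr j + wr j) * (nth 0%N pw j)%:R.
  set w := wr j; set p := (nth 0%N pw j)%:R : rat.
  rewrite (eq_bigr (fun e => wt I e * (w * (dd j)%:R * p) + wt I e * vr e j * p)); last first.
    by move=> e _; ring.
  by rewrite big_split /= -mulr_suml -/(claim_mass j) -/s -mulr_suml -/(wr j) -/w; ring.
rewrite mulrA ler_wpM2r //.
have : s * (dd j)%:R * wr j <= 2 * wr j by rewrite ler_wpM2r ?wr_ge0.
by lra.
Qed.

Lemma unitl_gt0 : (0 < size unitl)%N. Proof. by []. Qed.

Lemma kap_unitl S : kap I unitl 0 S = count (ncov I S) (goods I).
Proof. by rewrite /kap -sum1_count -big_filter -(big_map (fun=> 1%N) xpredT id) sumnE. Qed.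

Lemma crit_sub S : {subset crit I unitl 0 S <= S}.
Proof. by move=> i; rewrite mem_filter => /andP[]. Qed.

(** The critical set U has exactly |N(U)| + d members for the deficiency d, while the LP allows at
    most |N(U)| plus the small mass of U. So this mass is at least d, and at most 1/2 of it is
    dead. *)
Lemma crit_mass S : uniq S -> {subset S <= pers I} ->
  (defi I unitl 0 S)%:R <= \sum_(e <- ents I | alive I X e && (e.1 \in crit I unitl 0 S)) wt I e + 2^-1.
Proof.
move=> uS sub; set U := crit I unitl 0 S.
have uU : uniq U by exact: filter_uniq.
have subU : {subset U <= pers I} by move=> i /crit_sub /sub.
have h1 := size_ncov_pmass W uU subU.
have h2 := crit_max I 0 unitl_gt0 S; rewrite -/U kap_unitl mul1n in h2.
rewrite h2 natrD lerD2l in h1; apply: le_trans h1 _.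
rewrite (eq_bigr _ (fun i _ => pmass_split I X i)) big_split /= lerD //; last first.
  exact: le_trans (dead_sum _ _ uU) (dead_small W).
rewrite /live_mass (exchange_ents _ _ _ _ (fun e i => e.1 == i)).
rewrite [leRHS]big_mkcondr /=; apply: ler_sum => e _.
under eq_bigl do rewrite eq_sym.
rewrite -big_filter; case: (boolP (e.1 \in U)) => eS.
  by rewrite filter_pred1_uniq // big_seq1.
rewrite (_ : filter _ _ = [::]) ?big_nil // -(filter_pred0 U); apply: eq_in_filter => i iS /=.
by apply/eqP => h; rewrite -h iS in eS.
Qed.

(** As the deficiency d is at least 1, losing 1/2 leaves the candidates with mass at least d/2. The
    cheapest one costs no more than their average, at most 3 pot / (d/2). *)
Lemma chosen_spec st : uniq (rest st) -> {subset rest st <= pers I} ->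
  (0 < defi I unitl 0 (rest st))%N ->
  [/\ chosen I X st \in ents I, alive I X (chosen I X st),
      (chosen I X st).1 \in crit I unitl 0 (rest st) &
      (defi I unitl 0 (rest st))%:R * costr (pwr st) (chosen I X st) <= 6 * pot (pwr st)].
Proof.
move=> uS sub d0; set S := rest st; set d := defi I unitl 0 S; set e0 := chosen I X st.
have h1 := crit_mass uS sub; rewrite -/S -/d in h1.
have d1 : (1 : rat) <= d%:R by rewrite ler1n.
set mu := \sum_(e <- ents I | _) _ in h1.
have mem_c e : (e \in cands I X S) = [&& alive I X e, e.1 \in crit I unitl 0 S & e \in ents I].
  by rewrite mem_filter -andbA.
have : e0 \in cands I X S.
  rewrite /e0 /chosen; apply: amin_in; rewrite -/S.
  suff : cands I X S != [::] by case: (cands I X S) => // e s _; rewrite inE eqxx.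
  apply/eqP => c0; suff : mu = 0 by move=> z; rewrite z in h1; lra.
  by rewrite /mu -big_filter -/(cands I X S) c0 big_nil.
rewrite mem_c => /and3P[ae ce eI]; split=> //.
have ds0 : (0 : rat) < (den I)%:R * (scale I X)%:R.
  by rewrite mulr_gt0 // ltr0n ?(wf_den W) ?scale_gt0.
have min e : e \in cands I X S -> costr (pwr st) e0 <= costr (pwr st) e.
  move=> ec; have := ec; rewrite mem_c => /and3P[ae' _ eI'].
  rewrite -(ler_pM2l ds0) -!costE // ler_nat.
  exact: (amin_min (cost I X (pwr st)) _ ec).
have c0 e : 0 <= costr (pwr st) e.
  apply: sumr_ge0 => j _; rewrite mulr_ge0 // addr_ge0 ?vr_ge0 //.
  by rewrite mulr_ge0 ?wr_ge0.
have h2 : mu * costr (pwr st) e0 <= 3 * pot (pwr st).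
  apply: le_trans (avg_cost _); rewrite /mu mulr_suml.
  rewrite [leRHS](bigID (fun e => e.1 \in crit I unitl 0 S)) /= ler_wpDr //.
    by apply: sumr_ge0 => e _; rewrite mulr_ge0 ?wt_ge0.
  rewrite big_seq_cond [leRHS]big_seq_cond; apply: ler_sum => e /andP[eI' /andP[ae' ce']].
  by rewrite ler_wpM2l ?wt_ge0 // min // mem_c ae' ce'.
have h3 : d%:R * costr (pwr st) e0 <= 2 * mu * costr (pwr st) e0.
  by rewrite ler_wpM2r //; lra.
by lra.
Qed.

Definition gain (q : nat * seq nat) : rat := \sum_(j <- q.2) (ut I q.1 j)%:R.

(** The 4 in the third clause combines two halvings: an alive configuration keeps T/2, and refusals
    take at most half of that. The last clause trades the growth of the potential against the
    falling deficiency. *)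
Definition pinv st :=
  [/\ perm_eq ([seq q.1 | q <- served st] ++ rest st) X,
      forall j, (j < m)%N -> nth 0%N (pwr st) j = ((dd j).+1 ^ nth 0 (cnt st) j)%N,
      forall q, q \in served st -> [/\ uniq q.2,
         forall j, j \in q.2 -> (j < m)%N /\ ~~ kill I X j,
         forall j, j \in q.2 -> (C0 * E)%:R * (ut I q.1 j)%:R <= tgt I &
         tgt I <= 4 * gain q],
      forall j, (j < m)%N -> (count (fun q : nat * seq nat => j \in q.2) (served st)
         <= minn (nth 0 (cnt st) j) (16 * nn I j))%N &
      pot (pwr st) * (rise6 (defi I unitl 0 (rest st)))%:R <= k%:R * (rise6 k)%:R].

Lemma defi_size S : (defi I unitl 0 S <= size S)%N.
Proof.
have [Z h] := defi_ge I 0 unitl_gt0 S; rewrite mul1n in h.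
apply: leq_trans (count_size Z S); apply: leq_trans h; exact: leq_addl.
Qed.

Lemma size_X : (size X <= k)%N.
Proof. rewrite -(size_iota 0 k); exact: uniq_leq_size (uniq_X W) (Xpers W). Qed.

Lemma pinv_init : pinv (pinit I X).
Proof.
split; rewrite /served /rest /cnt /pwr //=.
- move=> j jm; rewrite !(nth_map 0%N) ?size_iota //.
- rewrite ler_pM // ?pot_ge0 //; last first.
    by rewrite ler_nat rise6_mono // (leq_trans (defi_size _)) // size_X.
  apply: le_trans sum_wr; rewrite /pot big_seq_cond [leRHS]big_seq_cond; apply: ler_sum => j /andP[jg _].
  by rewrite goods_lt in jg; rewrite (nth_map 0%N) ?size_iota // mulr1.
Qed.

(** The left side is at most 2 (2E)^14, because k + 6 <= (2E)^2 and k * rise6 k <= (k + 6)^7. The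
    right side is at least (E/2)^16 by [expn_div_ge]. The two spare factors [E] pay for 2^31, which
    is why 16 claims per unit of n_j and E >= 2^16 suffice. *)
Lemma big_power j : (j < m)%N -> ~~ kill I X j ->
  2 * (k%:R * (rise6 k)%:R) <= ((dd j).+1 ^ (16 * nn I j))%:R :> rat.
Proof.
move=> jm; rewrite /kill negb_or => /andP[n0 _]; rewrite -lt0n in n0.
rewrite -!natrM ler_nat mulnC [(16 * _)%N]mulnC expnM.
have h1 : (E <= 2 * (dd j).+1 ^ nn I j)%N by apply: expn_div_ge; rewrite n0 nn_le.
set M := ((dd j).+1 ^ nn I j)%N in h1 *.
have h2 : (E ^ 16 <= 2 ^ 16 * M ^ 16)%N by rewrite -expnMn; exact: leq_expl.
have h3 : (k + 6 <= (2 * E) ^ 2)%N.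
  have /andP[_] := rt_spec I; rewrite -/k -/E => h; have := rt_ge512 W; rewrite -/E.
  by move=> ?; rewrite expnMn -!mulnn; nia.
have h4 : (k * rise6 k <= 2 ^ 14 * E ^ 14)%N.
  by apply: leq_trans (rise6_le k) _; rewrite -expnMn (expnM _ 2 7); exact: leq_expl.
have h5 : (2 ^ 16 * 2 ^ 14 * 2 <= E ^ 2)%N.
  apply: leq_trans (leq_expl 2 (wf_rt W)).
  rewrite -expnM -expnD -expnSr; exact: leq_pexp2l.
have p0 : (0 < 2 ^ 16)%N by rewrite expn_gt0.
move: (2 ^ 16)%N (2 ^ 14)%N p0 h2 h4 h5 => A B p0 h2 h4 h5.
rewrite -(leq_pmul2l p0); apply: leq_trans h2; rewrite (expnD E 2 14).
move: (E ^ 14)%N (E ^ 2)%N (k * rise6 k)%N h4 h5 => e14 e2 z h4 h5.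
apply: (@leq_trans (A * (B * e14 * 2))%N); first by rewrite leq_mul2l leq_mul2r h4 !orbT.
by rewrite mulnA mulnA mulnAC leq_mul2r h5 orbT.
Qed.

Lemma pinv_step st : pinv st -> pinv (pstep I X st).
Proof.
move=> hst; case: (hst) => [hp hw hs hc hpot]; rewrite /pstep; case: eqP => [//|/eqP d0].
rewrite -lt0n in d0.
have uS : uniq (rest st).
  by have := perm_uniq hp; rewrite (uniq_X W) cat_uniq => /and3P[].
have sub : {subset rest st <= pers I}.
  by move=> i ir; apply: (Xpers W); rewrite -(perm_mem hp) mem_cat ir orbT.
have [eI ae ce hcost] := chosen_spec uS sub d0.
set e := chosen I X st in eI ae ce hcost.
set S := rest st in uS sub d0 ce hcost hp hpot; set d := defi I unitl 0 S in d0 hcost hpot.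
have eS : e.1 \in S := crit_sub ce.
have nsg : ~~ sgl e by case/andP: ae.
have d1 : (1 : rat) <= d%:R by rewrite ler1n.
have P0 := pot_ge0 (pwr st); set Phi := pot (pwr st) in hcost hpot P0.
have c0 : 0 <= costr (pwr st) e.
  apply: sumr_ge0 => j _; rewrite mulr_ge0 // addr_ge0 ?vr_ge0 //.
  by rewrite mulr_ge0 ?wr_ge0.
split; rewrite /served /rest /cnt /pwr /pgo /= -?/e -?/S.
- rewrite perm_sym; apply: perm_trans (_ : perm_eq _ ([seq q.1 | q <- served st] ++ S)) _; first by rewrite perm_sym.
  rewrite perm_sym -cat_cons -cat1s -catA perm_catCA perm_cat2l /del.
  have -> : [seq i' <- S | ~~ (i' == e.1)] = rem e.1 S by rewrite rem_filter.
  by rewrite perm_sym cat1s perm_to_rem.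
- move=> j jm; rewrite !(nth_map 0%N) ?size_iota // nth_iota // add0n.
  by case: ifP => _; rewrite ?expnSr ?hw.
- move=> q; rewrite inE => /orP[/eqP->|/hs//]; split=> /=.
  + exact: filter_uniq (wf_uniq W eI).
  + move=> j; rewrite mem_filter => /andP[/andP[nk _] je]; split=> //.
    exact: wf_goods W _ _ eI je.
  + by move=> j; rewrite mem_filter => /andP[_ je]; exact: wf_small W _ _ eI nsg je.
  rewrite /gain /= /grant big_filter.
  have Zb : \sum_(j <- e.2.1 | ~~ kill I X j) vr e j * (nth 0%N (pwr st) j)%:R <= k%:R * (rise6 k)%:R.
    apply: (@le_trans _ _ (costr (pwr st) e)).
      apply: ler_sum => j _; rewrite ler_wpM2r //.
      by rewrite lerDr mulr_ge0 ?wr_ge0.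
    have h1 : costr (pwr st) e <= d%:R * costr (pwr st) e by rewrite ler_peMl.
    have h2 : 6 * Phi <= (rise6 d)%:R * Phi by rewrite ler_wpM2r // (ler_nat _ 6) rise6_ge.
    by rewrite mulrC in hpot; lra.
  have Z0 : 0 < k%:R * (rise6 k)%:R :> rat.
    rewrite -natrM ltr0n muln_gt0 (leq_trans _ (rise6_ge k)) // andbT.
    exact: leq_ltn_trans (leq0n _) (wf_pers W eI).
  set Z := k%:R * _ in Zb Z0.
  (* On a refused good the power is at least 2 Z, whereas the average of the powers, weighted by the
     value shares of [e], is at most Z by [Zb]. Refused goods therefore carry at most half of the
     value. *)
  have ung : \sum_(j <- e.2.1 | ~~ kill I X j && ~~ (nth 0%N (cnt st) j < 16 * nn I j)%N) vr e j <= 2^-1.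
    rewrite -(ler_pM2r (_ : 0 < 2 * Z)); last by lra.
    apply: (@le_trans _ _ Z); last by lra.
    apply: le_trans Zb; rewrite [leRHS](bigID (fun j => nth 0%N (cnt st) j < 16 * nn I j)%N) /=.
    apply: ler_wpDl; first by apply: sumr_ge0 => j _; rewrite mulr_ge0 ?vr_ge0.
    rewrite mulr_suml big_seq_cond [leRHS]big_seq_cond; apply: ler_sum => j /andP[je /andP[nk]].
    rewrite -leqNgt => hcj; rewrite ler_wpM2l ?vr_ge0 //.
    have jm := wf_goods W eI je; apply: le_trans (big_power jm nk) _.
    by rewrite hw // ler_nat leq_pexp2l.
  have := sum_vr ae; rewrite (bigID (fun j => nth 0%N (cnt st) j < 16 * nn I j)%N) /= => hsum.
  have hg : 2^-1 <= \sum_(j <- e.2.1 | ~~ kill I X j && (nth 0%N (cnt st) j < 16 * nn I j)%N) vr e j by lra.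
  have a0 : (0 : rat) < (aval I X e)%:R by rewrite ltr0n aval_gt0.
  move: hg; rewrite /vr -mulr_suml ler_pdivlMr //.
  have : tgt I <= 2 * (aval I X e)%:R.
    rewrite /tgt ler_pdivrMr ?ltr0n ?(wf_tden W) // -!natrM ler_nat -mulnA (mulnC (aval I X e)).
    by case/andP: ae.
  by lra.
- move=> j jm; rewrite (nth_map 0%N) ?size_iota // nth_iota // add0n.
  have hj := hc j jm; rewrite /claimed.
  case: (boolP (j \in grant I X st e)) => jg.
    move: (jg); rewrite mem_filter => /andP[/andP[nk lt] je]; rewrite je nk /=.
    move: hj lt; rewrite !leq_min => /andP[h1 h2] lt; rewrite add1n ltnS h1 /=.
    exact: leq_ltn_trans h1 lt.
  rewrite /= add0n; apply: leq_trans hj _; rewrite leq_min geq_minr andbT.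
  by apply: leq_trans (geq_minl _ _) _; case: ifP.
- set pw' := [seq _ | j <- goods I].
  have hPhi : pot pw' <= Phi + costr (pwr st) e.
    rewrite /pot /costr -(sum_entry_goods _ _ eI) /Phi /pot big_mkcondr /= -big_split /=.
    rewrite big_seq_cond [leRHS]big_seq_cond; apply: ler_sum => j /andP[jg nk].
    rewrite goods_lt in jg; rewrite (nth_map 0%N) ?size_iota // nth_iota // add0n /claimed nk andbT.
    case: ifP => je; last by rewrite addr0.
    rewrite natrM -natr1 -/(dd j).
    have := vr_ge0 e j; have p0 : 0 <= (nth 0%N (pwr st) j)%:R :> rat by [].
    by move=> v0; have := mulr_ge0 v0 p0; lra.
  have hd : (defi I unitl 0 (del e.1 S) <= d.-1)%N by rewrite -ltnS prednK //; exact: (crit_del ce).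
  have hr := rise6_mono hd.
  have pw0 := pot_ge0 pw'.
  apply: (@le_trans _ _ (pot pw' * (rise6 d.-1)%:R)); first by rewrite ler_wpM2l // ler_nat.
  apply: le_trans hpot; case: (d) d0 d1 hcost => // d' _ _ hcost /=.
  have hR : (d'.+1)%:R * (rise6 d'.+1)%:R = (d'%:R + 7) * (rise6 d')%:R :> rat.
    by rewrite -natrM rise6S natrM natrD.
  have dp : (0 : rat) < (d'.+1)%:R by rewrite ltr0n.
  have r0 : (0 : rat) <= (rise6 d')%:R by [].
  rewrite -(ler_pM2l dp) [leRHS]mulrCA hR mulrA [leRHS]mulrA ler_wpM2r //.
  have h1 : (d'.+1)%:R * pot pw' <= (d'.+1)%:R * (Phi + costr (pwr st) e) by rewrite ler_pM2l.
  rewrite -natr1 in h1 hcost *; lra.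
Qed.

Lemma prun_spec : pinv (prun I X) /\ defi I unitl 0 (rest (prun I X)) = 0%N.
Proof.
have inv t : pinv (iter t (pstep I X) (pinit I X)).
  by elim: t => [|t IH]; [exact: pinv_init | exact: pinv_step].
split; first exact: inv.
have dec t : (defi I unitl 0 (rest (iter t (pstep I X) (pinit I X))) <= k - t)%N.
  elim: t => [|t IH]; first by rewrite subn0 (leq_trans (defi_size _)) // size_X.
  rewrite iterS; set st := iter t _ _ in IH *; have [hp _ _ _ _] := inv t.
  rewrite /pstep; case: eqP => [->//|/eqP d0]; rewrite -lt0n in d0.
  have uS : uniq (rest st).
    by have := perm_uniq hp; rewrite (uniq_X W) cat_uniq => /and3P[].
  have sub : {subset rest st <= pers I}.
    by move=> i ir; apply: (Xpers W); rewrite -(perm_mem hp) mem_cat ir orbT.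
  have [_ _ /crit_del h _] := chosen_spec uS sub d0.
  rewrite (_ : rest (pgo I X st) = del (chosen I X st).1 (rest st)) //; lia.
by have := dec k; rewrite subnn leqn0 => /eqP.
Qed.

End Phase2.

(** * The final assignment *)

Lemma sum_pow2 N : \sum_(c <- iota 0 N) (2 ^ c)%:R <= (2 ^ N)%:R :> rat.
Proof.
elim: N => [|N IH]; first by rewrite big_nil.
rewrite -addn1 iotaD big_cat big_seq1 add0n addn1 expnS mul2n -addnn natrD.
by rewrite lerD2r.
Qed.

Lemma sum_pow2_le N (t : rat) : 0 <= t ->
  \sum_(c <- iota 0 N | (2 ^ c)%:R <= t) (2 ^ c)%:R <= 2 * t.
Proof.
move=> t0; elim: N => [|N IH]; first by rewrite big_nil mulr_ge0.
rewrite -addn1 iotaD big_cat /= big_cons big_nil add0n; case: ifP => h; rewrite addr0 //.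
have : \sum_(c <- iota 0 N | (2 ^ c)%:R <= t) (2 ^ c)%:R <= (2 ^ N)%:R :> rat.
  apply: le_trans (sum_pow2 N); rewrite [leRHS](bigID (fun c => (2 ^ c)%:R <= t)) /=.
  by rewrite lerDl; apply: sumr_ge0.
by lra.
Qed.

Lemma sum_pows n (P : pred nat) (F : nat -> rat) :
  \sum_(p <- pows n | P p) F p =
  \sum_(c <- iota 0 (if n == 0%N then 0 else (trunc_log 2 n).+1) | P (2 ^ c)%N) F (2 ^ c)%N.
Proof. by rewrite /pows (perm_big _ (permEl (perm_rev _))) big_map. Qed.

Definition incls (u p : nat) := ((p <= u) && (u < 2 * p))%N.

Lemma incls_pow u c : (0 < u)%N -> incls u (2 ^ c) = (c == trunc_log 2 u).
Proof.
move=> u0; rewrite /incls -expnS; apply/idP/eqP => [h|->].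
  by apply/esym/trunc_log_eq.
by rewrite trunc_logP // trunc_log_ltn.
Qed.

Lemma count_incls u n : (u <= n)%N -> count (incls u) (pows n) = (0 < u)%N.
Proof.
move=> un; rewrite /pows count_rev count_map; case: (posnP u) => [->|u0].
  rewrite -[RHS]/0%N; apply/eqP; rewrite -leqn0 leqNgt -has_count.
  by apply/hasPn => c _ /=; rewrite /incls leqn0 expn_eq0.
rewrite (eq_count (a2 := pred1 (trunc_log 2 u))); last by move=> c /=; rewrite incls_pow.
rewrite count_uniq_mem ?iota_uniq // mem_iota add0n /=.
have n0 : (0 < n)%N by apply: leq_trans un.
by rewrite eqn0Ngt n0 /= ltnS leq_trunc_log // u0.
Qed.

(** * Hall's condition certified by loads *)

Section Hall.
Variable gs : seq nat.
Implicit Types (nds : seq node) (l : nat -> rat).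

Definition hit (Y : pred node) nds j := has (fun nd => Y nd && (j \in nd.2.2)) nds.

(* Hall's condition when good [j] may only be used to the extent [l j]. *)
Definition HL nds l := forall Y : pred node,
  (count Y nds)%:R <= \sum_(j <- gs | hit Y nds j) l j.

Lemma HL_nil l : HL [::] l.
Proof. by move=> Y; rewrite big_pred0. Qed.

(** Each group of nodes certifies the condition with its own load; the groups interact only through
    the total load of a good. *)
Lemma HL_cat n1 n2 l1 l2 : (forall j, 0 <= l1 j) -> (forall j, 0 <= l2 j) ->
  HL n1 l1 -> HL n2 l2 -> HL (n1 ++ n2) (fun j => l1 j + l2 j).
Proof.
move=> l10 l20 h1 h2 Y; rewrite count_cat natrD big_split /= lerD //.
  apply: le_trans (h1 Y) _; rewrite big_mkcond [leRHS]big_mkcond /=; apply: ler_sum => j _.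
  by rewrite /hit has_cat; case: (has _ n1) => //=; case: ifP.
apply: le_trans (h2 Y) _; rewrite big_mkcond [leRHS]big_mkcond /=; apply: ler_sum => j _.
by rewrite /hit has_cat orbC; case: (has _ n2) => //=; case: ifP.
Qed.

Lemma HL_le nds l l' : {in gs, forall j, l j <= l' j} -> HL nds l -> HL nds l'.
Proof.
move=> h hl Y; apply: le_trans (hl Y) _; rewrite big_seq_cond [leRHS]big_seq_cond.
by apply: ler_sum => j /andP[/h].
Qed.

Lemma HL_flatten (T : eqType) (s : seq T) (F : T -> seq node) (l : T -> nat -> rat) :
  (forall x j, x \in s -> 0 <= l x j) -> (forall x, x \in s -> HL (F x) (l x)) ->
  HL (flatten [seq F x | x <- s]) (fun j => \sum_(x <- s) l x j).
Proof.
elim: s => [|x s IH] l0 h /=; first exact: HL_nil.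
have {}IH : HL (flatten [seq F x | x <- s]) (fun j => \sum_(x <- s) l x j).
  by apply: IH => y *; [apply: l0 | apply: h]; rewrite inE orbC; apply/orP; left.
have x0 : x \in x :: s by rewrite inE eqxx.
have s_ge0 j : 0 <= \sum_(x <- s) l x j.
  by rewrite big_seq; apply: sumr_ge0 => y ys; apply: l0; rewrite inE ys orbT.
by apply: HL_le (HL_cat (fun j => l0 x j x0) s_ge0 (h x x0) IH) => j _; rewrite big_cons.
Qed.

(** The extremal set [Y] of the auction consists of positions. Closing it under equal nodes gives
    [Y'], with the same neighbourhood and at least as many nodes. Its load is at most the number of
    neighbouring goods, so nothing is left for dropped bidders. *)
Lemma HL_auction us nds l : gs = iota 0 (size us) ->
  (forall nd j, nd \in nds -> j \in nd.2.2 -> (j < size us)%N) ->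
  {in gs, forall j, l j <= 1} -> HL nds l ->
  dropped (auction us [seq nd.2.2 | nd <- nds]) = [::].
Proof.
move=> gsE lt l1 hl; set adj := [seq nd.2.2 | nd <- nds].
have nthE a : (a < size nds)%N -> nth [::] adj a = (nth (0, (0, [::])) nds a).2.2 :> seq nat.
  by move=> an; rewrite (nth_map (0, (0, [::]))%N).
have szE : size adj = size nds by rewrite size_map.
have adj_lt a j : j \in nth [::] adj a -> (j < size us)%N.
  have [an|ge] := ltnP a (size nds); last by rewrite nth_default // szE.
  by rewrite nthE //; apply: lt; rewrite mem_nth.
have [Y hY] := auction_ge adj_lt; rewrite szE in hY.
pose Y' (nd : node) := has (fun a => Y a && (nth (0, (0, [::]))%N nds a == nd)) (iota 0 (size nds)).
have c1 : (count Y (iota 0 (size nds)) <= count Y' nds)%N.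
  rewrite -[in X in (_ <= X)%N](mkseq_nth (0, (0, [::]))%N nds) count_map.
  by apply: sub_in_count => a an Ya; apply/hasP; exists a; rewrite //= Ya eqxx.
have h := hl Y'.
have c2 : \sum_(j <- gs | hit Y' nds j) l j <= (count (nbh adj Y) (iota 0 (size us)))%:R.
  rewrite -gsE natr_count big_mkcond [leRHS]big_mkcond /= big_seq [leRHS]big_seq.
  apply: ler_sum => j jg; case: ifP => [|_]; last by case: ifP.
  move=> /hasP[nd ndin /andP[/hasP[a ain /andP[Ya /eqP e]] jn]].
  rewrite ifT ?l1 //; apply/hasP; exists a; rewrite ?szE // Ya nthE ?e //.
  by move: ain; rewrite mem_iota.
have : (count Y (iota 0 (size nds)) <= count (nbh adj Y) (iota 0 (size us)))%N.
  rewrite -(ler_nat rat); apply: le_trans (le_trans h c2).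
  by rewrite ler_nat.
by rewrite hY -[X in (_ <= X)%N]addn0 leq_add2l leqn0 size_eq0 => /eqP.
Qed.

End Hall.

(** * Rounding shares by slots *)

Section Slots.
Variables (I : inst) (i d : nat) (G : seq (nat * nat)).
Hypothesis d0 : (0 < d)%N.
Hypothesis Ggoods : forall g, g \in G -> g.1 \in goods I.
Let dr : rat := d%:R.
Implicit Types (g : nat * nat) (p : nat).

Lemma drat_gt0 : 0 < dr. Proof. by rewrite ltr0n. Qed.

Lemma clsE p g : (g \in cls I i p G) = (g \in G) && incls (ut I i g.1) p.
Proof. by rewrite mem_filter andbC. Qed.

Definition hgt p : rat := \sum_(g <- G | incls (ut I i g.1) p) g.2%:R / dr.

Lemma hgt_ge0 p : 0 <= hgt p. Proof. by apply: sumr_ge0 => g _; rewrite divr_ge0. Qed.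

Lemma sum_cls p : (sumn [seq g.2 | g <- cls I i p G])%:R / dr = hgt p.
Proof. by rewrite natr_sumn mulr_suml. Qed.

Lemma sum_goods (P : pred (nat * nat)) (F : nat * nat -> rat) :
  \sum_(j <- goods I) \sum_(g <- G | P g && (g.1 == j)) F g = \sum_(g <- G | P g) F g.
Proof.
rewrite (exchange_big_dep P) /=; last by move=> j g _ /andP[].
rewrite big_seq_cond [RHS]big_seq_cond; apply: eq_bigr => g /andP[gG Pg].
rewrite Pg /=; under eq_bigl do rewrite eq_sym.
by rewrite -big_filter filter_pred1_uniq ?iota_uniq ?big_seq1 // Ggoods.
Qed.

Lemma size_slot p : (size (slot I i d p G) <= sumn [seq g.2 | g <- cls I i p G] %/ d)%N.
Proof.
rewrite size_map size_filter; set q := (_ %/ d)%N.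
have [le|lt] := leqP (size G) q; first by apply: leq_trans (count_size _ _) _; rewrite size_iota.
by rewrite (eq_count (a2 := fun c => (c + (size G - q) < size G)%N)) ?count_iota_ltn; [|move=> c /=]; lia.
Qed.

(** The slots of one class are copies of a single node, so [Y] takes all or none of them, and their
    number is the total load rounded down. *)
Lemma HL_slot p : HL (goods I) (slot I i d p G)
  (fun j => \sum_(g <- G | incls (ut I i g.1) p && (g.1 == j)) g.2%:R / dr).
Proof.
set nd : node := (i, (p, [seq g.1 | g <- cls I i p G])).
have al : forall x, x \in slot I i d p G -> x = nd by move=> x /mapP[c _ ->].
move=> Y; case: (boolP (Y nd)) => Ynd; last first.
  rewrite (_ : count Y _ = 0)%N.
    by apply: sumr_ge0 => j _; apply: sumr_ge0 => g _; rewrite divr_ge0.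
  by apply/eqP; rewrite -leqn0 leqNgt -has_count; apply/hasPn => x /al ->.
case s0 : (slot I i d p G) => [|x s].
  by rewrite /=; apply: sumr_ge0 => j _; apply: sumr_ge0 => g _; rewrite divr_ge0.
rewrite -s0; apply: (@le_trans _ _ (hgt p)).
  apply: (@le_trans _ _ (sumn [seq g.2 | g <- cls I i p G] %/ d)%:R).
    by rewrite ler_nat; apply: leq_trans (size_slot p); exact: count_size.
  by rewrite -sum_cls ler_pdivlMr ?drat_gt0 // -natrM ler_nat leq_trunc_div.
rewrite /hgt -sum_goods big_mkcond [leRHS]big_mkcond /=; rewrite [leRHS]big_mkcond big_mkcond /=.
apply: ler_sum => j _; case: ifP => // nh.
rewrite big1_seq // => g /andP[/andP[gp /eqP gj] gG]; exfalso; move/negP: nh; apply.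
have xin : x \in slot I i d p G by rewrite s0 inE eqxx.
have nds : nd \in slot I i d p G by rewrite -(al x xin).
apply/hasP; exists nd => //; rewrite Ynd /=; apply/mapP; exists g => //.
by rewrite clsE gG gp.
Qed.

Lemma ut_sum j : (ut I i j <= sumn (nth [::] (mat I) i))%N.
Proof.
rewrite /ut; elim: (nth [::] (mat I) i) j => [|x s IH] [|j] //=; first exact: leq_addr.
exact: leq_trans (IH j) (leq_addl _ _).
Qed.

Lemma sum_incls g (F : rat) :
  \sum_(p <- pows (sumn (nth [::] (mat I) i)) | incls (ut I i g.1) p) F = F *+ (0 < ut I i g.1)%N.
Proof.
rewrite -(count_incls (ut_sum g.1)) big_const_seq iter_addr_0.
by [].
Qed.

Lemma HL_slots : HL (goods I) (slots I i d G)
  (fun j => \sum_(g <- G | g.1 == j) g.2%:R / dr).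
Proof.
apply: (@HL_le _ _ (fun j => \sum_(p <- pows (sumn (nth [::] (mat I) i)))
   \sum_(g <- G | incls (ut I i g.1) p && (g.1 == j)) g.2%:R / dr)).
  move=> j _.
  under eq_bigr do under eq_bigl do rewrite andbC.
  rewrite (exchange_big_dep (fun g => g.1 == j)) /=; last by move=> p g _ /andP[].
  apply: ler_sum => g gj; rewrite gj /= sum_incls.
  by case: posnP; rewrite ?mulr0n ?divr_ge0.
apply: HL_flatten => [p j _|p _]; last exact: HL_slot.
by apply: sumr_ge0 => g _; rewrite divr_ge0.
Qed.

Variable t0 : rat.
Hypothesis t0_ge0 : 0 <= t0.
Hypothesis Gle : forall g, g \in G -> (g.2 <= d)%N.
Hypothesis Gt0 : forall g, g \in G -> (0 < g.2)%N -> (ut I i g.1)%:R <= t0.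

Lemma size_slotE p : size (slot I i d p G) = (sumn [seq g.2 | g <- cls I i p G] %/ d)%N.
Proof.
have le : (sumn [seq g.2 | g <- cls I i p G] %/ d <= size G)%N.
  rewrite -(mulnK (size G) d0) leq_div2r //.
  have : (sumn [seq g.2 | g <- cls I i p G] <= sumn [seq g.2 | g <- G])%N.
    rewrite -[G in (_ <= sumn [seq _ | _ <- G])%N](filter_predT G).
    by apply: sumn_filter_sub.
  move/leq_trans; apply; elim: (G) Gle => //= g s IH h.
  rewrite mulSn leq_add ?IH // ?h ?inE ?eqxx // => g' gs; apply: h.
  by rewrite inE gs orbT.
rewrite size_map size_filter; set q := (_ %/ d)%N in le *.
by rewrite (eq_count (a2 := fun c => (c + (size G - q) < size G)%N)) ?count_iota_ltn; [|move=> c /=]; lia.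
Qed.

(** Counting [p] instead of a utility below 2p costs a factor 2. Rounding down costs at most one
    slot in each class with a positive share; these classes belong to distinct powers of two below
    [t0], whose sum is at most [2 * t0]. *)
Lemma slots_value :
  (\sum_(g <- G) (ut I i g.1)%:R * (g.2%:R / dr)) / 2 - 2 * t0 <=
  \sum_(nd <- slots I i d G) (nd.2.1)%:R.
Proof.
have d1 := drat_gt0.
have e1 : \sum_(nd <- slots I i d G) (nd.2.1)%:R =
   \sum_(p <- pows (sumn (nth [::] (mat I) i))) p%:R * (size (slot I i d p G))%:R :> rat.
  rewrite /slots big_flatten big_map; apply: eq_bigr => p _.
  rewrite /slot big_map /= natr_size big_map mulr_sumr; apply: eq_bigr => c _.
  by rewrite mulr1.
have h1 p : p%:R * hgt p - (if 0 < hgt p then p%:R else 0) <= p%:R * (size (slot I i d p G))%:R.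
  rewrite size_slotE; case: ifP => hp; last first.
    by have := hgt_ge0 p; rewrite le_eqVlt hp orbF => /eqP <-; rewrite mulr0 subr0 mulr_ge0.
  have -> : p%:R * hgt p - p%:R = p%:R * (hgt p - 1) by ring.
  rewrite ler_wpM2l // -sum_cls lerBlDr ler_pdivrMr // natr1 -natrM ler_nat ltnW //.
  exact: ltn_ceil.
have h2 : \sum_(p <- pows (sumn (nth [::] (mat I) i))) (if 0 < hgt p then p%:R else 0) <= 2 * t0.
  rewrite -big_mkcond sum_pows; apply: le_trans (sum_pow2_le _ t0_ge0).
  rewrite big_mkcond [leRHS]big_mkcond /=; apply: ler_sum => c _.
  case: ifP => hc; last by case: ifP.
  have : hgt (2 ^ c)%N != 0 by rewrite gt_eqF.
  rewrite /hgt => hn.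
  have [g gG /andP[g2 gc]] : exists2 g, g \in G & (0 < g.2)%N && incls (ut I i g.1) (2 ^ c).
    apply/hasP/negPn/negP => /hasPn nh; case/negP: hn; apply/eqP; rewrite big1_seq //.
    move=> g /andP[gc gG]; have := nh g gG; rewrite gc andbT -leqNgt leqn0 => /eqP ->.
    by rewrite mul0r.
  rewrite ifT //; apply: le_trans (Gt0 gG g2); rewrite ler_nat.
  by case/andP: gc.
have h3 : (\sum_(g <- G) (ut I i g.1)%:R * (g.2%:R / dr)) / 2 <=
    \sum_(p <- pows (sumn (nth [::] (mat I) i))) p%:R * hgt p.
  have -> : \sum_(p <- pows (sumn (nth [::] (mat I) i))) p%:R * hgt p =
     \sum_(g <- G) \sum_(p <- pows (sumn (nth [::] (mat I) i)) | incls (ut I i g.1) p)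
       p%:R * (g.2%:R / dr).
    rewrite (exchange_big_dep xpredT) //=; apply: eq_bigr => p _.
    by rewrite /hgt mulr_sumr.
  rewrite mulr_suml; apply: ler_sum => g _.
  have q0 : 0 <= g.2%:R / dr by rewrite divr_ge0.
  apply: (@le_trans _ _ (\sum_(p <- pows (sumn (nth [::] (mat I) i)) | incls (ut I i g.1) p)
     ((ut I i g.1)%:R / 2 * (g.2%:R / dr)))).
    rewrite sum_incls; case: posnP => [->|_]; first by rewrite !mul0r mulr0n.
    by rewrite mulr1n mulrAC.
  apply: ler_sum => p /andP[_ lt]; rewrite ler_wpM2r // ler_pdivrMr // -natrM ler_nat mulnC.
  exact: ltnW.
rewrite e1; apply: le_trans (ler_sum _ (fun p _ => h1 p)).
by rewrite sumrB lerB.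
Qed.

End Slots.

(** * Loads, matching and value of the final assignment *)

Section Final.
Variables (I : inst) (C0 : nat).
Hypothesis W : wf I C0.
Let k := size (mat I).
Let m := size (nth [::] (mat I) 0).
Let E := rt I.
Let X := tightfix I.
Let st := prun I X.
Implicit Types (e : entry) (i j : nat).

Lemma nn_leE j : (nn I j <= E)%N.
Proof.
apply: (@leq_trans ((E * den I) %/ den I)%N); last by rewrite mulnK ?(wf_den W).
by apply: leq_div2r; rewrite leq_mul2l leq_subr orbT.
Qed.

Definition load_out j : rat := if ncov I X j then 0 else 1 - (nn I j)%:R / (2 * E%:R).
Definition load_in j : rat := if ncov I X j then 1 else 0.
Definition load_needless j : rat :=
  \sum_(i <- [seq i <- pers I | ~~ (i \in needy I X)])
    \sum_(g <- gshare I X i | g.1 == j) g.2%:R / (8 * den I)%:R.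
Definition load_served j : rat :=
  \sum_(q <- served st) \sum_(g <- [seq (j, 1%N) | j <- q.2] | g.1 == j) g.2%:R / (64 * E)%:R.

Lemma nn_frac j : 0 <= ((nn I j)%:R / (2 * E%:R) : rat) <= 1 / 2.
Proof.
have e0 := ratE_gt0 W; rewrite divr_ge0 ?mulr_ge0 //= ler_pdivrMr ?mulr_gt0 //.
have : (nn I j)%:R <= E%:R :> rat by rewrite ler_nat nn_leE.
by lra.
Qed.

Lemma count_map_node (Y : pred node) s :
  count Y [seq (i, (0%N, adj I i)) | i <- s] = count (fun i => Y (i, (0%N, adj I i))) s.
Proof. by rewrite count_map. Qed.

Lemma hit_map Y s j : hit Y [seq (i, (0%N, adj I i)) | i <- s] j =
  ncov I [seq i <- s | Y (i, (0%N, adj I i))] j.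
Proof.
rewrite /hit /ncov has_map; apply/hasP/hasP => [[i iS /= /andP[Yi ji]]|[i]].
  by exists i; rewrite // mem_filter Yi.
by rewrite mem_filter => /andP[Yi iS] ji; exists i; rewrite //= Yi.
Qed.

(* [X] has maximal deficiency, so Hall's condition holds outside it. *)
Lemma HL_out :
  HL (goods I) [seq (i, (0%N, adj I i)) | i <- [seq i <- needy I X | ~~ (i \in X)]] load_out.
Proof.
move=> Y; rewrite count_map_node; set S := [seq i <- needy I X | _].
pose Z i := Y (i, (0%N, adj I i)); have e0 := ratE_gt0 W.
pose Z' i := (i \in X) || Z i.
have h1 := defi_le I 1 (two_gt0 (rt_gt0 W)) Z' (needy I X).
have h2 := crit_max I 1 (two_gt0 (rt_gt0 W)) (needy I X).
rewrite -/(tight I X) (tightfixP (rt_gt0 W)) -/X in h2.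
have c1 : count Z' (needy I X) = (size X + count Z S)%N.
  have -> : size X = count (fun i => i \in X) (needy I X).
    rewrite -size_filter; apply: perm_size.
    apply: uniq_perm; [exact: uniq_X W | exact: filter_uniq (uniq_needy I X) | move=> i].
    rewrite [RHS]mem_filter; case: (boolP (i \in X)) => //= iX.
    by have := Xneedy W iX; rewrite -/X => ->.
  rewrite /S count_filter; elim: (needy I X) => //= i s ->.
  by rewrite /Z'; case: (i \in X); case: (Z i) => /=; lia.
have h3 : ((size (two I))%:R * (count Z S)%:R : rat) <=
   (kap I (two I) 1 (filter Z' (needy I X)))%:R - (kap I (two I) 1 X)%:R.
  by rewrite -natrM lerBrDr -natrD ler_nat; move: h1; rewrite c1 mulnDr; lia.
rewrite !(kap_two W) size_two in h3.
have h4 : \sum_(j <- goods I | ncov I (filter Z' (needy I X)) j) (2 * E%:R - (nn I j)%:R : rat) -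
   \sum_(j <- goods I | ncov I X j) (2 * E%:R - (nn I j)%:R) <=
   2 * E%:R * \sum_(j <- goods I | hit Y [seq (i, (0%N, adj I i)) | i <- S] j) load_out j.
  rewrite mulr_sumr [X in X - _]big_mkcond [X in _ - X]big_mkcond [leRHS]big_mkcond /= -sumrB.
  apply: ler_sum => j _; rewrite hit_map -/(filter Z S) /load_out.
  have nE : (nn I j)%:R <= E%:R :> rat by rewrite ler_nat nn_leE.
  have q : 2 * E%:R * (1 - (nn I j)%:R / (2 * E%:R)) = 2 * E%:R - (nn I j)%:R :> rat.
    by field; rewrite gt_eqF.
  have -> : ncov I (filter Z' (needy I X)) j = ncov I X j || ncov I (filter Z S) j.
    apply/hasP/orP => [[i]|[/hasP[i iX ji]|/hasP[i]]].
    - rewrite mem_filter => /andP[Zi iN] ji; case: (boolP (i \in X)) => iX.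
        by left; apply/hasP; exists i.
      right; apply/hasP; exists i => //; rewrite mem_filter /S mem_filter iX iN !andbT.
      by move: Zi; rewrite /Z' (negbTE iX).
    - exists i => //; rewrite mem_filter; apply/andP; split; first by apply/orP; left.
      exact: Xneedy W _ iX.
    - rewrite mem_filter => /andP[Zi iS] ji; exists i => //.
      rewrite mem_filter; apply/andP; split; first by rewrite /Z' Zi orbT.
      by move: iS; rewrite mem_filter => /andP[].
  by case: (ncov I X j); case: (ncov I _ j) => /=; rewrite ?mulr0 ?q; lra.
rewrite natrM in h3; have := le_trans h3 h4.
by rewrite -mulrA -[leRHS]mulrA !ler_pM2l.
Qed.

Lemma restX : {subset rest st <= X}.
Proof.
move=> i ir; have [[hp _ _ _ _] _] := prun_spec W.
by rewrite -(perm_mem hp) mem_cat ir orbT.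
Qed.

Lemma HL_in : HL (goods I) [seq (i, (0%N, adj I i)) | i <- rest st] load_in.
Proof.
move=> Y; rewrite count_map_node; set Z := fun i => _.
have [_ d0] := prun_spec W.
have := defi_le I 0 unitl_gt0 Z (rest st); rewrite d0 addn0 mul1n kap_unitl => h.
apply: (@le_trans _ _ (count (ncov I (filter Z (rest st))) (goods I))%:R); first by rewrite ler_nat.
rewrite natr_count big_mkcond [leRHS]big_mkcond /=; apply: ler_sum => j _.
rewrite hit_map -/(filter Z _); case: ifP => // hj; rewrite /load_in ifT //.
by apply: ncov_sub hj => i; rewrite mem_filter => /andP[_ /restX].
Qed.

Lemma gshare_goods i g : g \in gshare I X i -> g.1 \in goods I.
Proof. by move=> /mapP[j]; rewrite mem_filter => /andP[_ jg] ->. Qed.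

Lemma served_goods q g : q \in served st -> g \in [seq (j, 1%N) | j <- q.2] -> g.1 \in goods I.
Proof.
move=> qs /mapP[j jq ->]; have [[_ _ hs _ _] _] := prun_spec W.
by have [_ /(_ j jq)[jm _] _ _] := hs q qs; rewrite goods_lt.
Qed.

Lemma den8_gt0 : (0 < 8 * den I)%N. Proof. by rewrite muln_gt0 (wf_den W). Qed.
Lemma rt64_gt0 : (0 < 64 * E)%N. Proof. by rewrite muln_gt0 (rt_gt0 W). Qed.

Lemma load_out_ge0 j : 0 <= load_out j.
Proof. by rewrite /load_out; have := nn_frac j; case: ifP => // _ /andP[_]; lra. Qed.
Lemma load_in_ge0 j : 0 <= load_in j. Proof. by rewrite /load_in; case: ifP. Qed.
Lemma load_needless_ge0 j : 0 <= load_needless j.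
Proof. by do 2!apply: sumr_ge0 => ? _; rewrite divr_ge0. Qed.
Lemma load_served_ge0 j : 0 <= load_served j.
Proof. by do 2!apply: sumr_ge0 => ? _; rewrite divr_ge0. Qed.

Lemma HL_nodes : HL (goods I) (nodes I X st)
  (fun j => (load_out j + load_in j) + (load_needless j + load_served j)).
Proof.
rewrite /nodes; apply: HL_cat => [j|j||].
- by rewrite addr_ge0 ?load_out_ge0 ?load_in_ge0.
- by rewrite addr_ge0 ?load_needless_ge0 ?load_served_ge0.
- rewrite /bigs map_cat; apply: HL_cat HL_out HL_in; [exact: load_out_ge0|exact: load_in_ge0].
apply: HL_cat; [exact: load_needless_ge0|exact: load_served_ge0| |].
  apply: HL_flatten => [i j _|i _]; first by apply: sumr_ge0 => ? _; rewrite divr_ge0.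
  exact: HL_slots den8_gt0 (@gshare_goods i).
apply: HL_flatten => [q j _|q qs]; first by apply: sumr_ge0 => ? _; rewrite divr_ge0.
exact: HL_slots rt64_gt0 (fun g => @served_goods q g qs).
Qed.

Lemma load_needless_le j : j \in goods I ->
  load_needless j <= if kill I X j then 0 else (nn I j)%:R / (4 * E%:R).
Proof.
move=> jg; rewrite /load_needless.
have inner i : \sum_(g <- gshare I X i | g.1 == j) g.2%:R / (8 * den I)%:R =
    if kill I X j then 0 else (smass I X i j)%:R / (8 * den I)%:R :> rat.
  rewrite /gshare big_map big_filter_cond /= -big_filter.
  case: ifP => kj.
    rewrite (_ : filter _ _ = [::]) ?big_nil // -(filter_pred0 (goods I)); apply: eq_filter => j' /=.
    by case: eqP => [->|]; rewrite ?kj ?andbF.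
  rewrite (_ : filter _ _ = [:: j]) ?big_seq1 // -[RHS](filter_pred1_uniq (iota_uniq 0 m)) //.
  by apply: eq_filter => j' /=; case: eqP => [->|]; rewrite ?kj ?andbF.
rewrite (eq_bigr _ (fun i _ => inner i)); case: ifP => kj; first by rewrite big1.
have e0 := ratE_gt0 W; have d0 : (0 : rat) < (den I)%:R by rewrite ltr0n (wf_den W).
have jm : (j < m)%N by rewrite -goods_lt.
have h := claim_load W jm (negbT kj).
have : \sum_(i <- [seq i <- pers I | ~~ (i \in needy I X)]) (smass I X i j)%:R / (8 * den I)%:R
   <= claim_mass I j / 8.
  have sE i : (smass I X i j)%:R / (8 * den I)%:R =
     (\sum_(e <- ents I | (alive I X e && (j \in e.2.1)) && (e.1 == i)) wt I e) / 8.
    rewrite /smass natr_sumn /wt -mulr_suml natrM invfM mulrA mulrAC; congr (_ / _ / _).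
    by apply: eq_bigl => e; rewrite [(e.1 == i) && _]andbC andbA.
  rewrite (eq_bigr _ (fun i _ => sE i)) -mulr_suml ler_wpM2r ?invr_ge0 //.
  rewrite (exchange_ents _ _ _ _ (fun e i => e.1 == i)) /claim_mass.
  apply: ler_sum => e _; under eq_bigl do rewrite eq_sym.
  rewrite -big_filter; case: (boolP (e.1 \in [seq i <- pers I | ~~ (i \in needy I X)])) => eS.
    by rewrite filter_pred1_uniq ?big_seq1 // filter_uniq // uniq_pers.
  rewrite (_ : filter _ _ = [::]) ?big_nil ?wt_ge0 // -(filter_pred0 [seq i <- pers I | ~~ (i \in needy I X)]).
  by apply: eq_in_filter => i iS /=; apply/eqP => e1; rewrite -e1 iS in eS.
move/le_trans; apply; rewrite ler_pdivlMr ?mulr_gt0 //; move: h; rewrite -/E; lra.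
Qed.

Lemma load_served_le j : j \in goods I ->
  load_served j <= if kill I X j then 0 else (nn I j)%:R / (4 * E%:R).
Proof.
move=> jg; rewrite /load_served; have e0 := ratE_gt0 W.
have jm : (j < m)%N by rewrite -goods_lt.
have [[_ _ hs hc _] _] := prun_spec W; rewrite -/X -/st in hs hc.
have inner q : q \in served st -> \sum_(g <- [seq (j, 1%N) | j <- q.2] | g.1 == j) g.2%:R / (64 * E)%:R =
    if j \in q.2 then 1 / (64 * E)%:R else 0 :> rat.
  move=> qs; have [uq _ _ _] := hs q qs; rewrite big_map /= -big_filter.
  case: ifP => jq; first by rewrite filter_pred1_uniq // big_seq1.
  rewrite (_ : filter _ _ = [::]) ?big_nil // -(filter_pred0 q.2); apply: eq_in_filter => j' jq' /=.
  by apply/eqP => e1; rewrite -e1 jq' in jq.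
rewrite (eq_big_seq _ inner); case: ifP => kj.
  rewrite big1_seq // => q /andP[_ qs]; case: ifP => // jq.
  by have [_ /(_ j jq)[_]] := hs q qs; rewrite kj.
rewrite -big_mkcond /= -mulr_suml -natr_count.
have : (count (fun q : nat * seq nat => j \in q.2) (served st) <= 16 * nn I j)%N.
  by apply: leq_trans (hc j jm) _; exact: geq_minr.
rewrite -(ler_nat rat) natrM => h.
rewrite ler_pdivlMr ?mulr_gt0 // natrM mulrAC ler_pdivrMr ?mulr_gt0 //.
have := ler_wpM2r (ltW e0) h; lra.
Qed.

(** Persons who are not needy use 1/8 of a claim mass of at most 2 n_j / E; served persons use at
    most 16 n_j grants of 1 / (64 E). Each amounts to n_j / (4 E), together the n_j / (2 E) that
    [load_out] leaves free. On killed goods both vanish, so [load_in] may fill the goods of [X]. *)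
Lemma loads_le1 : {in goods I, forall j,
  (load_out j + load_in j) + (load_needless j + load_served j) <= 1}.
Proof.
move=> j jg; have h1 := load_needless_le jg; have h2 := load_served_le jg.
have /andP[n0 n1] := nn_frac j; have e0 := ratE_gt0 W.
have q : (nn I j)%:R / (4 * E%:R) = (nn I j)%:R / (2 * E%:R) / 2 :> rat.
  by field; rewrite gt_eqF.
move: h1 h2; rewrite q /load_out /load_in /kill; case: (ncov I X j); rewrite ?orbT ?orbF; first lra.
by case: ifP => _; lra.
Qed.

Let ns := nodes I X st.
Let au := auction (goods I) [seq nd.2.2 | nd <- ns].
Let nd0 : node := (0%N, (0%N, [::])).

Lemma slots_mem i d (G : seq (nat * nat)) nd : nd \in slots I i d G ->
  nd.1 = i /\ forall j, j \in nd.2.2 -> j \in [seq g.1 | g <- G] /\ (nd.2.1 <= ut I i j)%N.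
Proof.
move=> /flatten_mapP[p _ /mapP[c _ ->]] /=; split=> // j /mapP[g]; rewrite mem_filter.
by move=> /andP[/andP[h _] gG] ->; split=> //; apply/mapP; exists g.
Qed.

Lemma node_good nd j : nd \in ns -> j \in nd.2.2 ->
  j \in goods I /\ (nd.2.1 <= ut I nd.1 j)%N.
Proof.
rewrite !mem_cat => /orP[/mapP[i _ ->] /= ja|/orP[]/flatten_mapP].
- by rewrite goods_lt (mem_adj ja).
- move=> [i _ /slots_mem[-> h]] /h[/mapP[g gG ->] ->]; split=> //; exact: gshare_goods gG.
- move=> [q qs /slots_mem[-> h]] /h[/mapP[g gG ->] ->]; split=> //; exact: served_goods qs gG.
Qed.

Lemma adj_goods l j : j \in nth [::] [seq nd.2.2 | nd <- ns] l -> (j < size (goods I))%N.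
Proof.
have [ln|ge] := ltnP l (size ns); last by rewrite nth_default // size_map.
rewrite (nth_map nd0) // => h.
by have [] := node_good (mem_nth nd0 ln) h; rewrite goods_lt /goods size_iota.
Qed.

Lemma all_served : perm_eq (owned (owner au)) (iota 0 (size ns)).
Proof.
have := auction_perm adj_goods; rewrite size_map.
rewrite (HL_auction (gs := goods I) _ _ loads_le1 HL_nodes) //; first by rewrite /goods size_iota.
by move=> nd j h jn; have [] := node_good h jn; rewrite goods_lt /goods size_iota.
Qed.

Lemma mem_assign i j : ((i, j) \in assign I ns) =
  [&& j \in goods I, nth 0%N (owner au) j != 0%N & (nth nd0 ns (nth 0%N (owner au) j).-1).1 == i].
Proof.
apply/mapP/and3P => [[j']|[jg oj /eqP e]].
  by rewrite mem_filter => /andP[h1 h2] [-> ->]; rewrite h1 h2 eqxx.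
by exists j; rewrite ?mem_filter ?oj // e.
Qed.

Lemma assign_uniq : uniq [seq p.2 | p <- assign I ns].
Proof. by rewrite /assign -map_comp map_id filter_uniq // iota_uniq. Qed.

Lemma owner_node j l : nth 0%N (owner au) j = l.+1 ->
  [/\ j \in goods I, nth nd0 ns l \in ns & j \in (nth nd0 ns l).2.2].
Proof.
move=> /(ownerP adj_goods)[jg]; rewrite size_map => ln; rewrite (nth_map nd0) // => jn.
by rewrite mem_nth // goods_lt; move: jg; rewrite /goods size_iota.
Qed.

Lemma assign_pers i j : (i, j) \in assign I ns -> (i < k)%N /\ j \in goods I.
Proof.
rewrite mem_assign; case E1 : (nth _ (owner au) j) => [|l] /and3P[jg // _ /eqP <-]; split=> //.
have [_ + _] := owner_node E1; rewrite /= !mem_cat.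
case/orP => [/mapP[i' + ->]|/orP[]/flatten_mapP] /=.
- rewrite mem_cat => /orP[|/restX /(Xpers W)]; last by rewrite pers_lt.
  by rewrite !mem_filter pers_lt => /andP[_ /andP[]].
- by move=> [i']; rewrite mem_filter pers_lt => /andP[_ ik] /slots_mem[-> _].
- move=> [q qs /slots_mem[-> _]]; have [[hp _ _ _ _] _] := prun_spec W.
  by rewrite -pers_lt; apply: (Xpers W); rewrite -(perm_mem hp) mem_cat map_f.
Qed.

Lemma assign_big i : i \in bigs I X st -> exists2 j, (i, j) \in assign I ns & j \in adj I i.
Proof.
move=> ib; have : (i, (0%N, adj I i)) \in ns by rewrite mem_cat map_f.
move=> /(nthP nd0)[l ln e].
have : l \in owned (owner au) by rewrite (perm_mem all_served) mem_iota.
move=> /mapP[o]; rewrite mem_filter => /andP[o0 /(nthP 0%N)[j jo ej]] lo.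
have ej' : nth 0%N (owner au) j = l.+1 by rewrite ej lo prednK // lt0n.
have [jg _] := owner_node ej'; rewrite e => ja.
by exists j => //; rewrite mem_assign jg ej' /= e eqxx.
Qed.

(** Every node owns a good, distinct nodes own distinct goods, and an accepted good is worth at
    least the value of its node. *)
Lemma assign_value i : \sum_(nd <- ns | nd.1 == i) (nd.2.1)%:R <=
  \sum_(p <- assign I ns | p.1 == i) (ut I i p.2)%:R :> rat.
Proof.
rewrite -[X in \sum_(_ <- X | _) _ <= _](mkseq_nth nd0) big_map /=.
rewrite -(perm_big _ all_served) /=.
rewrite /owned big_map big_filter_cond /= -[X in \sum_(_ <- X | _) _ <= _](mkseq_nth 0%N) big_map.
rewrite (size_owner adj_goods) /goods size_iota -/(goods I).
rewrite /assign big_map big_filter_cond /= -/ns -/au big_seq_cond [leRHS]big_seq_cond.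
apply: ler_sum => j /andP[jg /andP[oj /eqP e]]; rewrite ler_nat.
case E1 : (nth _ (owner au) j) oj e => [|l] // _ e.
have [_ h1 h2] := owner_node E1.
by have [_] := node_good h1 h2; rewrite -e.
Qed.

Let t0 : rat := tgt I / (C0 * E)%:R.

Lemma C0E_gt0 : 0 < (C0 * E)%:R :> rat.
Proof.
rewrite ltr0n muln_gt0 (rt_gt0 W) andbT; apply: leq_trans (wf_C0 W).
by rewrite muln_gt0.
Qed.

Lemma t0_ge0 : 0 <= t0. Proof. by rewrite divr_ge0 ?ltW ?(tgt_gt0 W) ?C0E_gt0. Qed.

(** The origin of 256 * 6: a served person has grants worth T/4 at shares 1 / (64 E), that is T /
    (256 E) >= 6 t0. The slots keep half of this minus 2 t0, which is [t0]. *)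
Lemma tgt_t0 : 256 * 6 * E%:R * t0 <= tgt I.
Proof.
have e0 := ratE_gt0 W; have c0 := C0E_gt0.
have -> : tgt I = (C0 * E)%:R * t0 by rewrite mulrC divfK // gt_eqF.
rewrite natrM; apply: (ler_wpM2r t0_ge0); apply: (ler_wpM2r (ltW e0)).
by move: (wf_C0 W); rewrite -(ler_nat rat) natrM; apply.
Qed.

Lemma le_t0 (x : rat) : (C0 * E)%:R * x <= tgt I -> x <= t0.
Proof. by move=> h; rewrite ler_pdivlMr ?C0E_gt0 // mulrC. Qed.

(** Alive configurations worth at least T/2 make up at least 1/E of the mass. At 1/8 of the shares
    this is T / (16 E), far more than the 6 t0 needed for [slots_value]. *)
Lemma value_needless i : (i < k)%N -> i \notin needy I X ->
  t0 <= \sum_(nd <- slots I i (8 * den I) (gshare I X i)) (nd.2.1)%:R.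
Proof.
move=> ik nN; have e0 := ratE_gt0 W.
have d0 : (0 : rat) < (den I)%:R by rewrite ltr0n (wf_den W).
have sE j : (smass I X i j)%:R = (den I)%:R *
   \sum_(e <- ents I | (alive I X e && (e.1 == i)) && (j \in e.2.1)) wt I e.
  rewrite /smass natr_sumn /wt -mulr_suml mulrC divfK ?gt_eqF //.
  by apply: eq_bigl => e; rewrite andbA.
apply: le_trans (slots_value den8_gt0 t0_ge0 _ _); last first.
- move=> g /mapP[j]; rewrite mem_filter => /andP[kj jg] -> /=.
  rewrite /smass -(ltr_nat rat) natr_sumn => h; apply: le_t0.
  have : has (fun e => alive I X e && ((e.1 == i) && (j \in e.2.1))) (ents I).
    by apply/negPn/negP => /hasPn nh; move: h; rewrite big_hasC ?ltxx //; apply/hasPn.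
  move=> /hasP[e eI /and3P[ae /eqP <- je]]; apply: wf_small W _ _ eI _ je.
  by case/andP: ae.
- move=> g /mapP[j]; rewrite mem_filter => /andP[kj jg] -> /=.
  rewrite -(ler_nat rat) sE natrM mulrC ler_pM2r //.
  have : \sum_(e <- ents I | (alive I X e && (e.1 == i)) && (j \in e.2.1)) wt I e <=
     \sum_(e <- ents I | e.1 == i) wt I e.
    rewrite big_mkcond [leRHS]big_mkcond /=; apply: ler_sum => e _.
    by case: (e.1 == i) => /=; rewrite ?andbF //; case: ifP => // _; exact: wt_ge0.
  by rewrite (wf_one W ik); lra.
have -> : \sum_(g <- gshare I X i) (ut I i g.1)%:R * (g.2%:R / (8 * den I)%:R) =
    (\sum_(e <- ents I | alive I X e && (e.1 == i)) wt I e * (aval I X e)%:R) / 8 :> rat.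
  rewrite /gshare big_map big_filter /=.
  have -> : \sum_(j <- goods I | ~~ kill I X j) (ut I i j)%:R * ((smass I X i j)%:R / (8 * den I)%:R) =
    \sum_(j <- goods I | ~~ kill I X j)
      \sum_(e <- ents I | (alive I X e && (e.1 == i)) && (j \in e.2.1)) (ut I i j)%:R * wt I e / 8 :> rat.
    apply: eq_bigr => j _; rewrite -!mulr_suml -mulr_sumr sE natrM; field.
    by rewrite gt_eqF.
  rewrite (exchange_ents _ _ _ _ (fun e j => j \in e.2.1)) mulr_suml big_seq_cond [RHS]big_seq_cond.
  apply: eq_bigr => e /andP[eI /andP[_ /eqP ei]].
  rewrite (sum_entry_goods W _ _ eI) /aval natr_sumn mulr_sumr mulr_suml ei.
  by apply: eq_bigr => j _; rewrite [wt I e * _]mulrC.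
have h1 : tgt I / 2 * live_mass I X i <=
   \sum_(e <- ents I | alive I X e && (e.1 == i)) wt I e * (aval I X e)%:R.
  rewrite /live_mass mulr_sumr; apply: ler_sum => e /andP[/andP[_ h] _].
  rewrite mulrC ler_wpM2l ?wt_ge0 // ler_pdivrMr // /tgt ler_pdivrMr ?ltr0n ?(wf_tden W) //.
  rewrite -!natrM ler_nat; apply: leq_trans h _.
  by rewrite (mulnC (aval I X e)) -mulnA (mulnC (tden I)).
have h2 : 1 <= E%:R * live_mass I X i.
  move: nN; rewrite mem_filter pers_lt ik andbT -leqNgt -(ler_nat rat) natrM => h.
  rewrite /live_mass /wt -mulr_suml mulrA ler_pdivlMr // mul1r.
  by rewrite -natr_sumn.
have tp := tgt_gt0 W; have t00 := t0_ge0; have tt := tgt_t0.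
have h3 : 256 * 6 * t0 <= tgt I * live_mass I X i.
  rewrite -(ler_pM2l e0); apply: (@le_trans _ _ (tgt I)); first by lra.
  by rewrite mulrCA -[leLHS]mulr1 ler_pM2l.
lra.
Qed.

Lemma value_served q : q \in served st ->
  t0 <= \sum_(nd <- slots I q.1 (64 * E) [seq (j, 1%N) | j <- q.2]) (nd.2.1)%:R.
Proof.
move=> qs; have e0 := ratE_gt0 W.
have [[_ _ hs _ _] _] := prun_spec W; have [_ _ h3 h4] := hs q qs.
apply: le_trans (slots_value rt64_gt0 t0_ge0 _ _); last first.
- by move=> g /mapP[j jq ->] _ /=; apply: le_t0; exact: h3.
- by move=> g /mapP[j jq ->] /=; exact: rt64_gt0.
rewrite big_map /= -mulr_suml -/(gain I q).
have t00 := t0_ge0.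
have : 6 * t0 <= gain I q * (1%:R / (64 * E)%:R).
  rewrite mulr1n div1r ler_pdivlMr ?ltr0n ?rt64_gt0 // natrM; have := tgt_t0; lra.
by lra.
Qed.

Lemma sub_value i s1 s2 s3 : ns = s1 ++ s2 ++ s3 -> (forall nd, nd \in s2 -> nd.1 = i) ->
  \sum_(nd <- s2) (nd.2.1)%:R <= \sum_(nd <- ns | nd.1 == i) (nd.2.1)%:R :> rat.
Proof.
move=> -> h; rewrite !big_cat /= -[leLHS]add0r lerD ?sumr_ge0 // -[leLHS]addr0 lerD ?sumr_ge0 //.
rewrite big_seq [leRHS]big_seq_cond le_eqVlt; apply/orP; left; apply/eqP; apply: eq_bigl => nd.
by case: (boolP (nd \in s2)) => //= /h ->; rewrite eqxx.
Qed.

Lemma flatten_split (T : eqType) (F : T -> seq node) s x : x \in s ->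
  exists s1 s3, flatten [seq F y | y <- s] = s1 ++ F x ++ s3.
Proof.
elim: s => //= y s IH; rewrite inE => /orP[/eqP <-|/IH[s1 [s3 ->]]].
  by exists [::], (flatten [seq F y | y <- s]).
by exists (F y ++ s1), s3; rewrite !catA.
Qed.

Lemma assign_good i : (i < k)%N ->
  (exists2 j, (i, j) \in assign I ns & j \in adj I i) \/
  tgt I <= (C0 * E)%:R * \sum_(p <- assign I ns | p.1 == i) (ut I i p.2)%:R.
Proof.
move=> ik; have c0 := C0E_gt0.
suff : (i \in bigs I X st) \/ t0 <= \sum_(nd <- ns | nd.1 == i) (nd.2.1)%:R.
  case=> [/assign_big|h]; [by left | right].
  by move: (le_trans h (assign_value i)); rewrite ler_pdivrMr // mulrC.
case: (boolP (i \in needy I X)) => iN; last first.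
  right; apply: le_trans (value_needless ik iN) _.
  have [|s1 [s3 e]] := flatten_split (fun i => slots I i (8 * den I) (gshare I X i))
    (s := [seq i <- pers I | ~~ (i \in needy I X)]) (x := i).
    by rewrite mem_filter iN pers_lt.
  apply: (sub_value (s1 := [seq (i, (0%N, adj I i)) | i <- bigs I X st] ++ s1)
     (s3 := s3 ++ flatten [seq slots I q.1 (64 * rt I) [seq (j, 1%N) | j <- q.2] | q <- served st])).
    by rewrite /ns /nodes e !catA.
  by move=> nd /slots_mem[].
case: (boolP (i \in X)) => iX; last by left; rewrite mem_cat mem_filter iX iN.
have [[hp _ _ _ _] _] := prun_spec W.
rewrite -(perm_mem hp) mem_cat in iX; case/orP: iX => [/mapP[q qs ->]|ir]; last first.
  by left; rewrite mem_cat ir orbT.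
right; apply: le_trans (value_served qs) _.
have [s1 [s3 e]] := flatten_split (fun q => slots I q.1 (64 * rt I) [seq (j, 1%N) | j <- q.2]) qs.
apply: (sub_value (s1 := [seq (i, (0%N, adj I i)) | i <- bigs I X st] ++
   flatten [seq slots I i (8 * den I) (gshare I X i) | i <- [seq i <- pers I | ~~ (i \in needy I X)]] ++ s1)
   (s3 := s3)).
  by rewrite /ns /nodes e -!catA.
by move=> nd /slots_mem[].
Qed.

End Final.

(** * From feasible LP solutions to the algorithm and back *)

(** With z = ln k, the bound ln z = 2 ln (sqrt z) <= 2 sqrt z gives z / ln z >= sqrt z / 2, and [z0]
    is chosen so that sqrt z >= y = M^2 / 2. The summand 2 in [z0] keeps z above 1, hence ln z
    positive. *)
Lemma lambda_large (R : realType) (M : R) : 0 < M ->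
  exists k0 : nat, forall k, (k0 <= k)%N -> M * Num.sqrt k%:R <= lambda R k.
Proof.
move=> M0; pose y : R := M ^+ 2 / 2; pose z0 := y ^+ 2 + 2.
have y0 : 0 < y by rewrite divr_gt0 // exprn_gt0.
exists (Num.truncn (expR z0)).+1 => k kk.
have kz : expR z0 < k%:R.
  have /andP[_ h] := truncn_itv (ltW (expR_gt0 z0)).
  by apply: lt_le_trans h _; rewrite ler_nat.
have k0 : (0 : R) < k%:R by apply: lt_trans kz; exact: expR_gt0.
have zk : z0 < ln k%:R by rewrite -ltr_expR lnK.
set z := ln k%:R in zk *.
have z02 : 2 <= z0 by rewrite lerDr sqr_ge0.
have z1 : 1 < z by lra.
have zp : 0 < z by lra.
have l0 : 0 < ln z by exact: ln_gt0.
have sz : 0 < Num.sqrt z by rewrite sqrtr_gt0.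
have sq : Num.sqrt z ^+ 2 = z by rewrite sqr_sqrtr // ltW.
have ysz : y <= Num.sqrt z.
  rewrite -(ler_pXn2r (isT : (0 < 2)%N)) ?nnegrE ?ltW // sq; move: zk; rewrite /z0; lra.
have lnz : ln z <= 2 * Num.sqrt z.
  have -> : ln z = 2 * ln (Num.sqrt z) by rewrite -[in LHS]sq lnXn // mulr_natl.
  by apply: ler_wpM2l; [exact: ler0n | exact: ltW (ln_sublinear sz)].
have h : M ^+ 2 / 4 <= z / ln z.
  rewrite ler_pdivlMr //.
  have h1 : M ^+ 2 / 4 * ln z <= M ^+ 2 / 4 * (2 * Num.sqrt z).
    by apply: ler_wpM2l lnz; rewrite divr_ge0 ?sqr_ge0.
  have h2 : y * Num.sqrt z <= z by rewrite -[X in _ <= X]sq expr2; apply: ler_wpM2r ysz; exact: ltW.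
  by move: h1 h2; rewrite /y; lra.
rewrite /lambda -/z mulrAC ler_wpM2r ?sqrtr_ge0 //.
have -> : M = 2 * Num.sqrt (M ^+ 2 / 4).
  have -> : M ^+ 2 / 4 = (M / 2) ^+ 2 by field.
  by rewrite sqrtr_sqr ger0_norm ?divr_ge0 ?ltW //; field.
by rewrite ler_wpM2l // ler_wsqrtr.
Qed.

(** * Translation between the LP data and the instance *)

Section Wrap.
Variables (R : realType) (k m : nat) (u : 'I_k -> 'I_m -> nat) (T : rat).
Variables (x : 'I_k -> {set 'I_m} -> rat) (l : seq ('I_k * {set 'I_m})).

Definition rent (p : 'I_k * {set 'I_m}) : rentry :=
  (val p.1, ([seq val j | j <- enum p.2],
    ((`|numq (x p.1 p.2)|%N, `|denq (x p.1 p.2)|%N), tt))).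
Definition rinp : rinput :=
  (k, (m, ([seq [seq u i j | j <- enum 'I_m] | i <- enum 'I_k],
    ((`|numq T|%N, `|denq T|%N), ([seq rent p | p <- l], tt))))).

(** An equality of S-expressions, so the program for [main] runs on the given input without any
    conversion. *)
Lemma encode_rinp : encode rinp = enc_input u T x l.
Proof.
rewrite /enc_input /= /rinp /encode /= /enc_pair /= /encode /= /enc_seq /=.
congr (Pair _ (Pair _ (Pair _ (Pair _ (Pair _ _))))).
  by congr vlist; rewrite -map_comp; apply: eq_map => i /=; rewrite /encode /= /enc_seq -map_comp.
rewrite -map_comp; congr vlist; apply: eq_map => p /=.
by rewrite /enc_entry /= /encode /= -map_comp.
Qed.

Let I := toinst rinp.
Let C0 := (256 * 6)%N.

Hypothesis T0 : 0 < T.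
Hypothesis feas : feasible R u T x.
Hypothesis supp : lists_support x l.
Hypothesis k_large : (2 ^ 32 <= k)%N.
Hypothesis lam : C0%:R * Num.sqrt k%:R <= lambda R k.

Definition en (p : 'I_k * {set 'I_m}) : entry :=
  (val p.1, ([seq val j | j <- enum p.2],
     (`|numq (x p.1 p.2)| * (den I %/ `|denq (x p.1 p.2)|))%N)).

Lemma size_mat : size (mat I) = k.
Proof. by rewrite size_map -cardE card_ord. Qed.

Lemma k_gt0 : (0 < k)%N.
Proof. by apply: leq_trans k_large; rewrite expn_gt0. Qed.

Lemma mat_row (i : 'I_k) : nth [::] (mat I) i = [seq u i j | j <- enum 'I_m].
Proof. by rewrite (nth_map i) ?nth_ord_enum // -cardE card_ord. Qed.

Lemma size_row : size (nth [::] (mat I) 0) = m.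
Proof. by rewrite (mat_row (Ordinal k_gt0)) size_map -cardE card_ord. Qed.

Lemma utE (i : 'I_k) (j : 'I_m) : ut I i j = u i j.
Proof. by rewrite /ut mat_row (nth_map j) ?nth_ord_enum // -cardE card_ord. Qed.

Lemma entsE : ents I = [seq en p | p <- l].
Proof. by rewrite /ents /I /toinst /= -map_comp. Qed.

Lemma x_ge0 i S : 0 <= x i S. Proof. by case: feas. Qed.

Lemma den_gt0 : (0 < den I)%N.
Proof.
rewrite /den /= /rden -map_comp; elim: (l) => //= p s IH.
by rewrite muln_gt0 absz_gt0 denq_neq0.
Qed.

Lemma nat_numq (q : rat) : 0 <= q -> q = `|numq q|%N%:R / `|denq q|%N%:R.
Proof.
move=> q0; rewrite -[LHS]divq_num_den.
have -> : `|numq q|%N%:R = (numq q)%:~R :> rat.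
  by rewrite pmulrn gez0_abs // numq_ge0.
by have -> : `|denq q|%N%:R = (denq q)%:~R :> rat
  by rewrite pmulrn gez0_abs // denq_ge0.
Qed.

Lemma wt_en p : p \in l -> wt I (en p) = x p.1 p.2.
Proof.
move=> pl; set q := x p.1 p.2; rewrite [RHS](nat_numq (x_ge0 _ _)) -/q /wt /en /= -/q.
have dv : (`|denq q| %| den I)%N.
  apply: dvdn_prodn; rewrite /= -map_comp; apply/mapP; exists p => //.
have d0 : `|denq q|%N%:R != 0 :> rat by rewrite pnatr_eq0 absz_eq0 denq_neq0.
have D0 : (den I)%:R != 0 :> rat by rewrite pnatr_eq0 -lt0n den_gt0.
apply: (mulIf D0); rewrite divfK // natrM mulrAC -mulrA; congr (_ * _).
by rewrite -{2}(divnK dv) natrM mulrK // unitfE.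
Qed.

Lemma sum_ents (P : pred entry) :
  \sum_(e <- ents I | P e) wt I e = \sum_i \sum_(S | P (en (i, S))) x i S.
Proof.
have [ul lP] := supp; rewrite entsE big_map.
rewrite big_seq_cond (eq_bigr (fun p => x p.1 p.2)); last first.
  by move=> p /andP[pl _]; rewrite wt_en.
rewrite -big_seq_cond -big_filter big_uniq ?filter_uniq //= pair_big_dep /=.
rewrite [RHS](bigID (fun p => p \in l)) /= [X in _ = _ + X]big1 ?addr0.
  by apply: eq_bigl => -[i S]; rewrite mem_filter.
by move=> [i S] /andP[_]; rewrite lP negbK => /eqP.
Qed.

Lemma enP e : e \in ents I -> exists2 p, e = en p & valid R u T p.1 p.2.
Proof.
rewrite entsE => /mapP[[i S] pl ->]; exists (i, S) => //=.
have [_ lP] := supp; rewrite lP in pl; apply/negPn/negP => nv.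
by have [_ h _ _] := feas; rewrite (h _ _ nv) eqxx in pl.
Qed.

Lemma sgl_en p : sgl (en p) = (#|p.2| == 1%N).
Proof. by rewrite /sgl size_map -cardE. Qed.

Lemma mem_en p (j : 'I_m) : (val j \in (en p).2.1) = (j \in p.2).
Proof. by rewrite mem_map ?mem_enum //; exact: val_inj. Qed.

Lemma rt_sq : (rt I * rt I <= k < (rt I).+1 * (rt I).+1)%N.
Proof. by have := rt_spec I; rewrite size_mat. Qed.

Lemma rt_sqrt : (rt I)%:R <= Num.sqrt (k%:R : R).
Proof.
have /andP[h _] := rt_sq.
rewrite -(ger0_norm (ler0n R (rt I))) -sqrtr_sqr; apply: ler_wsqrtr.
by rewrite -natrX ler_nat -mulnn.
Qed.

Lemma lambda_rt : (C0 * rt I)%:R <= lambda R k.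
Proof. by apply: le_trans lam; rewrite natrM; apply: ler_wpM2l rt_sqrt; exact: ler0n. Qed.

Lemma rt_large : (2 ^ 16 <= rt I)%N.
Proof.
have /andP[_ h] := rt_sq; rewrite leqNgt; apply/negP => lt.
have : ((rt I).+1 * (rt I).+1 <= 2 ^ 16 * 2 ^ 16)%N by apply: leq_mul.
rewrite -expnD => h2; have := leq_trans h h2.
by rewrite ltnNge k_large.
Qed.

Lemma C0rt_gt0 : (0 < C0 * rt I)%N.
Proof. by rewrite !muln_gt0 /=; apply: leq_trans rt_large; rewrite expn_gt0. Qed.

Lemma lambda_gt0 : 0 < lambda R k.
Proof. by apply: lt_le_trans lambda_rt; rewrite ltr0n C0rt_gt0. Qed.

Lemma tgtE : tgt I = T.
Proof. by rewrite [RHS](nat_numq (ltW T0)). Qed.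

Lemma le_scaled (a : nat) : a%:R < ratr T / lambda R k -> (C0 * rt I)%:R * a%:R <= T.
Proof.
rewrite ltr_pdivlMr ?lambda_gt0 // => h.
rewrite -(ler_rat R) rmorphM /= !ratr_nat; apply: le_trans (ltW h); rewrite mulrC.
by apply: ler_wpM2l lambda_rt; exact: ler0n.
Qed.

(** The split by cardinality agrees with the split into big and small: one small good of value at
    least [T] would contradict [C0 * rt I > 1]. *)
Lemma valid_cases i S : valid R u T i S ->
  if #|S| == 1%N then exists2 j, S = [set j] & big R u T i j
  else T <= (util u i S)%:R /\ forall j, j \in S -> small R u T i j.
Proof.
rewrite /valid; case: ifP => S1; last first.
  case/orP => [/andP[/forallP h ->]|/existsP[j /andP[/eqP e _]]].
    by split=> // j jS; have := h j; rewrite jS.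
  by rewrite e cards1 in S1.
case/cards1P: S1 => j ->; case/orP => [/andP[/forallP/(_ j)]|/existsP[j' /andP[/eqP e h]]]; last by exists j'.
rewrite inE eqxx /= /small => h; rewrite /util big_set1 => h2.
have := le_scaled h.
have : (0 : rat) <= (u i j)%:R by [].
have : (1 : rat) < (C0 * rt I)%:R.
  rewrite ltr1n; apply: leq_trans (_ : 1 * rt I <= _)%N; last by rewrite leq_mul2r orbT.
  by rewrite mul1n; apply: leq_trans rt_large; rewrite (leq_exp2l 1).
move=> A1 B0 h3; have := le_trans h3 h2; rewrite leNgt ltr_pMl ?A1 //.
exact: lt_le_trans T0 h2.
Qed.

Lemma wf_toinst : wf I C0.
Proof.
have [_ xv xc xs] := feas.
split; rewrite ?size_mat ?size_row ?tgtE.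
- exact: leqnn.
- exact: rt_large.
- exact: den_gt0.
- by rewrite /tnum /= absz_gt0 numq_eq0 gt_eqF.
- by rewrite /tden /= absz_gt0 denq_neq0.
- by move=> e /enP[[i S] -> _] /=.
- move=> e /enP[[i S] -> _] /=; rewrite map_inj_uniq ?enum_uniq //; exact: val_inj.
- by move=> e j /enP[[i S] -> _] /= /mapP[j' _ ->].
- move=> i ik; rewrite sum_ents -(xs (Ordinal ik)) (bigD1 (Ordinal ik)) //= [X in _ + X]big1 ?addr0.
    rewrite [LHS](bigID (valid R u T (Ordinal ik))) /= [X in _ + X]big1 ?addr0; last by move=> S /andP[_]; exact: xv.
    by apply: eq_bigl => S; rewrite eqxx.
  by move=> i' ne; rewrite big_pred0 // => S /=; apply: contraNF ne => /eqP h; apply/eqP/val_inj.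
- move=> j jm; rewrite sum_ents; apply: le_trans (xc (Ordinal jm)); apply: ler_sum => i _.
  rewrite [leLHS](bigID (valid R u T i)) /= [X in _ + X]big1 ?addr0; last by move=> S /andP[_]; exact: xv.
  rewrite le_eqVlt; apply/orP; left; apply/eqP; apply: eq_bigl => S.
  by rewrite andbC -(mem_en (i, S)).
- move=> e /enP[[i S] -> v]; rewrite sgl_en /= => n1.
  have := valid_cases v; rewrite (negbTE n1) => -[h _]; apply: le_trans h _.
  rewrite /util natr_sum big_map -big_enum /= le_eqVlt; apply/orP; left; apply/eqP.
  by apply: eq_bigr => j _; rewrite utE.
- move=> e j /enP[[i S] -> v]; rewrite sgl_en /= => n1 /mapP[j' jS ->]; rewrite mem_enum in jS.
  have := valid_cases v; rewrite (negbTE n1) => -[_ h]; rewrite utE; exact: le_scaled (h j' jS).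
Qed.

Let sol := main rinp.

Lemma solE : sol = assign I (nodes I (tightfix I) (prun I (tightfix I))).
Proof. by []. Qed.

Lemma sol_ords : exists l' : seq ('I_k * 'I_m), sol = [seq (val p.1, val p.2) | p <- l'].
Proof.
have : forall p, p \in sol -> (p.1 < k)%N && (p.2 < m)%N.
  move=> [i j]; rewrite solE => /(assign_pers wf_toinst)[h1 h2] /=.
  by rewrite -[X in (i < X)%N]size_mat h1 -size_row -goods_lt.
elim: sol => [|[i j] s IH] h; first by exists [::].
have [|l' ->] := IH; first by move=> p ps; apply: h; rewrite inE ps orbT.
have /andP[ik jm] := h (i, j) (mem_head _ _).
by exists ((Ordinal ik, Ordinal jm) :: l').
Qed.

Definition alloc (i : 'I_k) : {set 'I_m} := [set j : 'I_m | (val i, val j) \in sol].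

Lemma sol_fun i i' j : (i, j) \in sol -> (i', j) \in sol -> i = i'.
Proof.
have : uniq [seq p.2 | p <- sol] by rewrite solE; exact: assign_uniq.
elim: sol => //= p s IH /andP[ns us]; rewrite !inE => /orP[/eqP e|h] /orP[/eqP e'|h'].
- by rewrite -e in e'; case: e'.
- by case/negP: ns; rewrite -e; apply: (map_f _ h').
- by case/negP: ns; rewrite -e'; apply: (map_f _ h).
- exact: IH.
Qed.

Lemma alloc_allocation : allocation alloc.
Proof.
move=> i i' ne; rewrite -setI_eq0; apply/eqP/setP => j; rewrite !inE.
apply/negP => /andP[h h']; case/eqP: ne; apply: val_inj; exact: sol_fun h h'.
Qed.

Lemma alloc_decodes : decodes_to (encode sol) alloc.
Proof.
have [l' e] := sol_ords; exists l'; split.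
  by rewrite e /encode /= /enc_seq -map_comp.
move=> i j; rewrite inE e; apply/mapP/idP => [[[i' j'] h [/val_inj -> /val_inj ->]]//|h].
by exists (i, j).
Qed.

Lemma util_alloc (i : 'I_k) :
  (\sum_(p <- sol | p.1 == val i) (ut I i p.2)%:R : rat) <= (util u i (alloc i))%:R.
Proof.
have ul : uniq sol.
  by apply: (map_uniq (f := snd)); rewrite solE; exact: assign_uniq.
have [l' e] := sol_ords.
have ul' : uniq l' by move: ul; rewrite e; exact: map_uniq.
rewrite e big_map /util natr_sum.
have -> : \sum_(p <- l' | (val p.1, val p.2).1 == val i) (ut I i (val p.1, val p.2).2)%:R =
   \sum_(p <- [seq p <- l' | p.1 == i]) (u i p.2)%:R :> rat.
  by rewrite big_filter; apply: eq_big => [p|p _] //=; rewrite utE.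
rewrite -(big_map snd xpredT (fun j => (u i j)%:R)).
rewrite big_uniq /=; last first.
  rewrite map_inj_in_uniq ?filter_uniq // => -[i1 j1] [i2 j2] /=.
  by rewrite !mem_filter /= => /andP[/eqP -> _] /andP[/eqP -> _] ->.
rewrite le_eqVlt; apply/orP; left; apply/eqP; apply: eq_bigl => j; rewrite inE e.
apply/mapP/mapP => [[[i1 j1]]|[[i1 j1] h [h1 h2]]].
  by rewrite mem_filter => /andP[/eqP /= -> h] ->; exists (i, j1).
by exists (i1, j1); rewrite ?mem_filter ?h ?andbT /=; [apply/eqP/val_inj | apply: val_inj].
Qed.

(** A good obtained through [adj] comes from a valid singleton, so it is big and suffices alone.
    Otherwise the value is at least T / (C0 E), and [C0 * E] is at most [lambda]. *)
Lemma alloc_good (i : 'I_k) : ratr T / lambda R k <= (util u i (alloc i))%:R.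
Proof.
have lg := lambda_gt0; have cg := C0rt_gt0.
have := assign_good wf_toinst (i := val i); rewrite size_mat => /(_ (ltn_ord i)).
rewrite -solE tgtE; case=> [[j jsol]|h].
  rewrite mem_filter => /andP[/hasP[e /enP[[i' S] -> v] /and3P[s1 /eqP ei je]] jg].
  have {}ei : i' = i by apply: val_inj.
  move: s1 je v; rewrite ei sgl_en /= => s1 /mapP[j' j'S ej] /valid_cases; rewrite s1 => -[j'' eS].
  rewrite mem_enum eS inE in j'S; rewrite -(eqP j'S) /big /small -leNgt => /le_trans; apply.
  by rewrite ler_nat /util (bigD1 j') ?leq_addr //= inE; move: jsol; rewrite ej.
rewrite ler_pdivrMr // mulrC.
have := le_trans h (ler_wpM2l (ler0n _ _) (util_alloc i)).
rewrite -(ler_rat R) rmorphM /= !ratr_nat => /le_trans; apply.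
by apply: ler_wpM2r lambda_rt; exact: ler0n.
Qed.

End Wrap.

Theorem theorem11 (R : realType) (d : nat) :
  exists (prog : cmd) (a b k0 : nat) (c : R),
    0 < c /\
    forall (k m : nat) (u : 'I_k -> 'I_m -> nat) (T : rat)
           (x : 'I_k -> {set 'I_m} -> rat) (l : seq ('I_k * {set 'I_m})),
      (k0 <= k)%N -> 0 < T -> feasible R u T x -> lists_support x l ->
      let input := enc_input u T x l in
      let N := (a * vsize input ^ b)%N in
      exists A : N.-tuple bool -> 'I_k -> {set 'I_m},
        (forall w : N.-tuple bool,
           allocation (A w) /\
           exists (o : sexp) (t : nat),
             [/\ runs prog input w o t, (t <= N)%N & decodes_to o (A w)]) /\
        1 - k%:R ^- d <=
          Pr R (fun w : N.-tuple bool =>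
            [forall i, ratr T / (c * Num.sqrt (k%:R * ln k%:R / ln (ln k%:R)))
                         <= (util u i (A w i))%:R]).
Proof.
have [[prog [n [tm [[ce tmP] run]]]] _] := PT_main.
have [k1 k1P] : exists k1 : nat, forall k, (k1 <= k)%N ->
    (256 * 6)%N%:R * Num.sqrt k%:R <= lambda R k.
  by apply: lambda_large; rewrite ltr0n.
(* Sizes are positive, so (size + 1)^ce <= 2^ce size^ce. The bound 2^32 on [k] yields E >= 2^16, and
   the final 2 is the leading factor of [lambda]. *)
exists prog, (2 ^ ce)%N, ce, (maxn k1 (2 ^ 32)), 2; split; first exact: ltr0n.
move=> k m u T x l; rewrite geq_max => /andP[/k1P lam k2] T0 feas supp input N.
(* One allocation for all tapes: the event then contains every tape and has probability 1. *)
exists (fun=> alloc u T x l); split.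
  move=> w; split; first exact: alloc_allocation.
  have [s' [t [ex tt out _]]] := run (rinp u T x l)
    (upd (fun=> Nat 0) 0 input) w (esym (encode_rinp u T x l)).
  exists (encode (main (rinp u T x l))), t; split.
  - by exists s', w.
  - apply: leq_trans tt (leq_trans (tmP _) _).
    rewrite /N -expnMn; apply: leq_expl.
    rewrite /esize encode_rinp -/input mul2n -addnn -addn1 leq_add2l; exact: vsize_gt0.
  - exact: alloc_decodes T0 feas supp k2 lam.
rewrite /Pr (_ : [set w | _] = setT); last first.
  apply/setP => w; rewrite !inE; apply/forallP => i.
  rewrite -mulrA sqrtrM ?ler0n // mulrA.
  exact: alloc_good T0 feas supp k2 lam i.
rewrite cardsT card_tuple card_bool natrX divff ?expf_neq0 ?pnatr_eq0 //.
by rewrite lerBlDr lerDl invr_ge0 exprn_ge0 // ler0n.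
Qed.
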